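(* Let $\widehat\alpha$ denote the smallest number among all $\alpha_{n,j}>0$ satisfying \[ \alpha_{n,j}=\frac{-a_j\beta_{n,j}}{b\sin\beta_{n,j}}, \] where $a_j:=a+\mu_j$, $\mu_j$ is an eigenvalue of $C:=Dh(0)$, and $\beta_{n,j}>0$ is a solution of \[ \beta_{n,j}=\frac{a_j(\cos\beta_{n,j}-1)}{\sin\beta_{n,j}} \] for some $j\in\{0,1,\dots,r\}$. If $a_j>0$ for all $j=0,1,\dots,r$, then the trivial consensus equilibrium $x\equiv 0$ of \[ \dot x(t)=-a\,x(t)-\alpha\,\mathbf f\!\left(\int_0^1 x(t-s)\,ds\right)-h(x(t)),\qquad x(t)\in\mathbb R^n, \] is locally asymptotically stable for all $\alpha\in(0,\widehat\alpha)$.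
   Context: Let $\Gamma_0\le S_n$ be a finite group acting on $V=\mathbb R^n$ by permuting components, $\sigma(x_1,\dots,x_n)^T=(x_{\sigma(1)},\dots,x_{\sigma(n)})^T$. In the delay equation of the claim, $a>0$ is a constant, $\alpha$ is a real parameter, $\mathbf f(x)=(f(x_1),\dots,f(x_n))^T$ for a function $f:\mathbb R\to\mathbb R$, and $h:\mathbb R^n\to\mathbb R^n$. Standing assumptions: (1) $\mathbf f$ and $h$ are odd; (2) $\mathbf f$ and $h$ are everywhere continuous and differentiable at $0$, with $b:=f'(0)>0$ and $C:=Dh(0)$ a symmetric matrix; (3) $h$ is $\Gamma_0$-equivariant; (4) the spectrum of $C$ is $\{\mu_0,\mu_1,\dots,\mu_r\}$ and the eigenspaces $E(\mu_j)$ coincide with the isotypic components $V_j$ of the $\Gamma_0\times\mathbb Z_2$-isotypic decomposition $V=V_0\oplus\dots\oplus V_r$ (with $\mathbb Z_2$ acting antipodally). A consensus state is a state $x\in\mathbb R^n$ with $x_1=\dots=x_n$; $x\equiv 0$ is the trivial consensus equilibrium. *)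

(* Defs.v *)
From mathcomp Require Import all_boot all_order all_algebra all_fingroup.
From mathcomp Require Import mxrepresentation.
From mathcomp Require Import all_classical all_reals all_analysis.

Set Implicit Arguments.
Unset Strict Implicit.
Unset Printing Implicit Defensive.

Import Order.TTheory GRing.Theory Num.Theory.
Import numFieldNormedType.Exports.

Local Open Scope classical_set_scope.
Local Open Scope ring_scope.

(* Vectors of R^n are row vectors, as in mathcomp.analysis.derive: there
   jacobian h p acts by v *m jacobian h p, so it is the transpose of the usual
   matrix Dh(p); the two agree when Dh(p) is symmetric. *)

Section SignedPermutationRepresentation.
Variables (R : realType) (n : nat) (Gamma : {group 'S_n}).

(* Gamma x Z_2, with 'Z_2 viewed as its (additive) group. *)
Definition perm_sign_group : {group 'S_n * 'Z_2} := setX_group Gamma [set: 'Z_2].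

(* Permutation of the components, Z_2 acting by -1.  On row vectors,
   x *m perm_mx s = col_perm s^-1 x; the passage from s to s^-1 changes neither
   the submodules nor the intertwining maps. *)
Definition perm_sign_mx (g : 'S_n * 'Z_2) : 'M[R]_n :=
  (-1) ^+ (g.2 : nat) *: perm_mx g.1.

Lemma perm_sign_mx_repr : mx_repr perm_sign_group perm_sign_mx.
Proof.
split=> [|[s k] [t l] _ _]; first by rewrite /perm_sign_mx perm_mx1 scale1r.
rewrite /perm_sign_mx /= perm_mxM -scalemxAl -scalemxAr scalerA -exprD.
by congr (_ *: _); rewrite -signr_odd -[RHS]signr_odd modn2 oddb.
Qed.

Definition perm_sign_repr : mx_representation R perm_sign_group n :=
  MxRepresentation perm_sign_mx_repr.

End SignedPermutationRepresentation.

(* Subspaces are represented by the row spaces of square matrices. *)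
Definition isotypic_decomposition (F : fieldType) (gT : finGroupType)
    (G : {group gT}) (n : nat) (rG : mx_representation F G n)
    (m : nat) (V : 'I_m -> 'M[F]_n) : Prop :=
  [/\ forall j, exists2 M, mxsimple rG M & (V j :=: component_mx rG M)%MS,
      mxdirect (\sum_j V j)%MS &
      (\sum_j V j :=: 1%:M)%MS].

Section DelayEquation.
Variables (R : realType) (n : nat).
Local Notation V := 'rV[R]_n.

(* G x t, which may depend on the values of x on [t - 1, t], is the right-hand
   side of the equation x'(t) = G x t with maximal delay 1.  A solution with
   history phi on [-1, 0] lives on [-1, T[, where T may be +oo; its values
   elsewhere are irrelevant. *)
Definition dde_solution (G : (R -> V) -> R -> V) (phi : R -> V) (T : \bar R)
    (x : R -> V) : Prop :=
  [/\ (0 < T)%E,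
      {in `[-1, 0], forall s, x s = phi s},
      {within [set t : R | -1 <= t /\ (t%:E < T)%E], continuous x} &
      forall t : R, 0 < t -> (t%:E < T)%E -> is_derive t 1 x (G x t)].

Definition near_history (xe : V) (delta : R) (phi : R -> V) : Prop :=
  {within `[-1, 0], continuous phi} /\
  {in `[-1, 0], forall s, `|phi s - xe| < delta}.

(* Uniqueness of solutions is not assumed: the conditions bear on every
   solution with a given history, and global existence is required. *)
Definition stable (G : (R -> V) -> R -> V) (xe : V) : Prop :=
  forall eps : R, 0 < eps -> exists2 delta : R, 0 < delta &
    forall phi, near_history xe delta phi ->
      (exists x, dde_solution G phi +oo%E x) /\
      (forall T x, dde_solution G phi T x ->
         forall t : R, 0 <= t -> (t%:E < T)%E -> `|x t - xe| < eps).

Definition locally_attractive (G : (R -> V) -> R -> V) (xe : V) : Prop :=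
  exists2 delta : R, 0 < delta &
    forall phi, near_history xe delta phi ->
      forall x, dde_solution G phi +oo%E x -> x t @[t --> +oo] --> xe.

Definition locally_asymptotically_stable (G : (R -> V) -> R -> V) (xe : V) :
    Prop :=
  stable G xe /\ locally_attractive G xe.

Definition componentwise (f : R -> R) (x : V) : V := map_mx f x.

Definition consensus_rhs (a alpha : R) (f : R -> R) (h : V -> V)
    (x : R -> V) (t : R) : V :=
  - (a *: x t)
  - alpha *: componentwise f
      (\row_i (\int[lebesgue_measure]_(s in `[0, 1]) (x (t - s) 0 i)))
  - h (x t).

End DelayEquation.

(* The positive values of alpha for which the characteristic equation
   l + (a + mu_j) + alpha b (1 - exp(- l)) / l = 0 of the linearization at 0
   has a root l = i beta, beta > 0. *)
Definition critical_alphas (R : realType) (a b : R) (r : nat)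
    (mu : 'I_r.+1 -> R) : set R :=
  [set al | 0 < al /\ exists j : 'I_r.+1, exists beta : R,
     [/\ 0 < beta, sin beta != 0,
         beta = (a + mu j) * (cos beta - 1) / sin beta &
         al = - (a + mu j) * beta / (b * sin beta)]].

(* Main.v *)
(** In an eigenbasis of [C] the linearization at [0] splits into the scalar equations
[y'(t) + A y(t) + k \int_(t-1)^t y = 0] with [A = a + mu_j > 0], [k = alpha b].  Each
has a quadratic functional [W] of the history whose derivative along solutions is
[- (2 A / k) y(t)^2 - y(t-1)^2 - \int_(t-1)^t y^2]; its kernel solves a linear
boundary value problem, explicitly, because the reflection [s |-> -1 - s] decouples
the even and odd parts.  The only denominator is [A c1(1/2) + c0(1/2)] (with
generalized cosine [c0] and sine [c1]), whose first zero as a function of the delay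
is the first purely imaginary characteristic root; [alpha < alphahat] excludes it for
all delays [tau] in [(0, 1]].  The functional is positive for small [tau], and when it
is nonnegative its dissipation makes it coercive, so positivity persists up to
[tau = 1].  Summing over the eigenbasis, [W] decays exponentially along the nonlinear
equation as long as the state is small.  Global existence comes from limits of Euler
polygons for the field truncated to the unit ball, where decay keeps the solution. *)

Require Import Defs.
From mathcomp Require Import all_boot all_order all_algebra all_fingroup.
From mathcomp Require Import mxrepresentation.
From mathcomp Require Import all_classical all_reals all_analysis.
From mathcomp Require Import ring lra.

Set Implicit Arguments.
Unset Strict Implicit.
Unset Printing Implicit Defensive.

Import Order.TTheory GRing.Theory Num.Theory.
Import numFieldNormedType.Exports.

Local Open Scope classical_set_scope.
Local Open Scope ring_scope.

(** * Derivatives, primitives and integrals of continuous real functions *)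

Section Calculus.
Variable R : realType.
Implicit Types (f g u v w : R -> R) (a b c t : R).

(** Positivity of [W] cannot be read off its kernel, hence the detour through shorter delays. The
    main part [V] of [W] is found by prescribing [V' = - (2 + 2 A / k) y(t)^2] along solutions:
    requiring every cross term of the derivative to vanish dictates the differential equation of the
    kernel, its boundary values and the coefficient [p]. The added term [\int (2 + s) y(t + s)^2 ds]
    spends the constant 2 of that dissipation to buy dissipation of the whole window, which
    coercivity needs. For a delay [tau] near 0 the coefficient of [y(t)^2] grows like
    [1 / (tau^2 k)] while the remaining kernels stay bounded, which starts the continuation. The
    field sees the past only through [z(t) = \int_(t-1)^t x], and [z' = x(t) - x(t-1)]. It is
    therefore handled throughout as a map [G v z] of present value and window integral, both for
    decay and for existence. The same decay estimate serves twice: for the original field it bounds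
    every solution, for the truncated one it shows that the truncation is never felt. *)

Lemma derive_cont f t (d : R) : is_derive t 1 f d -> {for t, continuous f}.
Proof. by move=> h; apply/differentiable_continuous/derivable1_diffP. Qed.

Lemma derive_addf f g t (d e : R) : is_derive t 1 f d -> is_derive t 1 g e ->
  is_derive t 1 (fun s => f s + g s) (d + e).
Proof. by move=> hf hg; apply: is_deriveD. Qed.

Lemma derive_subf f g t (d e : R) : is_derive t 1 f d -> is_derive t 1 g e ->
  is_derive t 1 (fun s => f s - g s) (d - e).
Proof. by move=> hf hg; apply: is_deriveB. Qed.

Lemma derive_mulf f g t (d e : R) : is_derive t 1 f d -> is_derive t 1 g e ->
  is_derive t 1 (fun s => f s * g s) (d * g t + f t * e).
Proof.
move=> hf hg; apply: (is_derive_eq (is_deriveM hf hg)).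
by rewrite addrC; congr (_ + _); exact: mulrC.
Qed.

Lemma derive_cmulf c f t (d : R) : is_derive t 1 f d ->
  is_derive t 1 (fun s => c * f s) (c * d).
Proof. by move=> hf; apply: (@is_deriveZ _ _ _ f c). Qed.

Lemma derive_cstf c t : is_derive t 1 (fun=> c) (0 : R).
Proof. exact: is_derive_cst. Qed.

Lemma derive_idf t : is_derive t 1 (fun s : R => s) (1 : R).
Proof. exact: is_derive_id. Qed.

Lemma derive_compf f g t (d e : R) : is_derive (g t) 1 f d ->
  is_derive t 1 g e -> is_derive t 1 (fun s => f (g s)) (d * e).
Proof. by move=> hf hg; apply: (@is_derive1_comp R f g). Qed.

Lemma derive_shiftf f c t (d : R) : is_derive (t - c) 1 f d ->
  is_derive t 1 (fun s => f (s - c)) d.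
Proof.
move=> hf; rewrite -[d]mulr1; apply: (@derive_compf f (fun s => s - c)) => //.
rewrite -[1 in X in is_derive _ _ _ X](subr0 1).
exact: derive_subf (derive_idf _) (derive_cstf _ _).
Qed.

Lemma derive_sumf (I : Type) (s : seq I) (F : I -> R -> R) (d : I -> R) t :
  (forall i, is_derive t 1 (F i) (d i)) ->
  is_derive t 1 (fun x => \sum_(i <- s) F i x) (\sum_(i <- s) d i).
Proof.
move=> hF; elim: s => [|i s IH].
  rewrite big_nil (_ : (fun x => _) = fun=> 0); first exact: derive_cstf.
  by apply/funext => x; rewrite big_nil.
rewrite big_cons (_ : (fun x => _) = fun x => F i x + \sum_(j <- s) F j x).
  exact: derive_addf.
by apply/funext => x; rewrite big_cons.
Qed.

Lemma derive_le f (d : R -> R) a b : a <= b ->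
  {within `[a, b], continuous f} ->
  (forall t, a < t < b -> is_derive t 1 f (d t)) ->
  (forall t, a < t < b -> d t <= 0) -> f b <= f a.
Proof.
rewrite le_eqVlt => /predU1P[->//|ab] fc fd d0.
have fd' t : t \in `]a, b[ -> is_derive t 1 f (d t).
  by rewrite in_itv/=; exact: fd.
have [t] := MVT ab fd' fc; rewrite in_itv/= => tab e; rewrite -subr_le0 e.
by rewrite mulr_le0_ge0 ?d0// subr_ge0 ltW.
Qed.

Lemma cont_within f a b : continuous f -> {within `[a, b], continuous f}.
Proof. by move=> fc; apply: continuous_subspaceT. Qed.

Lemma cont_addf f g : continuous f -> continuous g ->
  continuous (fun s => f s + g s).
Proof. by move=> cf cg t; apply: cvgD; [exact: cf|exact: cg]. Qed.

Lemma cont_subf f g : continuous f -> continuous g ->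
  continuous (fun s => f s - g s).
Proof. by move=> cf cg t; apply: cvgB; [exact: cf|exact: cg]. Qed.

Lemma cont_mulf f g : continuous f -> continuous g ->
  continuous (fun s => f s * g s).
Proof. by move=> cf cg t; apply: cvgM; [exact: cf|exact: cg]. Qed.

Lemma cont_cmulf c f : continuous f -> continuous (fun s => c * f s).
Proof. by move=> cf; apply: cont_mulf => //; exact: cst_continuous. Qed.

Lemma cont_shiftf f c : continuous f -> continuous (fun s => f (s - c)).
Proof.
move=> cf t; apply: (@continuous_comp _ _ _ (fun s => s - c) f); last exact: cf.
by apply: cont_subf => [x|x]; [exact: cvg_id|exact: cst_continuous].
Qed.

Lemma cont_reflf f c : continuous f -> continuous (fun s => f (c - s)).
Proof.
move=> cf t; apply: (@continuous_comp _ _ _ (fun s => c - s) f); last exact: cf.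
by apply: cont_subf => [x|x]; [exact: cst_continuous|exact: cvg_id].
Qed.

Lemma cont_sumf (I : Type) (s : seq I) (F : I -> R -> R) :
  (forall i, continuous (F i)) -> continuous (fun x => \sum_(i <- s) F i x).
Proof.
move=> hF; elim: s => [|i s IH].
  rewrite (_ : (fun x => _) = fun=> 0); first exact: cst_continuous.
  by apply/funext => x; rewrite big_nil.
rewrite (_ : (fun x => _) = fun x => F i x + \sum_(j <- s) F j x).
  exact: cont_addf.
by apply/funext => x; rewrite big_cons.
Qed.

Local Notation mu := (@lebesgue_measure R).

Lemma cont_integrable u a b : continuous u ->
  mu.-integrable `[a, b] (EFin \o u).
Proof.
move=> cu; apply: continuous_compact_integrable; first exact: segment_compact.
exact: cont_within.
Qed.

Lemma Rintegral_split u a c b : continuous u -> a <= c -> c <= b ->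
  \int[mu]_(x in `[a, b]) u x =
  \int[mu]_(x in `[a, c]) u x + \int[mu]_(x in `[c, b]) u x.
Proof.
move=> cu ac cb; apply/eqP; rewrite addrC -subr_eq; apply/eqP.
rewrite (@Rintegral_itvB _ u (BLeft a) (BRight b) c) ?bnd_simp//; last first.
  exact: cont_integrable.
rewrite Rintegral_itv_obnd_cbnd//.
apply: (integrableS _ _ _ (cont_integrable c b cu)) => //.
by move=> x /=; rewrite !in_itv/= => /andP[/ltW -> ->].
Qed.

(** The integral over [[a, t]] is a primitive only to the right of [a], so the base point
    [- |t| - 1] moves with [t], staying left of both [t] and [0]; subtracting the value at [0] makes
    the result independent of it. *)
Lemma primitive_exists u : continuous u ->
  exists U : R -> R, forall t, is_derive t 1 U (u t).
Proof.
move=> cu.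
pose F a t : R := \int[mu]_(x in `[a, t]) u x.
pose U t := F (- `|t| - 1) t - F (- `|t| - 1) 0.
have FE a a' t : a' <= a -> a <= 0 -> a <= t ->
    F a' t - F a' 0 = F a t - F a 0.
  move=> a'a a0 at0; rewrite /F (@Rintegral_split _ a' a t)//.
  by rewrite (@Rintegral_split _ a' a 0)//; ring.
exists U => t.
pose a := - `|t| - 2.
have at0 : a < t.
  by rewrite /a; have := lerNnormlW (lexx `|t|); lra.
have a0 : a < 0 by rewrite /a; have := normr_ge0 t; lra.
have [dF F'] : derivable (F a) t 1 /\ derive1 (F a) t = u t.
  apply: (@continuous_FTC1_closed R u a t (t + 1)) => //; last exact: cu.
    by rewrite ltrDl.
  exact: cont_integrable.
have dFa : is_derive t 1 (F a) (u t) by apply: DeriveDef; [exact: dF|rewrite -derive1E].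
apply: (@near_eq_is_derive _ _ _ (fun s => F a s - F a 0)); last first.
  by rewrite -[u t]subr0; exact: derive_subf dFa (derive_cstf (F a 0) t).
near=> s; rewrite /U; apply: FE.
- rewrite /a; suff: `|s| < `|t| + 1 by lra.
  suff : `|t - s| < 1 by have := lerB_dist s t; rewrite distrC; lra.
  by near: s; exact: nbhsx_ballx.
- by have := normr_ge0 s; lra.
- by have := lerNnormlW (lexx `|s|); lra.
Unshelve. all: by end_near. Qed.

Definition primitive u : R -> R :=
  xget (fun=> 0) [set U | forall t, is_derive t 1 U (u t)].

Lemma derive_primitive u t : continuous u -> is_derive t 1 (primitive u) (u t).
Proof.
move=> /primitive_exists [U hU].
by rewrite /primitive; case: xgetP => [V -> hV|/(_ U)]; [exact: hV|case].
Qed.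

(** A signed integral: as a difference of values of one primitive it is additive for endpoints in
    any order and differentiable in both of them. *)
Definition Int u a b : R := primitive u b - primitive u a.

Lemma IntE u U a b : continuous u -> (forall t, is_derive t 1 U (u t)) ->
  Int u a b = U b - U a.
Proof.
move=> cu dU; rewrite /Int.
pose D s := primitive u s - U s.
have : D b = D a.
  apply: is_derive_0_is_cst => t; rewrite -(subrr (u t)).
  exact: derive_subf (derive_primitive t cu) (dU t).
by rewrite /D; lra.
Qed.

Lemma Rintegral_Int u a b : a <= b -> continuous u ->
  \int[mu]_(x in `[a, b]) u x = Int u a b.
Proof.
rewrite le_eqVlt => /predU1P[->|ab] cu.
  by rewrite set_itv1 Rintegral_set1 /Int subrr.
have cP : continuous (primitive u).
  by move=> t; exact: derive_cont (derive_primitive t cu).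
rewrite /Rintegral (@continuous_FTC2 R u (primitive u))//.
- exact: cont_within.
- split.
  + by move=> x _; have [] := derive_primitive x cu.
  + by apply: cvg_at_right_filter; exact: cP.
  + by apply: cvg_at_left_filter; exact: cP.
- by move=> x _; rewrite derive1E; have [_ ->] := derive_primitive x cu.
Qed.

Lemma Int_add u a b c : Int u a b + Int u b c = Int u a c.
Proof. by rewrite /Int; ring. Qed.

Lemma derive_Int u a t : continuous u -> is_derive t 1 (Int u a) (u t).
Proof.
move=> cu; rewrite -[u t]subr0.
exact: derive_subf (derive_primitive t cu) (derive_cstf (primitive u a) t).
Qed.

Lemma IntD u v a b : continuous u -> continuous v ->
  Int (fun s => u s + v s) a b = Int u a b + Int v a b.
Proof.
move=> cu cv; have dU t :=
  derive_addf (derive_primitive t cu) (derive_primitive t cv).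
by rewrite (IntE _ _ (cont_addf cu cv) dU) /Int; ring.
Qed.

Lemma IntZ c u a b : continuous u -> Int (fun s => c * u s) a b = c * Int u a b.
Proof.
move=> cu; have dU t := derive_cmulf c (derive_primitive t cu).
by rewrite (IntE _ _ (cont_cmulf (c := c) cu) dU) /Int; ring.
Qed.

Lemma IntB u v a b : continuous u -> continuous v ->
  Int (fun s => u s - v s) a b = Int u a b - Int v a b.
Proof.
move=> cu cv; rewrite (_ : (fun s => _) = fun s => u s + (-1) * v s).
  by rewrite IntD ?IntZ//; [ring|exact: cont_cmulf].
by apply/funext => s; ring.
Qed.

Lemma Int_sum (I : Type) (s : seq I) (F : I -> R -> R) a b :
  (forall i, continuous (F i)) ->
  Int (fun x => \sum_(i <- s) F i x) a b = \sum_(i <- s) Int (F i) a b.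
Proof.
move=> cF; have dU t := derive_sumf s (fun i => derive_primitive t (cF i)).
by rewrite (IntE _ _ (cont_sumf (s := s) cF) dU) -sumrB.
Qed.

Lemma Int_cst c a b : Int (fun=> c) a b = c * (b - a).
Proof.
have dU t : is_derive t 1 (fun s => c * s) c.
  rewrite -[X in is_derive _ _ _ X]mulr1.
  exact: derive_cmulf (derive_idf t).
rewrite (IntE _ _ _ dU); first by ring.
exact: cst_continuous.
Qed.

Lemma le_Int u v a b : a <= b -> continuous u -> continuous v ->
  (forall s, a < s < b -> u s <= v s) -> Int u a b <= Int v a b.
Proof.
move=> ab cu cv uv.
pose D s := primitive u s - primitive v s.
have dD t : is_derive t 1 D (u t - v t).
  exact: derive_subf (derive_primitive t cu) (derive_primitive t cv).
have : D b <= D a.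
  apply: (@derive_le D (fun t => u t - v t)) => //.
    by apply: cont_within => t; exact: derive_cont (dD t).
  by move=> t /uv; rewrite subr_le0.
by rewrite /D /Int; lra.
Qed.

Lemma eq_Int u v a b : a <= b -> continuous u -> continuous v ->
  (forall s, a < s < b -> u s = v s) -> Int u a b = Int v a b.
Proof.
by move=> ab cu cv uv; apply/eqP; rewrite eq_le !le_Int// => s /uv ->.
Qed.

Lemma Int_ge0 u a b : a <= b -> continuous u ->
  (forall s, a < s < b -> 0 <= u s) -> 0 <= Int u a b.
Proof.
move=> ab cu u0; rewrite -[0](mul0r (b - a)) -Int_cst.
by apply: le_Int => //; exact: cst_continuous.
Qed.

Lemma cont_sqrf u : continuous u -> continuous (fun s => u s ^+ 2).
Proof. by move=> cu; exact: cont_mulf. Qed.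

Lemma Int_reflect u a b c : continuous u ->
  Int (fun s => u (c - s)) a b = Int u (c - b) (c - a).
Proof.
move=> cu; have dU t : is_derive t 1 (fun s => - 1 * primitive u (c - s)) (u (c - t)).
  rewrite (_ : u (c - t) = -1 * (u (c - t) * (0 - 1))); last by ring.
  apply: derive_cmulf; apply: (@derive_compf _ (fun s => c - s)).
  exact: derive_primitive.
by rewrite (IntE _ _ (cont_reflf (c := c) cu) dU) /Int; ring.
Qed.

(** Cauchy-Schwarz against the constant 1, obtained from the nonnegative variance of [u] about its
    mean [l]. *)
Lemma sqr_Int_le u a b : a <= b -> continuous u ->
  Int u a b ^+ 2 <= (b - a) * Int (fun s => u s ^+ 2) a b.
Proof.
rewrite le_eqVlt => /predU1P[-> _|ab cu].
  by rewrite /Int !subrr expr0n mul0r.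
set m := Int u a b; pose l := m / (b - a).
have ba0 : b - a != 0 by rewrite subr_eq0 gt_eqF.
have : 0 <= Int (fun s => (u s - l) ^+ 2) a b.
  apply: Int_ge0 => [||s _]; [exact: ltW| |exact: sqr_ge0].
  by apply: cont_sqrf; apply: cont_subf => //; exact: cst_continuous.
rewrite (_ : (fun s => _) = fun s => u s ^+ 2 + ((- 2 * l) * u s + l ^+ 2)); last first.
  by apply/funext => s; ring.
rewrite IntD; [|exact: cont_sqrf|apply: cont_addf]; last first.
- exact: cst_continuous.
- exact: cont_cmulf.
rewrite IntD; [|exact: cont_cmulf|exact: cst_continuous].
rewrite IntZ// Int_cst -/m => h.
have -> : m ^+ 2 = (b - a) * (l * m) by rewrite /l; field.
rewrite ler_pM2l ?subr_gt0// (_ : l ^+ 2 * (b - a) = l * m) in h *; first lra.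
by rewrite /l; field.
Qed.

End Calculus.

(** * Integrals over the moving window [[t - 1, t]] *)

Section Window.
Variable R : realType.
Implicit Types (g h x : R -> R) (t B a b c s u w : R).

(** Finite rank of [g (u - t)]: the variable [t] leaves the integral, so windows are differentiated
    by the product rule and the fundamental theorem alone, without differentiating under the
    integral sign. Polynomials, exponentials, sines and cosines all qualify. *)
Definition separable g : Prop :=
  exists (I : finType) (al dal be : I -> R -> R),
    [/\ forall i t, is_derive t 1 (al i) (dal i t),
        forall i, continuous (be i) &
        forall u t, g (u - t) = \sum_i al i t * be i u].

Lemma separable_cont g : separable g -> continuous g.
Proof.
move=> [I [al [dal [be [dal_ cbe gE]]]]].
rewrite (_ : g = fun u => \sum_i al i 0 * be i u).
  by apply: cont_sumf => i; exact: cont_cmulf.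
by apply/funext => u; rewrite -gE subr0.
Qed.

Lemma separableD g h : separable g -> separable h ->
  separable (fun s => g s + h s).
Proof.
move=> [I [al [dal [be [dalP cbe gE]]]]] [J [al' [dal' [be' [dalP' cbe' hE]]]]].
exists (I + J)%type, (fun k => match k with inl i => al i | inr j => al' j end),
  (fun k => match k with inl i => dal i | inr j => dal' j end),
  (fun k => match k with inl i => be i | inr j => be' j end).
by split=> [[i|j]|[i|j]|u t] //; rewrite big_sumType gE hE.
Qed.

Lemma separableM g h : separable g -> separable h ->
  separable (fun s => g s * h s).
Proof.
move=> [I [al [dal [be [dalP cbe gE]]]]] [J [al' [dal' [be' [dalP' cbe' hE]]]]].
exists (I * J)%type, (fun k t => al k.1 t * al' k.2 t),
  (fun k t => dal k.1 t * al' k.2 t + al k.1 t * dal' k.2 t),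
  (fun k t => be k.1 t * be' k.2 t).
split=> [k t|k|u t]; [exact: derive_mulf|exact: cont_mulf|].
rewrite gE hE big_distrlr pair_big /=.
by apply: eq_bigr => -[i j] _ /=; ring.
Qed.

Lemma separable_cst c : separable (fun=> c).
Proof.
exists unit, (fun _ _ => c), (fun _ _ => 0), (fun _ _ => 1).
split=> [_ t|_|u t]; [exact: derive_cstf|exact: cst_continuous|].
by rewrite (big_pred1 tt) ?mulr1// => -[].
Qed.

Lemma separable_id : separable (fun s => s).
Proof.
exists bool, (fun k t => if k then 1 else - 1 * t), (fun k _ => if k then 0 else - 1),
  (fun k u => if k then u else 1).
split=> [[] t|[]|u t].
- exact: derive_cstf.
- by rewrite -[X in is_derive _ _ _ X]mulr1; exact: derive_cmulf (derive_idf t).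
- by move=> x; exact: cvg_id.
- exact: cst_continuous.
- by rewrite big_bool/=; ring.
Qed.

Lemma separableZ c g : separable g -> separable (fun s => c * g s).
Proof. exact/separableM/separable_cst. Qed.

Lemma derive_lin_comp c g d t : is_derive (c * t) 1 g d ->
  is_derive t 1 (fun s => g (c * s)) (c * d).
Proof.
move=> gd; rewrite mulrC; apply: (derive_compf gd).
by rewrite -[X in is_derive _ _ _ X]mulr1; exact: derive_cmulf (derive_idf t).
Qed.

Lemma cont_lin_comp c g : continuous g -> continuous (fun s => g (c * s)).
Proof.
move=> cg t; apply: (@continuous_comp _ _ _ (fun s => c * s) g); last exact: cg.
by apply: cont_cmulf => s; exact: cvg_id.
Qed.

Lemma separable_exp c : separable (fun s => expR (c * s)).
Proof.
exists unit, (fun _ t => expR (- c * t)), (fun _ t => - c * expR (- c * t)),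
  (fun _ u => expR (c * u)).
split=> [_ t|_|u t].
- exact: derive_lin_comp (is_derive_expR _).
- exact/cont_lin_comp/continuous_expR.
- by rewrite (big_pred1 tt) => [|[]//]; rewrite -expRD; congr expR; ring.
Qed.

Lemma separable_cos c : separable (fun s => cos (c * s)).
Proof.
exists bool, (fun k t => if k then cos (c * t) else sin (c * t)),
  (fun k t => if k then c * - sin (c * t) else c * cos (c * t)),
  (fun k u => if k then cos (c * u) else sin (c * u)).
split=> [[] t|[]|u t].
- exact: derive_lin_comp (is_derive_cos _).
- exact: derive_lin_comp (is_derive_sin _).
- exact/cont_lin_comp/continuous_cos.
- exact/cont_lin_comp/continuous_sin.
- by rewrite big_bool/= mulrBr cosB; ring.
Qed.

Lemma separable_sin c : separable (fun s => sin (c * s)).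
Proof.
exists bool, (fun k t => if k then cos (c * t) else - 1 * sin (c * t)),
  (fun k t => if k then c * - sin (c * t) else - 1 * (c * cos (c * t))),
  (fun k u => if k then sin (c * u) else cos (c * u)).
split=> [[] t|[]|u t].
- exact: derive_lin_comp (is_derive_cos _).
- exact: derive_cmulf (derive_lin_comp (is_derive_sin _)).
- exact/cont_lin_comp/continuous_sin.
- exact/cont_lin_comp/continuous_cos.
- by rewrite big_bool/= mulrBr sinB; ring.
Qed.

Lemma separable_shift c g : separable g -> separable (fun s => g (s - c)).
Proof.
move=> [I [al [dal [be [dalP cbe gE]]]]].
exists I, al, dal, (fun i u => be i (u - c)); split=> // [i|u t].
  exact: cont_shiftf.
by rewrite -gE; congr g; ring.
Qed.

Lemma separable_scale c g : separable g -> separable (fun s => g (c * s)).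
Proof.
move=> [I [al [dal [be [dalP cbe gE]]]]].
exists I, (fun i t => al i (c * t)), (fun i t => c * dal i (c * t)),
  (fun i u => be i (c * u)); split=> // [i t|i|u t].
- exact: derive_lin_comp.
- exact: cont_lin_comp.
- by rewrite -gE; congr g; ring.
Qed.

Definition window g x t : R := Int (fun u => g (u - t) * x u) (t - 1) t.

Definition dwindow g x t : R :=
  Int (fun u => x u * Int (fun w => g (w - u) * x w) (t - 1) u) (t - 1) t.

Lemma derive_Int_window g t : continuous g ->
  is_derive t 1 (fun s => Int g (s - 1) s) (g t - g (t - 1)).
Proof.
move=> cg; have dp s := derive_primitive s cg.
exact: derive_subf (dp t) (derive_shiftf (dp (t - 1))).
Qed.

Lemma derive_window g dg x t : separable g -> continuous dg -> continuous x ->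
  (forall s, is_derive s 1 g (dg s)) ->
  is_derive t 1 (window g x) (g 0 * x t - g (- 1) * x (t - 1) - window dg x t).
Proof.
move=> [I [al [dal [be [dalP cbe gE]]]]] cdg cx gd.
have cbx i : continuous (fun u => be i u * x u) by exact: cont_mulf.
rewrite (_ : window g x =
    fun t => \sum_i al i t * Int (fun u => be i u * x u) (t - 1) t); last first.
  apply/funext => s; rewrite /window.
  rewrite (_ : (fun u => _) = fun u => \sum_i al i s * (be i u * x u)).
    rewrite Int_sum => [|i]; last exact: cont_cmulf.
    by apply: eq_bigr => i _; rewrite IntZ.
  by apply/funext => u; rewrite gE mulr_suml; apply: eq_bigr => i _; ring.
apply: (is_derive_eq (derive_sumf _ (fun i =>
  derive_mulf (dalP i t) (derive_Int_window t (cbx i))))).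
(* Both sides come from differentiating [t |-> g (u - t)], once by the chain rule and once through
   the finite sum. *)
have dgE u : dg (u - t) = - \sum_i dal i t * be i u.
  have d1 : is_derive t 1 (fun s => \sum_i al i s * be i u)
      (\sum_i (dal i t * be i u + al i t * 0)).
    exact: derive_sumf (fun i => derive_mulf (dalP i t) (derive_cstf (be i u) t)).
  have d2 : is_derive t 1 (fun s => g (u - s)) (dg (u - t) * (0 - 1)).
    exact: derive_compf (gd _) (derive_subf (derive_cstf u t) (derive_idf t)).
  move: d1; rewrite (_ : (fun s => _) = fun s => g (u - s)); last first.
    by apply/funext => s; rewrite gE.
  move=> d1; have := @derive_val _ _ _ _ _ _ _ d1.
  rewrite (@derive_val _ _ _ _ _ _ _ d2) => e.
  rewrite -[LHS]opprK; congr (- _); transitivity (dg (u - t) * (0 - 1)); first by ring.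
  by rewrite e; apply: eq_bigr => i _; ring.
rewrite /window (_ : (fun u => _) = fun u => \sum_i (- dal i t) * (be i u * x u)); last first.
  apply/funext => u; rewrite dgE mulNr mulr_suml -sumrN.
  by apply: eq_bigr => i _; ring.
rewrite Int_sum => [|i]; last exact: cont_cmulf.
have -> : g 0 = \sum_i al i t * be i t by rewrite -gE subrr.
have -> : g (-1) = \sum_i al i t * be i (t - 1) by rewrite -gE; congr g; ring.
rewrite !mulr_suml -!sumrB; apply: eq_bigr => i _.
by rewrite IntZ//; ring.
Qed.

Lemma cont_window_from g x t : separable g -> continuous x ->
  continuous (fun u => Int (fun w => g (w - u) * x w) t u).
Proof.
move=> [I [al [dal [be [dalP cbe gE]]]]] cx.
have cbx i : continuous (fun u => be i u * x u) by exact: cont_mulf.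
rewrite (_ : (fun u => _) =
    fun u => \sum_i al i u * Int (fun u => be i u * x u) t u); last first.
  apply/funext => s.
  rewrite (_ : (fun u => _) = fun u => \sum_i al i s * (be i u * x u)).
    rewrite Int_sum => [|i]; last exact: cont_cmulf.
    by apply: eq_bigr => i _; rewrite IntZ.
  by apply/funext => u; rewrite gE mulr_suml; apply: eq_bigr => i _; ring.
apply: cont_sumf => i; apply: cont_mulf => s.
  exact: derive_cont (dalP i s).
exact: derive_cont (derive_Int _ _ (cbx i)).
Qed.

(** The integral is over a triangle [w < u]. Its upper end gives the term in [x t]; the moving lower
    limit of the inner integral gives the term in [x (t - 1)], where the kernel is seen reflected
    because [t - 1 - u = - 1 - (u - t)]. The outer lower limit contributes nothing, the inner
    integral being empty there. *)
Lemma derive_dwindow g x t : separable g -> continuous x ->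
  is_derive t 1 (dwindow g x)
    (x t * window g x t - x (t - 1) * window (fun s => g (- 1 - s)) x t).
Proof.
move=> [I [al [dal [be [dalP cbe gE]]]]] cx.
have cal i : continuous (al i) by move=> s; exact: derive_cont (dalP i s).
have cbx i : continuous (fun u => be i u * x u) by exact: cont_mulf.
have cax i : continuous (fun u => al i u * x u) by exact: cont_mulf.
pose B i := primitive (fun u => be i u * x u).
have dB i s : is_derive s 1 (B i) (be i s * x s) by exact: derive_primitive.
have cB i : continuous (B i) by move=> s; exact: derive_cont (dB i s).
have caxB i : continuous (fun u => al i u * x u * B i u) by exact: cont_mulf.
have inner s u : Int (fun w => g (w - u) * x w) (s - 1) u =
    \sum_i al i u * (B i u - B i (s - 1)).
  rewrite (_ : (fun w => _) = fun w => \sum_i al i u * (be i w * x w)).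
    rewrite Int_sum => [|i]; last exact: cont_cmulf.
    by apply: eq_bigr => i _; rewrite IntZ.
  by apply/funext => w; rewrite gE mulr_suml; apply: eq_bigr => i _; ring.
rewrite (_ : dwindow g x = fun s => \sum_i (
    Int (fun u => al i u * x u * B i u) (s - 1) s
    - B i (s - 1) * Int (fun u => al i u * x u) (s - 1) s)); last first.
  apply/funext => s; rewrite /dwindow.
  rewrite (_ : (fun u => _) = fun u =>
      \sum_i (al i u * x u * B i u - B i (s - 1) * (al i u * x u))).
    rewrite Int_sum => [|i]; last by apply: cont_subf => //; exact: cont_cmulf.
    by apply: eq_bigr => i _; rewrite IntB ?IntZ//; exact: cont_cmulf.
  by apply/funext => u; rewrite inner mulr_sumr; apply: eq_bigr => i _; ring.
apply: (is_derive_eq (derive_sumf _ (fun i =>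
  derive_subf (derive_Int_window t (caxB i))
    (derive_mulf (derive_shiftf (dB i (t - 1))) (derive_Int_window t (cax i)))))).
rewrite /window.
rewrite (_ : (fun u => g (u - t) * x u) = fun u => \sum_i al i t * (be i u * x u)); last first.
  by apply/funext => u; rewrite gE mulr_suml; apply: eq_bigr => i _; ring.
rewrite (_ : (fun u => g (- 1 - (u - t)) * x u) =
    fun u => \sum_i be i (t - 1) * (al i u * x u)); last first.
  apply/funext => u; rewrite (_ : - 1 - (u - t) = t - 1 - u); last by ring.
  by rewrite gE mulr_suml; apply: eq_bigr => i _; ring.
rewrite !Int_sum => [|i|i]; try exact: cont_cmulf.
rewrite !mulr_sumr -!sumrB; apply: eq_bigr => i _.
rewrite !IntZ// (_ : Int (fun u => be i u * x u) (t - 1) t = B i t - B i (t - 1))//.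
by ring.
Qed.

Definition sqwindow x t : R := Int (fun u => x u ^+ 2) (t - 1) t.

Lemma sqwindow_ge0 x t : continuous x -> 0 <= sqwindow x t.
Proof.
move=> cx; apply: Int_ge0 => [||s _]; [lra|exact: cont_sqrf|exact: sqr_ge0].
Qed.

(** The interval lies in one of length 1, so the length factor of Cauchy-Schwarz is at most 1 and
    disappears from all window estimates. *)
Lemma sqr_Int_mul_le g x a b c B : c <= a -> a <= b -> b <= c + 1 ->
  continuous g -> continuous x -> (forall s, a < s < b -> `|g s| <= B) ->
  Int (fun u => g u * x u) a b ^+ 2 <= B ^+ 2 * Int (fun u => x u ^+ 2) c b.
Proof.
move=> ca ab bc cg cx gB.
apply: le_trans (sqr_Int_le ab (cont_mulf cg cx)) _.
apply: (@le_trans _ _ (B ^+ 2 * Int (fun u => x u ^+ 2) a b)).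
  rewrite -[leRHS]mul1r -(IntZ (B ^+ 2)); last exact: cont_sqrf.
  apply: ler_pM; [lra| |lra|].
    apply: Int_ge0 => // [|s _]; last exact: sqr_ge0.
    exact/cont_sqrf/cont_mulf.
  apply: le_Int => // [||s sab].
  - exact/cont_sqrf/cont_mulf.
  - exact/cont_cmulf/cont_sqrf.
  - rewrite exprMn ler_wpM2r ?sqr_ge0// -(real_normK (num_real (g s))).
    by rewrite lerXn2r ?nnegrE ?gB// (le_trans _ (gB s sab)).
rewrite ler_wpM2l ?sqr_ge0// -[X in _ <= X](Int_add _ c a b) lerDr.
by apply: Int_ge0 => [||s _]; [|exact: cont_sqrf|exact: sqr_ge0].
Qed.

Lemma window_bound g x t B : continuous g -> continuous x ->
  (forall s, -1 <= s <= 0 -> `|g s| <= B) ->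
  window g x t ^+ 2 <= B ^+ 2 * sqwindow x t.
Proof.
move=> cg cx gB; apply: sqr_Int_mul_le => //; try lra.
  exact: cont_shiftf.
by move=> s hs; apply: gB; lra.
Qed.

Lemma dwindow_bound g x t B : separable g -> continuous x -> 0 <= B ->
  (forall s, -1 <= s <= 0 -> `|g s| <= B) ->
  `|dwindow g x t| <= B * sqwindow x t.
Proof.
move=> sg cx B0 gB; set Z := sqwindow x t.
have Z0 : 0 <= Z by exact: sqwindow_ge0.
have BZ0 : 0 <= B ^+ 2 * Z by rewrite mulr_ge0 ?sqr_ge0.
rewrite -(ler_pXn2r (n := 2))// ?nnegrE ?mulr_ge0//.
rewrite real_normK ?num_real//.
rewrite exprMn [X in _ * X]expr2 mulrA -(sqr_sqrtr BZ0).
rewrite /dwindow; under [fun u => x u * _]funext do rewrite mulrC.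
apply: sqr_Int_mul_le => //; try lra.
  exact: cont_window_from.
move=> s hs; rewrite -sqrtr_sqr ler_sqrt//.
apply: (@le_trans _ _ (B ^+ 2 * Int (fun u => x u ^+ 2) (t - 1) s)).
  apply: sqr_Int_mul_le => //; try lra.
    exact/cont_shiftf/separable_cont.
  by move=> w hw; apply: gB; lra.
rewrite ler_wpM2l ?sqr_ge0// /Z /sqwindow -(Int_add _ (t - 1) s t) lerDl.
by apply: Int_ge0 => [||w _]; [lra|exact: cont_sqrf|exact: sqr_ge0].
Qed.

Lemma windowD g h x t : continuous g -> continuous h -> continuous x ->
  window (fun s => g s + h s) x t = window g x t + window h x t.
Proof.
move=> cg ch cx; rewrite /window -IntD; last 2 first.
- exact/cont_mulf/cx/cont_shiftf.
- exact/cont_mulf/cx/cont_shiftf.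
by congr Int; apply/funext => u; ring.
Qed.

Lemma windowZ c g x t : continuous g -> continuous x ->
  window (fun s => c * g s) x t = c * window g x t.
Proof.
move=> cg cx; rewrite /window -IntZ; last exact/cont_mulf/cx/cont_shiftf.
by congr Int; apply/funext => u; ring.
Qed.

Lemma dwindowD g h x t : separable g -> separable h -> continuous x ->
  dwindow (fun s => g s + h s) x t = dwindow g x t + dwindow h x t.
Proof.
move=> sg sh cx; rewrite /dwindow -IntD; last 2 first.
- exact/cont_mulf/cont_window_from.
- exact/cont_mulf/cont_window_from.
congr Int; apply/funext => u; rewrite -mulrDr; congr (_ * _).
rewrite -IntD; last 2 first.
- exact/cont_mulf/cx/cont_shiftf/separable_cont.
- exact/cont_mulf/cx/cont_shiftf/separable_cont.
by congr Int; apply/funext => w; ring.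
Qed.

Lemma dwindowZ c g x t : separable g -> continuous x ->
  dwindow (fun s => c * g s) x t = c * dwindow g x t.
Proof.
move=> sg cx; rewrite /dwindow -IntZ; last exact/cont_mulf/cont_window_from.
congr Int; apply/funext => u; rewrite mulrCA; congr (_ * _).
rewrite -IntZ; last exact/cont_mulf/cx/cont_shiftf/separable_cont.
by congr Int; apply/funext => w; ring.
Qed.

End Window.

(** * Generalized sines and cosines and their iterated primitives *)

Section Stumpff.
Variable R : realType.
Implicit Types (kappa s t B : R) (c f : R -> R).

(** The Stumpff functions [c_j(s) = \sum_m (- kappa)^m s^(2m+j) / (2m+j)!], which treat the three
    signs of [kappa] uniformly. Only what the kernel uses is recorded; values at 0 are asked of the
    even ones alone, since parity settles the odd ones. *)
Record stumpff kappa c0 c1 c2 c3 c4 : Prop := Stumpff {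
  stumpff_d1 : forall s, is_derive s 1 c1 (c0 s);
  stumpff_d2 : forall s, is_derive s 1 c2 (c1 s);
  stumpff_d3 : forall s, is_derive s 1 c3 (c2 s);
  stumpff_d4 : forall s, is_derive s 1 c4 (c3 s);
  stumpff_e0 : forall s, c0 s + kappa * c2 s = 1;
  stumpff_e1 : forall s, c1 s + kappa * c3 s = s;
  stumpff_p0 : forall s, c0 (- s) = c0 s;
  stumpff_p1 : forall s, c1 (- s) = - c1 s;
  stumpff_p2 : forall s, c2 (- s) = c2 s;
  stumpff_p3 : forall s, c3 (- s) = - c3 s;
  stumpff_p4 : forall s, c4 (- s) = c4 s;
  stumpff_z2 : c2 0 = 0;
  stumpff_z4 : c4 0 = 0;
  stumpff_s0 : separable c0;
  stumpff_s1 : separable c1;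
  stumpff_s2 : separable c2;
  stumpff_s3 : separable c3;
  stumpff_s4 : separable c4 }.

(** Off [kappa = 0] the relation [c_j + kappa c_(j+2) = s^j / j!] can be solved for [c2], [c3],
    [c4]; the degenerate value is treated separately by polynomials. *)
Lemma stumpff_of kappa c0 c1 : kappa != 0 ->
  (forall s, is_derive s 1 c1 (c0 s)) ->
  (forall s, is_derive s 1 c0 (- kappa * c1 s)) ->
  (forall s, c0 (- s) = c0 s) -> (forall s, c1 (- s) = - c1 s) -> c0 0 = 1 ->
  separable c0 -> separable c1 ->
  stumpff kappa c0 c1 (fun s => kappa^-1 * (1 - c0 s))
    (fun s => kappa^-1 * (s - c1 s))
    (fun s => kappa^-1 * (2^-1 * (s * s) - kappa^-1 * (1 - c0 s))).
Proof.
move=> k0 d1 d0 p0 p1 c00 s0 s1.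
have d2 s : is_derive s 1 (fun s => kappa^-1 * (1 - c0 s)) (c1 s).
  rewrite (_ : c1 s = kappa^-1 * (0 - (- kappa * c1 s))); last by field.
  exact: derive_cmulf (derive_subf (derive_cstf 1 s) (d0 s)).
have sep1 : separable (fun=> 1 : R) by exact: separable_cst.
have sepid : separable (fun s : R => s) by exact: separable_id.
have sepB f g : separable f -> separable g -> separable (fun s : R => f s - g s).
  move=> sf sg; rewrite (_ : (fun s => _) = fun s => f s + (-1) * g s).
    exact/separableD/separableZ.
  by apply/funext => s; ring.
have s2 : separable (fun s => kappa^-1 * (1 - c0 s)) by exact/separableZ/sepB.
split=> //.
- move=> s; apply: (is_derive_eq (derive_cmulf _ (derive_subf (derive_idf s) (d1 s)))).
  by [].
- move=> s; apply: (is_derive_eq (derive_cmulf kappa^-1 (derive_subf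
    (derive_cmulf 2^-1 (derive_mulf (derive_idf s) (derive_idf s))) (d2 s)))).
  by congr (_ * (_ - _)); field.
- by move=> s; field.
- by move=> s; field.
- by move=> s; rewrite p0.
- by move=> s; rewrite p1; ring.
- by move=> s; rewrite p0; congr (_ * (_ - _)); ring.
- by rewrite c00 subrr mulr0.
- by rewrite c00; ring.
- exact/separableZ/sepB.
- by apply: separableZ; apply: sepB => //; exact/separableZ/separableM.
Qed.

Lemma stumpff_trig (w : R) : 0 < w ->
  stumpff (w ^+ 2) (fun s => cos (w * s)) (fun s => w^-1 * sin (w * s))
    (fun s => (w ^+ 2)^-1 * (1 - cos (w * s)))
    (fun s => (w ^+ 2)^-1 * (s - w^-1 * sin (w * s)))
    (fun s => (w ^+ 2)^-1 * (2^-1 * (s * s) - (w ^+ 2)^-1 * (1 - cos (w * s)))).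
Proof.
move=> w0; have wn0 : w != 0 by rewrite gt_eqF.
apply: stumpff_of.
- by rewrite expf_neq0.
- move=> s; apply: (is_derive_eq (derive_cmulf w^-1
    (derive_lin_comp (is_derive_sin (w * s))))).
  by field.
- move=> s; apply: (is_derive_eq (derive_lin_comp (is_derive_cos (w * s)))).
  by field.
- by move=> s; rewrite mulrN cosN.
- by move=> s; rewrite mulrN sinN mulrN.
- by rewrite mulr0 cos0.
- exact: separable_cos.
- exact/separableZ/separable_sin.
Qed.

Lemma stumpff_hyp (w : R) : 0 < w -> exists c2 c3 c4,
  stumpff (- w ^+ 2) (fun s => 2^-1 * (expR (w * s) + expR (- w * s)))
    (fun s => (2 * w)^-1 * (expR (w * s) - expR (- w * s))) c2 c3 c4.
Proof.
move=> w0; have wn0 : w != 0 by rewrite gt_eqF.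
have de a s : is_derive s 1 (fun s => expR (a * s)) (a * expR (a * s)).
  exact: derive_lin_comp (is_derive_expR (a * s)).
eexists; eexists; eexists.
apply: (@stumpff_of (- w ^+ 2)
  (fun s => 2^-1 * (expR (w * s) + expR (- w * s)))
  (fun s => (2 * w)^-1 * (expR (w * s) - expR (- w * s)))).
- by rewrite oppr_eq0 expf_neq0.
- move=> s; apply: (is_derive_eq (derive_cmulf _ (derive_subf (de w s) (de (- w) s)))).
  by field.
- move=> s; apply: (is_derive_eq (derive_cmulf _ (derive_addf (de w s) (de (- w) s)))).
  by field.
- by move=> s; rewrite !mulrN !mulNr opprK addrC.
- by move=> s; rewrite !mulrN !mulNr opprK; ring.
- by rewrite !mulr0 expR0; field.
- by apply: separableZ; apply: separableD; exact: separable_exp.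
- rewrite (_ : (fun s => _) = fun s => (2 * w)^-1 * (expR (w * s) + (-1) * expR (- w * s))).
    apply: separableZ; apply: separableD; first exact: separable_exp.
    exact/separableZ/separable_exp.
  by apply/funext => s; ring.
Qed.

Lemma stumpff_poly : exists c4, stumpff 0 (fun=> 1 : R) (fun s => s)
  (fun s => 2^-1 * (s * s)) (fun s => 6^-1 * (s * (s * s))) c4.
Proof.
exists (fun s => 24^-1 * ((s * s) * (s * s))).
have d1 := derive_idf; have d2 s := derive_mulf (d1 _ s) (d1 _ s).
have d3 s := derive_mulf (d1 _ s) (d2 s).
have d4 s := derive_mulf (d2 s) (d2 s).
have sepid : separable (fun s : R => s) by exact: separable_id.
have sep2 : separable (fun s : R => s * s) by exact: separableM.
split=> //.
- by move=> s; apply: (is_derive_eq (derive_cmulf _ (d2 s))); field.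
- by move=> s; apply: (is_derive_eq (derive_cmulf _ (d3 s))); field.
- by move=> s; apply: (is_derive_eq (derive_cmulf _ (d4 s))); field.
- by move=> s; ring.
- by move=> s; ring.
- by move=> s; ring.
- by move=> s; ring.
- by move=> s; ring.
- by rewrite !mulr0.
- by rewrite !mulr0.
- exact: separable_cst.
- exact: separableZ.
- exact/separableZ/separableM.
- exact/separableZ/separableM.
Qed.

(** The time change behind the shortening of the delay: [2 k - A^2] is multiplied by [tau^2] when
    [(A, k)] becomes [(tau A, tau^2 k)]. *)
Lemma stumpff_scale kappa c0 c1 c2 c3 c4 tau :
  stumpff kappa c0 c1 c2 c3 c4 -> tau != 0 ->
  stumpff (tau ^+ 2 * kappa) (fun s => c0 (tau * s))
    (fun s => tau^-1 * c1 (tau * s)) (fun s => tau ^- 2 * c2 (tau * s))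
    (fun s => tau ^- 3 * c3 (tau * s)) (fun s => tau ^- 4 * c4 (tau * s)).
Proof.
move=> [d1 d2 d3 d4 e0 e1 p0 p1 p2 p3 p4 z2 z4 s0 s1 s2 s3 s4] t0.
have e0' s : c0 s = 1 - kappa * c2 s by rewrite -(e0 s); ring.
have e1' s : c1 s = s - kappa * c3 s by apply/eqP; rewrite eq_sym subr_eq e1.
split.
- move=> s; apply: (is_derive_eq (derive_cmulf tau^-1 (derive_lin_comp (d1 (tau * s))))).
  by field.
- move=> s; apply: (is_derive_eq (derive_cmulf (tau ^- 2) (derive_lin_comp (d2 (tau * s))))).
  by field.
- move=> s; apply: (is_derive_eq (derive_cmulf (tau ^- 3) (derive_lin_comp (d3 (tau * s))))).
  by field.
- move=> s; apply: (is_derive_eq (derive_cmulf (tau ^- 4) (derive_lin_comp (d4 (tau * s))))).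
  by field.
- by move=> s; rewrite e0'; field.
- by move=> s; rewrite e1'; field.
- by move=> s; rewrite mulrN p0.
- by move=> s; rewrite mulrN p1 mulrN.
- by move=> s; rewrite mulrN p2.
- by move=> s; rewrite mulrN p3 mulrN.
- by move=> s; rewrite mulrN p4.
- by rewrite mulr0 z2 mulr0.
- by rewrite mulr0 z4 mulr0.
- exact: separable_scale.
- exact/separableZ/separable_scale.
- exact/separableZ/separable_scale.
- exact/separableZ/separable_scale.
- exact/separableZ/separable_scale.
Qed.

End Stumpff.

(** * Explicit solution of the boundary value problem for the kernel *)

Section Kernel.
Variable R : realType.
Variables (A k : R) (c0 c1 c2 c3 c4 : R -> R).
Implicit Types (s u : R) (f g : R -> R).
Let h : R := 2^-1.

(** The condition [Q' (-1) = 0] reads [kcoef * kden = - (c1 + 2 k c3 + A c2)] at [1/2], and [kcst]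
    is then fixed by [Q (-1) = 0]. Solvability thus rests on [kden != 0] only. *)
Definition kden : R := A * c1 h + c0 h.
Definition kcoef : R := - (c1 h + 2 * k * c3 h + A * c2 h) / kden.
Definition kcst : R :=
  (1 + kcoef * A) * c2 h + 2 * k * c4 h + (A * c3 h + kcoef * c1 h).

(** With [e], [o] the even and odd parts about the midpoint, the equation splits into
    [e'' + A o' = - 1] and [o'' + A e' + 2 k o = 0]. By parity the first integrates to
    [e' = - s - A o], and the second becomes [o'' + (2 k - A^2) o = A s], solved by [A c3] plus a
    multiple of [c1]. *)
Definition keven (s : R) : R :=
  kcst - (1 + kcoef * A) * c2 s - 2 * k * c4 s.
Definition kodd (s : R) : R := A * c3 s + kcoef * c1 s.

(* The kernel [Q] of the functional: the solution of
   [Q'' + A Q' + k (Q s - Q (-1 - s)) = -1], [Q (-1) = Q' (-1) = 0]; its even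
   and odd parts about [-1/2] solve a constant-coefficient system. *)
Definition kQ (s : R) : R := keven (s - - h) + kodd (s - - h).
Definition kq (s : R) : R :=
  - (1 + kcoef * A) * c1 (s - - h) - 2 * k * c3 (s - - h)
  + (A * c2 (s - - h) + kcoef * c0 (s - - h)).
Definition kdq (s : R) : R :=
  - (1 + kcoef * A) * c0 (s - - h) - 2 * k * c2 (s - - h)
  + (A * c1 (s - - h) + kcoef * (- (2 * k - A ^+ 2) * c1 (s - - h))).

Hypothesis st : stumpff (2 * k - A ^+ 2) c0 c1 c2 c3 c4.
Hypothesis den0 : kden != 0.

Let d1 := stumpff_d1 st. Let d2 := stumpff_d2 st.
Let d3 := stumpff_d3 st. Let d4 := stumpff_d4 st.

Lemma stumpff_d0 s : is_derive s 1 c0 (- (2 * k - A ^+ 2) * c1 s).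
Proof.
rewrite (_ : c0 = fun s => 1 - (2 * k - A ^+ 2) * c2 s); last first.
  by apply/funext => u; apply/eqP; rewrite eq_sym subr_eq (stumpff_e0 st).
apply: (is_derive_eq (derive_subf (derive_cstf 1 s) (derive_cmulf _ (d2 s)))).
by ring.
Qed.

Lemma derive_kQ s : is_derive s 1 kQ (kq s).
Proof.
have dke u : is_derive u 1 keven (- (1 + kcoef * A) * c1 u - 2 * k * c3 u).
  apply: (is_derive_eq (derive_subf (derive_subf (derive_cstf kcst u)
    (derive_cmulf (1 + kcoef * A) (d2 u))) (derive_cmulf (2 * k) (d4 u)))).
  by ring.
have dko u : is_derive u 1 kodd (A * c2 u + kcoef * c0 u).
  exact: derive_addf (derive_cmulf A (d3 u)) (derive_cmulf kcoef (d1 u)).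
exact: derive_addf (derive_shiftf (dke _)) (derive_shiftf (dko _)).
Qed.

Lemma derive_kq s : is_derive s 1 kq (kdq s).
Proof.
have dk u : is_derive u 1 (fun u => - (1 + kcoef * A) * c1 u - 2 * k * c3 u
    + (A * c2 u + kcoef * c0 u))
    (- (1 + kcoef * A) * c0 u - 2 * k * c2 u
    + (A * c1 u + kcoef * (- (2 * k - A ^+ 2) * c1 u))).
  exact: derive_addf (derive_subf (derive_cmulf _ (d1 u)) (derive_cmulf _ (d3 u)))
    (derive_addf (derive_cmulf A (d2 u)) (derive_cmulf kcoef (stumpff_d0 u))).
exact: derive_shiftf (dk _).
Qed.

Lemma kQ_reflect s : kQ (- 1 - s) = keven (s - - h) - kodd (s - - h).
Proof.
rewrite /kQ (_ : - 1 - s - - h = - (s - - h)); last by rewrite /h; field.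
rewrite /keven /kodd (stumpff_p1 st) (stumpff_p2 st) (stumpff_p3 st) (stumpff_p4 st).
by ring.
Qed.

Lemma kQ_ode s : kdq s + A * kq s + k * (kQ s - kQ (- 1 - s)) = - 1.
Proof.
rewrite kQ_reflect /kQ /kdq /kq /kodd; set u := s - - h.
have -> : c0 u = 1 - (2 * k - A ^+ 2) * c2 u.
  by apply/eqP; rewrite eq_sym subr_eq (stumpff_e0 st).
by ring.
Qed.

Lemma kQ_N1 : kQ (- 1) = 0.
Proof.
rewrite -[X in kQ X]subr0 kQ_reflect sub0r opprK /keven /kodd /kcst; ring.
Qed.

Let kden_eq : kcoef * kden = - (c1 h + 2 * k * c3 h + A * c2 h).
Proof. by rewrite /kcoef divfK. Qed.

Lemma kq_N1 : kq (- 1) = 0.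
Proof.
rewrite /kq (_ : - 1 - - h = - h); last by rewrite /h; field.
rewrite (stumpff_p0 st) (stumpff_p1 st) (stumpff_p2 st) (stumpff_p3 st).
by move: kden_eq; rewrite /kden => e; lra.
Qed.

(** Forced by the conditions at [-1]: the even part gives [Q' 0 - Q' (-1) = 2 e' (1/2) = - 1 - 2 A o
    (1/2)], and [Q 0 - Q (-1) = 2 o (1/2)]. *)
Lemma kq_0 : kq 0 = - 1 - A * kQ 0.
Proof.
rewrite /kq /kQ /keven /kodd /kcst sub0r opprK.
have e1 : c1 h + (2 * k - A ^+ 2) * c3 h = 2^-1 := stumpff_e1 st h.
by move: kden_eq; rewrite /kden => e2; lra.
Qed.

Lemma separable_keven : separable (fun s => keven (s - - h)).
Proof.
apply: (@separable_shift _ _ keven).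
rewrite (_ : keven = fun s => kcst + (- (1 + kcoef * A)) * c2 s + (- (2 * k)) * c4 s).
  apply: separableD; last exact/separableZ/(stumpff_s4 st).
  apply: separableD; first exact: separable_cst.
  exact/separableZ/(stumpff_s2 st).
by apply/funext => s; rewrite /keven; ring.
Qed.

Lemma separable_kodd : separable (fun s => kodd (s - - h)).
Proof.
apply: (@separable_shift _ _ kodd); apply: separableD.
  exact/separableZ/(stumpff_s3 st).
exact/separableZ/(stumpff_s1 st).
Qed.

Lemma separable_kQ : separable kQ.
Proof. exact: separableD separable_keven separable_kodd. Qed.

Lemma separable_kQ_reflect : separable (fun s => kQ (- 1 - s)).
Proof.
rewrite (_ : (fun s => _) = fun s => keven (s - - h) + (- 1) * kodd (s - - h)).
  exact: separableD separable_keven (separableZ _ separable_kodd).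
by apply/funext => s; rewrite kQ_reflect; ring.
Qed.

Let sep_addB f g a b : separable f -> separable g ->
  separable (fun s : R => a * f s - b * g s).
Proof.
move=> sf sg; rewrite (_ : (fun s => _) = fun s => a * f s + (- b) * g s).
  exact: separableD (separableZ _ sf) (separableZ _ sg).
by apply/funext => s; ring.
Qed.

Lemma separable_kq : separable kq.
Proof.
pose f u := - (1 + kcoef * A) * c1 u - 2 * k * c3 u + (A * c2 u + kcoef * c0 u).
apply: (@separable_shift _ _ f); apply: separableD.
  exact/sep_addB/(stumpff_s3 st)/(stumpff_s1 st).
apply: separableD; apply: separableZ; first exact: (stumpff_s2 st).
exact: (stumpff_s0 st).
Qed.

Lemma cont_kdq : continuous kdq.
Proof.
pose f u := - (1 + kcoef * A) * c0 u - 2 * k * c2 u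
  + (A * c1 u + kcoef * (- (2 * k - A ^+ 2) * c1 u)).
apply: (@cont_shiftf _ f); apply: separable_cont; apply: separableD.
  exact/sep_addB/(stumpff_s2 st)/(stumpff_s0 st).
apply: separableD; apply: separableZ; first exact: (stumpff_s1 st).
exact/separableZ/(stumpff_s1 st).
Qed.

End Kernel.

(** * The Lyapunov-Krasovskii functional, its derivative and its bounds *)

Section Functional.
Variable R : realType.
Implicit Types (x f g q Y Q : R -> R) (A k p t s u B : R).

(** General quadratic form in [x t], the window integral of [x] and the history. The double integral
    carries the reflected kernel so that its [x (t - 1)] term cancels the one produced by
    differentiating [Int x (t - 1) t]. *)
Definition lyapV p q Y x t : R :=
  p * x t ^+ 2 + 2 * (x t * window q x t) - 2 * (Int x (t - 1) t * window Y x t)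
  + 2 * dwindow (fun s => Y (- 1 - s)) x t.

(** The weight increases from 1 to 2 across the window: it costs [2 x(t)^2] and dissipates
    [x(t-1)^2] together with the whole window. *)
Definition lyapM x t : R := window (fun s => 2 + s) (fun u => x u ^+ 2) t.

Definition lyapW p q Y x t : R := lyapV p q Y x t + lyapM x t.

Definition state_norm x t : R := x t ^+ 2 + sqwindow x t.

Record lyap_kernel A k p Q q dq : Prop := LyapKernel {
  lk_dQ : forall s, is_derive s 1 Q (q s);
  lk_dq : forall s, is_derive s 1 q (dq s);
  lk_ode : forall s, dq s + A * q s + k * (Q s - Q (- 1 - s)) = - 1;
  lk_QN1 : Q (- 1) = 0;
  lk_qN1 : q (- 1) = 0;
  lk_q0 : q 0 = - 1 - A * Q 0;
  lk_p : p = k^-1 - Q 0;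
  lk_sQ : separable Q;
  lk_sQr : separable (fun s => Q (- 1 - s));
  lk_sq : separable q;
  lk_cdq : continuous dq }.

Lemma separable_affine a : separable (fun s : R => a + s).
Proof. exact: separableD (separable_cst _) (separable_id R). Qed.

Lemma window1 x t : continuous x -> window (fun=> 1) x t = Int x (t - 1) t.
Proof. by move=> cx; rewrite /window; congr Int; apply/funext => u; rewrite mul1r. Qed.

Lemma derive_sqf x t v : is_derive t 1 x v ->
  is_derive t 1 (fun s => x s ^+ 2) (2 * x t * v).
Proof. by move=> xv; apply: (is_derive_eq (derive_mulf xv xv)); ring. Qed.

Lemma derive_lyapM x t : continuous x ->
  is_derive t 1 (lyapM x) (2 * x t ^+ 2 - x (t - 1) ^+ 2 - sqwindow x t).
Proof.
move=> cx.
have d2 s : is_derive s 1 (fun s : R => 2 + s) (1 : R).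
  by rewrite -[X in is_derive _ _ _ X]add0r; exact: derive_addf (derive_cstf _ _) (derive_idf s).
apply: (is_derive_eq (derive_window t (separable_affine 2) _ (cont_sqrf cx) d2)).
  exact: cst_continuous.
by rewrite window1; [rewrite /sqwindow addr0; ring|exact: cont_sqrf].
Qed.

(** [x] need not solve anything: the last summand is the effect of its defect in the linear
    equation. In the rest, the choice of [p] and the kernel equation remove the products with [x t],
    [Q' = q] removes those with the window integral, [Q (-1) = q (-1) = 0] those with [x (t - 1)],
    and [q 0] leaves [- 2 A / k - 2] in front of [x t ^+ 2]. *)
Lemma derive_lyapW A k p Q q dq x t v : k != 0 -> lyap_kernel A k p Q q dq ->
  continuous x -> is_derive t 1 x v ->
  is_derive t 1 (lyapW p q (fun s => k * Q s) x)
    (- (2 * A / k) * x t ^+ 2 - x (t - 1) ^+ 2 - sqwindow x t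
     + 2 * ((v + A * x t + k * Int x (t - 1) t) * (p * x t + window q x t))).
Proof.
move=> k0 [dQ ddq ode QN1 qN1 q0 pE sQ sQr sq cdq] cx xv.
have cq := separable_cont sq; have cQ := separable_cont sQ.
have cQr := separable_cont sQr.
have dY s : is_derive s 1 (fun s => k * Q s) (k * q s) by exact: derive_cmulf.
have dL := derive_window t sq cdq cx ddq.
have dLY := derive_window t (separableZ k sQ) (cont_cmulf (c := k) cq) cx dY.
have dz := derive_Int_window t cx.
have dG := derive_dwindow t (separableZ k sQr) cx.
have dV : is_derive t 1 (lyapV p q (fun s => k * Q s) x) _ :=
  derive_addf (derive_subf (derive_addf (derive_cmulf p (derive_sqf xv))
    (derive_cmulf 2 (derive_mulf xv dL)))
    (derive_cmulf 2 (derive_mulf dz dLY))) (derive_cmulf 2 dG).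
apply: (is_derive_eq (derive_addf dV (derive_lyapM t cx))).
(* The kernel equation, integrated against the history. *)
have odeI : window dq x t + A * window q x t + k * window Q x t
    - k * window (fun s => Q (- 1 - s)) x t = - Int x (t - 1) t.
  have -> : - Int x (t - 1) t = window (fun=> - 1) x t.
    transitivity (- 1 * window (fun=> 1) x t); first by rewrite window1// mulN1r.
    rewrite -windowZ//; last exact: cst_continuous.
    by congr window; apply/funext => s; rewrite mulr1.
  have cAq : continuous (fun s => A * q s) by exact: cont_cmulf.
  have ckQ : continuous (fun s => k * Q s) by exact: cont_cmulf.
  have ckQr : continuous (fun s => - k * Q (- 1 - s)) by exact: cont_cmulf.
  have cdqA := cont_addf cdq cAq; have cdqAk := cont_addf cdqA ckQ.
  rewrite -mulNr -!windowZ// -!windowD//.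
  by congr window; apply/funext => s; apply: etrans (ode s); ring.
rewrite qN1 QN1.
have -> : (fun s => k * Q (- 1 - (- 1 - s))) = fun s => k * Q s.
  by apply/funext => s; congr (_ * Q _); ring.
rewrite !windowZ// q0 pE.
move: odeI; move: (window dq x t) (window q x t) (window Q x t) (window (fun s => Q (- 1 - s)) x t)
  (Int _ _ _) => D L M M' z e.
have -> : D = - z - A * L - k * M + k * M' by rewrite -e; ring.
by field.
Qed.

Lemma sqr_Int_window_le x t : continuous x ->
  Int x (t - 1) t ^+ 2 <= sqwindow x t.
Proof.
move=> cx; apply: le_trans (sqr_Int_le _ cx) _; first lra.
by rewrite opprB addrCA subrr addr0 mul1r.
Qed.

Lemma mul_le_half B a b : 0 < B -> 2 * (a * b) <= B * a ^+ 2 + B^-1 * b ^+ 2.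
Proof.
move=> B0; rewrite -subr_ge0 (_ : _ - _ = B^-1 * (B * a - b) ^+ 2).
  by rewrite mulr_ge0 ?sqr_ge0// invr_ge0 ltW.
by field; rewrite gt_eqF.
Qed.

Lemma norm_mul_le B a b : 0 < B -> 2 * `|a * b| <= B * a ^+ 2 + B^-1 * b ^+ 2.
Proof.
move=> B0; rewrite normrM; apply: le_trans (mul_le_half _ _ B0) _.
by rewrite !real_normK ?num_real.
Qed.

Lemma state_norm_ge0 x t : continuous x -> 0 <= state_norm x t.
Proof. by move=> cx; rewrite addr_ge0 ?sqr_ge0 ?sqwindow_ge0. Qed.

(** The terms in [p] and [q] are left aside because [p] blows up for short delays, where only the
    [Y] part is small. *)
Lemma lyapV_bound_Y p q Y x t B : 0 < B -> continuous x ->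
  continuous Y -> separable (fun s => Y (- 1 - s)) ->
  (forall s, - 1 <= s <= 0 -> `|Y s| <= B) ->
  `|lyapV p q Y x t - p * x t ^+ 2 - 2 * (x t * window q x t)|
    <= 4 * B * sqwindow x t.
Proof.
move=> B0 cx cY sYr YB.
set S := sqwindow x t; have S0 : 0 <= S by exact: sqwindow_ge0.
have hY := window_bound t cY cx YB.
have hG : `|dwindow (fun s => Y (- 1 - s)) x t| <= B * S.
  by apply: dwindow_bound => //; [exact: ltW|move=> s hs; apply: YB; lra].
have hz := sqr_Int_window_le t cx.
have h2 := norm_mul_le (Int x (t - 1) t) (window Y x t) B0.
have h3 : B^-1 * window Y x t ^+ 2 <= B * S.
  by rewrite mulrC ler_pdivrMr// mulrAC -expr2.
have h4 : B * Int x (t - 1) t ^+ 2 <= B * S by rewrite ler_pM2l.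
rewrite /lyapV; move: hG h2 h3 h4.
move: (Int x _ _ * _) (dwindow _ _ _) => b c hc hb h3 h4.
rewrite (_ : _ - _ - _ = 2 * c - 2 * b); last by ring.
have := ler_normB (2 * c) (2 * b); rewrite !normrM (@ger0_norm _ 2)//.
by move: hc hb h3 h4; clear; lra.
Qed.

Lemma lyapV_bound p q Y x t B : 0 < B -> continuous x -> continuous q ->
  continuous Y -> separable (fun s => Y (- 1 - s)) -> `|p| <= B ->
  (forall s, - 1 <= s <= 0 -> `|q s| <= B) ->
  (forall s, - 1 <= s <= 0 -> `|Y s| <= B) ->
  `|lyapV p q Y x t| <= 5 * B * state_norm x t.
Proof.
move=> B0 cx cq cY sYr pB qB YB.
have hV := lyapV_bound_Y p q t B0 cx cY sYr YB.
rewrite /state_norm; set S := sqwindow x t in hV *.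
have S0 : 0 <= S by exact: sqwindow_ge0.
have hq := window_bound t cq cx qB.
have h1 := norm_mul_le (x t) (window q x t) B0.
have h2 : B^-1 * window q x t ^+ 2 <= B * S.
  by rewrite mulrC ler_pdivrMr// mulrAC -expr2.
have h3 : `|p * x t ^+ 2| <= B * x t ^+ 2.
  by rewrite normrM (ger0_norm (sqr_ge0 _)) ler_wpM2r// sqr_ge0.
have h4 : 0 <= B * x t ^+ 2 by rewrite mulr_ge0 ?sqr_ge0// ltW.
move: hV h1 h2 h3 h4; move: (lyapV p q Y x t) => V.
set a := x t * _; set b := p * _ => hV h1 h2 h3 h4.
have := ler_normD (V - b - 2 * a) (b + 2 * a); have := ler_normD b (2 * a).
rewrite (_ : V - b - 2 * a + (b + 2 * a) = V); last by ring.
rewrite [`|2 * a|]normrM (@ger0_norm _ 2)//.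
by move: hV h1 h2 h3 h4; clear; lra.
Qed.

(** Linearity in [(p, q, Y)] turns closeness of kernels into closeness of functionals. *)
Lemma lyapV_sub p q Y p' q' Y' x t : continuous x ->
  continuous q -> continuous q' -> continuous Y -> continuous Y' ->
  separable (fun s => Y (- 1 - s)) -> separable (fun s => Y' (- 1 - s)) ->
  lyapV p q Y x t - lyapV p' q' Y' x t =
  lyapV (p - p') (fun s => q s + (- 1) * q' s) (fun s => Y s + (- 1) * Y' s) x t.
Proof.
move=> cx cq cq' cY cY' sY sY'; rewrite /lyapV.
rewrite !windowD ?windowZ ?dwindowD ?dwindowZ//; last 3 first.
- exact: separableZ.
- exact: cont_cmulf.
- exact: cont_cmulf.
by ring.
Qed.

Lemma lyapM_bound x t : continuous x ->
  sqwindow x t <= lyapM x t <= 2 * sqwindow x t.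
Proof.
move=> cx; have cx2 := cont_sqrf cx.
have ca : continuous (fun u => 2 + (u - t)).
  exact: (@cont_shiftf _ (fun s => 2 + s) t (separable_cont (separable_affine 2))).
rewrite /lyapM /window /sqwindow; apply/andP; split.
  apply: le_Int; [lra|exact: cx2|exact: cont_mulf|move=> s hs].
  by rewrite -[leLHS]mul1r ler_wpM2r ?sqr_ge0//; lra.
rewrite -IntZ//; apply: le_Int; [lra|exact: cont_mulf|exact: cont_cmulf|move=> s hs].
by rewrite ler_wpM2r ?sqr_ge0//; lra.
Qed.

End Functional.

(** * From nonnegativity of the functional to coercivity *)

Section Coercivity.
Variable R : realType.
Implicit Types (x e g f q Y Q : R -> R) (A k p t s u B a b c : R).

Lemma cont_bounded g a b : continuous g ->
  exists2 B, 0 < B & forall s, a <= s <= b -> `|g s| <= B.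
Proof.
move=> cg; case: (leP a b) => [ab|ba]; last first.
  by exists 1 => // s; rewrite leNgt => /andP[/negP as_ sb]; case: as_; lra.
have cn : {within `[a, b], continuous (fun s => `|g s|)}.
  apply: continuous_subspaceT => s.
  by apply: cvg_norm; exact: cg.
have [c _ hc] := EVT_max ab cn.
exists (`|g c| + 1) => [|s hs]; first by have := normr_ge0 (g c); lra.
by apply: le_trans (hc s _) _; rewrite ?in_itv//= lerDl.
Qed.

Lemma window_local g x e t : continuous g -> continuous x -> continuous e ->
  (forall s, t - 1 <= s <= t -> x s = e s) -> window g x t = window g e t.
Proof.
move=> cg cx ce xe; apply: eq_Int; [lra| | |].
- exact/cont_mulf/cx/cont_shiftf.
- exact/cont_mulf/ce/cont_shiftf.
- by move=> s hs; rewrite xe//; lra.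
Qed.

Lemma dwindow_local g x e t : separable g -> continuous x -> continuous e ->
  (forall s, t - 1 <= s <= t -> x s = e s) -> dwindow g x t = dwindow g e t.
Proof.
move=> sg cx ce xe; apply: eq_Int; [lra| | |].
- exact/cont_mulf/cont_window_from.
- exact/cont_mulf/cont_window_from.
- move=> s hs; rewrite xe; last lra.
  congr (_ * _); apply: eq_Int; [lra| | |].
  + exact/cont_mulf/cx/cont_shiftf/separable_cont.
  + exact/cont_mulf/ce/cont_shiftf/separable_cont.
  + by move=> w hw; rewrite xe//; lra.
Qed.

Lemma Int_local x e a b : a <= b -> continuous x -> continuous e ->
  (forall s, a <= s <= b -> x s = e s) -> Int x a b = Int e a b.
Proof. by move=> ab cx ce xe; apply: eq_Int => // s hs; apply: xe; lra. Qed.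

Lemma sqwindow_local x e t : continuous x -> continuous e ->
  (forall s, t - 1 <= s <= t -> x s = e s) -> sqwindow x t = sqwindow e t.
Proof.
move=> cx ce xe; apply: Int_local; [lra|exact: cont_sqrf|exact: cont_sqrf|].
by move=> s hs; rewrite xe.
Qed.

Lemma state_norm_local x e t : continuous x -> continuous e ->
  (forall s, t - 1 <= s <= t -> x s = e s) -> state_norm x t = state_norm e t.
Proof.
move=> cx ce xe; rewrite /state_norm (sqwindow_local cx ce xe) xe//; lra.
Qed.

(** Allows a history to be continued at will beyond [t], and a solution living on an interval to be
    replaced by a globally continuous function. *)
Lemma lyapW_local p q Y x e t : continuous q -> continuous Y ->
  separable (fun s => Y (- 1 - s)) -> continuous x -> continuous e ->
  (forall s, t - 1 <= s <= t -> x s = e s) ->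
  lyapW p q Y x t = lyapW p q Y e t.
Proof.
move=> cq cY sY cx ce xe; rewrite /lyapW /lyapV /lyapM.
rewrite (window_local cq cx ce xe) (window_local cY cx ce xe).
rewrite (dwindow_local sY cx ce xe).
rewrite (Int_local (a := t - 1) (b := t) _ cx ce xe); last lra.
rewrite xe; last lra.
congr (_ + _); apply: window_local; [|exact: cont_sqrf|exact: cont_sqrf|].
  exact: separable_cont (separable_affine 2).
by move=> s hs; rewrite xe.
Qed.

Lemma cont_lyapW A k p Q q dq x : lyap_kernel A k p Q q dq -> continuous x ->
  continuous (lyapW p q (fun s => k * Q s) x).
Proof.
move=> [dQ ddq ode QN1 qN1 q0 pE sQ sQr sq cdq] cx.
have cq := separable_cont sq.
have dY s : is_derive s 1 (fun s => k * Q s) (k * q s) by exact: derive_cmulf.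
have c1 : continuous (window q x).
  by move=> t; exact: derive_cont (derive_window t sq cdq cx ddq).
have c2 : continuous (window (fun s => k * Q s) x).
  move=> t; exact: derive_cont
    (derive_window t (separableZ k sQ) (cont_cmulf (c := k) cq) cx dY).
have c3 : continuous (fun s => Int x (s - 1) s).
  by move=> t; exact: derive_cont (derive_Int_window t cx).
have c4 : continuous (dwindow (fun s => k * Q (- 1 - s)) x).
  by move=> t; exact: derive_cont (derive_dwindow t (separableZ k sQr) cx).
have c5 : continuous (lyapM x).
  by move=> t; exact: derive_cont (derive_lyapM t cx).
apply: cont_addf c5; apply: cont_addf; last exact: cont_cmulf.
apply: cont_subf; last exact/cont_cmulf/cont_mulf.
by apply: cont_addf; [exact/cont_cmulf/cont_sqrf|exact/cont_cmulf/cont_mulf].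
Qed.

(** Continuation of the history by a straight line of slope [v]; unlike a solution it needs no
    existence theorem. *)
Definition extend_affine x t v u : R := x (Order.min u t) + v * Order.max (u - t) 0.

Lemma cont_maxf f g : continuous f -> continuous g ->
  continuous (fun s => Order.max (f s) (g s)).
Proof. by move=> cf cg t; exact: (continuous_max (cf t) (cg t)). Qed.

Lemma cont_minf f g : continuous f -> continuous g ->
  continuous (fun s => Order.min (f s) (g s)).
Proof. by move=> cf cg t; exact: (continuous_min (cf t) (cg t)). Qed.

Lemma cont_idf : continuous (fun s : R => s).
Proof. by move=> s; exact: cvg_id. Qed.

Lemma cont_cstf c : continuous (fun _ : R => c).
Proof. exact: cst_continuous. Qed.

Lemma cont_extend_affine x t v : continuous x -> continuous (extend_affine x t v).
Proof.
move=> cx; have cm := cont_minf cont_idf (@cont_cstf t).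
apply: cont_addf.
  by move=> u; exact: (continuous_comp (cm u) (cx _)).
exact/cont_cmulf/(cont_maxf (cont_subf cont_idf (@cont_cstf t)) (@cont_cstf 0)).
Qed.

Lemma extend_affine_le x t v u : u <= t -> extend_affine x t v u = x u.
Proof.
by move=> ut; rewrite /extend_affine min_l// max_r ?mulr0 ?addr0// subr_le0.
Qed.

Lemma extend_affine_ge x t v u : t <= u -> extend_affine x t v u = x t + v * (u - t).
Proof. by move=> ut; rewrite /extend_affine min_r// max_l// subr_ge0. Qed.

Lemma derive_extend_affine x t v u : t < u ->
  is_derive u 1 (extend_affine x t v) v.
Proof.
move=> tu; apply: (@near_eq_is_derive _ _ _ (fun u => x t + v * (u - t))).
  near=> w; rewrite extend_affine_ge//.
  by apply: ltW; near: w; exact: lt_nbhsr.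
have d := derive_addf (derive_cstf (x t) u)
  (derive_cmulf v (derive_subf (derive_idf u) (derive_cstf t u))).
by apply: (is_derive_eq d); ring.
Unshelve. all: by end_near. Qed.

(* If the functional is nonnegative on all histories, it bounds what it
   dissipates; following, instead of a solution, the line tangent to it costs
   [O(eta^2)] over the time [eta], against a dissipation of order [eta]. *)
Lemma lyapW_coercive A k p Q q dq : 0 < A -> 0 < k -> lyap_kernel A k p Q q dq ->
  (forall x t, continuous x -> 0 <= lyapW p q (fun s => k * Q s) x t) ->
  exists2 c, 0 < c & forall x t, continuous x ->
    c * state_norm x t <= lyapW p q (fun s => k * Q s) x t.
Proof.
move=> A0 k0 lk W0; have k0' : k != 0 by rewrite gt_eqF.
have cq := separable_cont (lk_sq lk); have cQ := separable_cont (lk_sQ lk).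
have [Bq Bq0 qB] := cont_bounded (-1) 0 cq.
pose B := Bq + `|p|; have B0 : 0 < B by rewrite ltr_wpDr.
have qB' s : - 1 <= s <= 0 -> `|q s| <= B.
  by move=> /qB h; rewrite (le_trans h)// lerDl.
have pB : p ^+ 2 <= B ^+ 2.
  by rewrite -(real_normK (num_real p)) lerXn2r ?nnegrE ?(ltW B0)// lerDr ltW.
pose V := 2 * (A ^+ 2 + k ^+ 2); pose E := 2 + 2 * V.
have A2 : 0 < A ^+ 2 by exact: exprn_gt0.
have k2 : 0 < k ^+ 2 by exact: exprn_gt0.
have B2 : 0 < B ^+ 2 by exact: exprn_gt0.
have V0 : 0 < V by rewrite /V; lra.
have E0 : 0 < E by rewrite /E; lra.
pose P := 3 * (A ^+ 2 * V + k ^+ 2 * E + k ^+ 2).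
have P0 : 0 < P.
  by rewrite /P; have := mulr_gt0 A2 V0; have := mulr_gt0 k2 E0; lra.
pose G := 2 * B ^+ 2 * (1 + 2 * E).
have G0 : 0 < G by rewrite /G; have := mulr_gt0 B2 E0; lra.
have div4K c d : 0 < d -> c / (4 * d) * d = c / 4.
  by move=> d0; field; rewrite gt_eqF.
(* [c1 N] is available from the dissipation. A quarter is given to the defect through Young's
   inequality with weight [lam], a quarter to the errors proportional to elapsed time, which [eta]
   keeps small; half survives. *)
pose c1 := Order.min (A / k) 1.
have Ak0 : 0 < A / k by rewrite divr_gt0.
have c10 : 0 < c1 by rewrite /c1 lt_min Ak0 ltr01.
pose lam := c1 / (4 * G); have lam0 : 0 < lam by rewrite divr_gt0// mulr_gt0.
pose D := 2 * A / k * V + P / lam.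
have D0 : 0 < D.
  have := mulr_gt0 Ak0 V0; have : 0 < P / lam by rewrite divr_gt0.
  by rewrite /D; lra.
pose eta := Order.min 1 (c1 / (4 * D)).
have eta0 : 0 < eta by rewrite lt_min ltr01 divr_gt0// mulr_gt0.
have eta1 : eta <= 1 by rewrite /eta ge_min lexx.
have etaD : eta * D <= c1 / 4.
  apply: (@le_trans _ _ (c1 / (4 * D) * D)).
    by rewrite ler_pM2r// /eta ge_min lexx orbT.
  by rewrite div4K.
have lamG : lam * G = c1 / 4 by exact: div4K.
exists (eta * (c1 / 2)) => [|x t cx]; first by rewrite mulr_gt0// divr_gt0.
(* [v] is the velocity the linear equation prescribes at time [t], so the defect of the line
   vanishes there. *)
pose z0 := Int x (t - 1) t; pose v := - A * x t - k * z0.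
pose e := extend_affine x t v.
have ce : continuous e by exact: cont_extend_affine.
have xe s : t - 1 <= s <= t -> x s = e s.
  by move=> /andP[_ st]; rewrite /e extend_affine_le.
have sY : separable (fun s => k * Q (- 1 - s)) := separableZ k (lk_sQr lk).
have cY : continuous (fun s => k * Q s) by exact: cont_cmulf.
rewrite (lyapW_local p cq cY sY cx ce xe) (state_norm_local cx ce xe).
have z0E : z0 = Int e (t - 1) t by apply: Int_local => //; lra.
have xte : x t = e t by apply: xe; lra.
have eE u : t <= u -> e u = e t + v * (u - t).
  by move=> tu; rewrite -xte /e extend_affine_ge.
have de u : t < u -> is_derive u 1 e v by exact: derive_extend_affine.
have vE : v = - A * e t - k * Int e (t - 1) t by rewrite /v xte z0E.
clearbody e v z0; clear z0 z0E xte xe x cx.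
set N := state_norm e t; pose S := sqwindow e t; pose y := e t.
have S0 : 0 <= S by exact: sqwindow_ge0.
have NE : N = y ^+ 2 + S by [].
have y2 : 0 <= y ^+ 2 by exact: sqr_ge0.
have N0 : 0 <= N by rewrite NE addr_ge0.
pose z := Int e (t - 1) t; have z2 : z ^+ 2 <= S by exact: sqr_Int_window_le.
have v2 : v ^+ 2 <= V * N.
  have h1 : v ^+ 2 <= 2 * (A ^+ 2 * y ^+ 2) + 2 * (k ^+ 2 * z ^+ 2).
    rewrite vE -/y -/z -subr_ge0 (_ : _ - _ = (A * y - k * z) ^+ 2); last by ring.
    exact: sqr_ge0.
  have h2 := ler_wpM2l (ltW k2) z2.
  have := mulr_ge0 (ltW A2) S0; have := mulr_ge0 (ltW k2) y2.
  by rewrite NE /V; lra.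
have eu2 u : t <= u -> u <= t + 1 -> e u ^+ 2 <= E * N.
  move=> tu ut; rewrite eE// -/y.
  have d0 : 0 <= u - t by rewrite subr_ge0.
  have d1 : (u - t) ^+ 2 <= 1 by rewrite expr_le1// lerBlDl.
  have h1 : v ^+ 2 * (u - t) ^+ 2 <= V * N.
    by rewrite -[leRHS]mulr1; apply: ler_pM => //; exact: sqr_ge0.
  have h2 : (y + v * (u - t)) ^+ 2 <= 2 * y ^+ 2 + 2 * (v ^+ 2 * (u - t) ^+ 2).
    rewrite -subr_ge0 (_ : _ - _ = (y - v * (u - t)) ^+ 2); last by ring.
    exact: sqr_ge0.
  by rewrite /E; move: h1 h2 S0; rewrite NE; clear; lra.
have ce2 := cont_sqrf ce.
have I2 u : t <= u -> u <= t + 1 -> Int (fun s => e s ^+ 2) t u <= (u - t) * (E * N).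
  move=> tu ut; rewrite mulrC -Int_cst; apply: le_Int => // [|s hs].
    exact: cst_continuous.
  by case/andP: hs => /ltW h1 /ltW h2; apply: eu2 => //; exact: le_trans ut.
(* The mass that has left the window by time [u]. Its derivative balances the term
   [- e (u - 1) ^+ 2], so what the window loses is not lost for the estimate. *)
pose J u := Int (fun s => e s ^+ 2) (t - 1) (u - 1).
have Int2_ge0 a b : a <= b -> 0 <= Int (fun s => e s ^+ 2) a b.
  by move=> ab; apply: Int_ge0 => // s _; exact: sqr_ge0.
have J0 u : t <= u -> 0 <= J u by move=> tu; apply: Int2_ge0; lra.
have Jle u w : u <= w -> J u <= J w.
  move=> uw; rewrite -subr_ge0 (_ : J w - J u = Int (fun s => e s ^+ 2) (u - 1) (w - 1)).
    by apply: Int2_ge0; lra.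
  by rewrite /J /Int; ring.
have JS u : u <= t + 1 -> J u <= S.
  move=> ut; apply: le_trans (Jle _ _ ut) _.
  by rewrite /J /S /sqwindow addrK.
have zu u : Int e (u - 1) u = z + (Int e t u - Int e (t - 1) (u - 1)).
  by rewrite /z /Int; ring.
have Su u : sqwindow e u = S + Int (fun s => e s ^+ 2) t u - J u.
  by rewrite /S /sqwindow /J /Int; ring.
pose J1 := J (t + eta).
(* A rate of dissipation valid on the whole of [[t, t + eta]]: the window keeps at least [S - J1],
   and half of [A / k * y ^+ 2] has been given up to bound [e u ^+ 2] from below. *)
pose m := A / k * y ^+ 2 + S - J1 - c1 / 2 * N.
pose W u := lyapW p q (fun s => k * Q s) e u.
pose rho u := v + A * e u + k * Int e (u - 1) u.
pose w u := p * e u + window q e u.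
pose d u := - (2 * A / k) * e u ^+ 2 - e (u - 1) ^+ 2 - sqwindow e u
  + 2 * (rho u * w u) + e (u - 1) ^+ 2 + m * (1 - 0).
have dW u : t < u -> is_derive u 1 W (- (2 * A / k) * e u ^+ 2 - e (u - 1) ^+ 2
    - sqwindow e u + 2 * (rho u * w u)).
  by move=> tu; exact: derive_lyapW k0' lk ce (de u tu).
have dJ u : is_derive u 1 J (e (u - 1) ^+ 2).
  exact: derive_shiftf (derive_Int _ _ ce2).
have dH u : t < u -> is_derive u 1 (fun u => W u + J u + m * (u - t)) (d u).
  move=> tu; exact: derive_addf (derive_addf (dW u tu) (dJ u))
    (derive_cmulf m (derive_subf (derive_idf u) (derive_cstf t u))).
have cW : continuous W by exact: (cont_lyapW lk ce).
have cH : continuous (fun u => W u + J u + m * (u - t)).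
  apply: cont_addf; last exact/cont_cmulf/cont_subf/cont_cstf/cont_idf.
  by apply: cont_addf => // u; exact: derive_cont (dJ u).
have d_le0 u : t < u < t + eta -> d u <= 0.
  move=> /andP[tu ut]; set dl := u - t.
  have dl0 : 0 < dl by rewrite subr_gt0.
  have dle : dl < eta by rewrite ltrBlDl.
  have dl1 : dl <= 1 by exact: le_trans (ltW dle) eta1.
  have tu1 : u <= t + 1 by rewrite -lerBlDl.
  have dl2 : dl ^+ 2 <= dl by rewrite expr2 ler_piMr// ltW.
  have EN0 : 0 <= E * N by rewrite mulr_ge0// ltW.
  have dlN0 : 0 <= dl * N by rewrite mulr_ge0// ltW.
  have hI2 := I2 u (ltW tu) tu1; rewrite -/dl in hI2.
  have hi1 : Int e t u ^+ 2 <= dl * (E * N).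
    apply: le_trans (sqr_Int_le (ltW tu) ce) _; rewrite -/dl.
    by rewrite ler_pM2l//; apply: le_trans hI2 _; rewrite ler_piMl.
  have hi2 : Int e (t - 1) (u - 1) ^+ 2 <= dl * N.
    apply: le_trans (sqr_Int_le _ ce) _; first by rewrite lerB// ltW.
    rewrite (_ : u - 1 - (t - 1) = dl); last by rewrite /dl; ring.
    by rewrite ler_pM2l//; apply: le_trans (JS u tu1) _; rewrite NE lerDr.
  have hv : v ^+ 2 * dl ^+ 2 <= dl * (V * N).
    by rewrite mulrC; apply: ler_pM => //; exact: sqr_ge0.
  have rhoE : rho u = A * v * dl + k * (Int e t u - Int e (t - 1) (u - 1)).
    by rewrite /rho zu (eE _ (ltW tu)) {1}vE -/y -/z -/dl; ring.
  have hrho : rho u ^+ 2 <= P * (dl * N).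
    rewrite rhoE; move: hi1 hi2 hv.
    move: (Int e t u) (Int e (t - 1) (u - 1)) => i1 i2 hi1 hi2 hv.
    have := ler_wpM2l (ltW A2) hv; have := ler_wpM2l (ltW k2) hi1.
    have := ler_wpM2l (ltW k2) hi2.
    (* This sum of squares is the gap in [(a + b - c)^2 <= 3 (a^2 + b^2 + c^2)]. *)
    have : 0 <= (A * v * dl - k * i1) ^+ 2 + (A * v * dl + k * i2) ^+ 2
        + (k * i1 + k * i2) ^+ 2.
      by rewrite !addr_ge0// sqr_ge0.
    by rewrite /P; clear; lra.
  have heu := eu2 u (ltW tu) tu1.
  have hS : sqwindow e u <= (1 + E) * N.
    rewrite Su; have := J0 u (ltW tu).
    have h1 : dl * (E * N) <= E * N by rewrite ler_piMl.
    have h2 : S <= N by rewrite NE lerDr.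
    by move: hI2 h1 h2; clear; lra.
  have hw : w u ^+ 2 <= G * N.
    have hL := window_bound u cq ce qB'.
    have h1 : w u ^+ 2 <= 2 * (p ^+ 2 * e u ^+ 2) + 2 * window q e u ^+ 2.
      rewrite -subr_ge0 (_ : _ - _ = (p * e u - window q e u) ^+ 2); last first.
        by rewrite /w; ring.
      exact: sqr_ge0.
    have h2 : p ^+ 2 * e u ^+ 2 <= B ^+ 2 * (E * N).
      by apply: ler_pM => //; exact: sqr_ge0.
    have h3 := ler_wpM2l (ltW B2) hS.
    by rewrite /G; move: h1 h2 h3 hL; clear; lra.
  have h2 := mul_le_half (w u) (rho u) lam0.
  have h3 : lam * w u ^+ 2 <= c1 / 4 * N.
    by rewrite -lamG -mulrA ler_pM2l.
  have h4 : lam^-1 * rho u ^+ 2 <= P / lam * (dl * N).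
    by rewrite (mulrC P) -mulrA ler_pM2l ?invr_gt0.
  have h5 : y ^+ 2 / 2 - dl * (V * N) <= e u ^+ 2.
    rewrite (eE _ (ltW tu)) -/y -/dl.
    have : 0 <= (y + 2 * (v * dl)) ^+ 2 by exact: sqr_ge0.
    by move: hv; clear; lra.
  have h6 : 2 * A / k * (y ^+ 2 / 2 - dl * (V * N)) <= 2 * A / k * e u ^+ 2.
    by rewrite ler_pM2l// -mulrA mulr_gt0.
  have h7 : S - J1 <= sqwindow e u.
    rewrite Su; have : J u <= J1 by exact/Jle/ltW.
    by have := Int2_ge0 _ _ (ltW tu); clear; lra.
  have h8 : D * (dl * N) <= c1 / 4 * N.
    rewrite mulrA ler_wpM2r//; apply: le_trans etaD.
    by rewrite mulrC ler_pM2r// ltW.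
  rewrite /d /m; move: h2 h3 h4 h6 h7 h8; rewrite /D (mulrC (rho u)).
  by clear; lra.
have tte : t <= t + eta by rewrite lerDl ltW.
have := derive_le tte (cont_within (a := t) (b := t + eta) cH)
  (fun u h => dH u (proj1 (andP h))) d_le0.
rewrite subrr mulr0 addr0 (_ : J t = 0) ?addr0; last by rewrite /J /Int subrr.
rewrite (_ : t + eta - t = eta); last by ring.
move=> hfin.
(* Nonnegativity at [t + eta] leaves [W t >= J1 + eta m]; since [eta <= 1], the term [J1] pays for
   the [- eta J1] inside [eta m]. *)
have hW := W0 e (t + eta) ce; rewrite -/(W (t + eta)) in hW.
have hJ1 : 0 <= J1 by exact: J0.
have h1 : c1 * y ^+ 2 <= A / k * y ^+ 2 by rewrite ler_wpM2r// /c1 ge_min lexx.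
have h2 : c1 * S <= S by rewrite ler_piMl// /c1 ge_min lexx orbT.
have h3 : eta * (c1 / 2 * N) <= eta * (m + J1).
  by rewrite ler_pM2l// /m NE; move: h1 h2; clear; lra.
have h4 : eta * J1 <= J1 by rewrite ler_piMl.
by move: hfin hW h3 h4; rewrite -/J1 -/(W t) -/N; clear; lra.
Qed.

End Coercivity.

(** * Continuous induction and uniform continuity in a parameter *)

Section DelayHomotopy.
Variable R : realType.
Implicit Types (x f g : R -> R) (F G : R -> R -> R) (a b c s t tau B : R).

(** Supremum of the initial segments on which [P] holds. It serves both to continue positivity in
    the delay and to propagate smallness in time. *)
Lemma real_induction (P : R -> Prop) a b : a <= b -> P a ->
  (forall t, a <= t < b -> (forall s, a <= s <= t -> P s) ->
    exists2 d, 0 < d & forall s, t < s < t + d -> s <= b -> P s) ->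
  (forall t, a < t <= b -> (forall s, a <= s < t -> P s) -> P t) ->
  forall t, a <= t <= b -> P t.
Proof.
move=> ab Pa Popen Pclosed.
pose E := [set t | a <= t <= b /\ forall s, a <= s <= t -> P s].
have Ea : E a.
  by split=> [|s /le_anti <-//]; rewrite lexx.
have ubE : ubound E b by move=> t [/andP[]].
have hE : has_sup E by split; [exists a|exists b].
set m := sup E.
have am : a <= m by exact: (ub_le_sup (ex_intro _ b ubE) Ea).
have mb : m <= b by exact: (ge_sup (ex_intro _ a Ea) ubE).
have Pm s : a <= s < m -> P s.
  move=> /andP[as_ sm].
  have e0 : 0 < m - s by rewrite subr_gt0.
  have [t [_ Et] st] := sup_adherent e0 hE.
  by apply: Et; rewrite as_ ltW//; move: st; rewrite -/m subKr.
have Pm' s : a <= s <= m -> P s.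
  move=> /andP[as_]; rewrite le_eqVlt => /predU1P[->|sm]; last first.
    by apply: Pm; rewrite as_.
  case: (ltgtP a m) am => // [am' _|<- _]; last by [].
  by apply: Pclosed => //; rewrite am' mb.
suff bm : b <= m by move=> t /andP[h1 h2]; apply: Pm'; rewrite h1 (le_trans h2).
rewrite leNgt; apply/negP => mb'.
have [|d d0 Pd] := Popen m _ Pm'; first by rewrite am.
pose m' := Order.min (m + d / 2) b.
have mm' : m < m' by rewrite lt_min mb' andbT ltrDl divr_gt0.
suff : E m' by move/(ub_le_sup (ex_intro _ b ubE)); rewrite leNgt mm'.
split; first by rewrite ge_min lexx orbT andbT ltW// (le_lt_trans am).
move=> s /andP[as_ sm']; case: (leP s m) => sm; first by apply: Pm'; rewrite as_.
apply: Pd; last by rewrite (le_trans sm')// ge_min lexx orbT.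
rewrite sm; apply: (le_lt_trans sm'); rewrite gt_min ltrD2l.
by rewrite ltr_pdivrMr// ltr_pMr// ltr1n.
Qed.

(* The bound at [tau0] makes the notion stable under products. *)
Definition ucont F tau0 : Prop :=
  (forall e, 0 < e -> exists2 d, 0 < d & forall tau, `|tau - tau0| < d ->
     forall s, - 1 <= s <= 0 -> `|F tau s - F tau0 s| <= e) /\
  exists2 B, 0 < B & forall s, - 1 <= s <= 0 -> `|F tau0 s| <= B.

Lemma ucont_param g tau0 : {for tau0, continuous g} ->
  ucont (fun tau _ => g tau) tau0.
Proof.
move=> cg; split=> [e e0|]; last first.
  by exists (`|g tau0| + 1) => [|s _]; [rewrite ltr_wpDl|rewrite lerDl].
move/cvgrPdist_lt : cg => /(_ e e0) /nbhs_ballP[d /= d0 hd].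
exists d => // tau htau s _; rewrite ltW// distrC; apply: hd.
by rewrite /ball/= distrC.
Qed.

Lemma ucontD F G tau0 : ucont F tau0 -> ucont G tau0 ->
  ucont (fun tau s => F tau s + G tau s) tau0.
Proof.
move=> [cF [BF BF0 hF]] [cG [BG BG0 hG]]; split=> [e e0|].
  have e20 : 0 < e / 2 by rewrite divr_gt0.
  have [d1 d10 h1] := cF _ e20; have [d2 d20 h2] := cG _ e20.
  exists (Order.min d1 d2) => [|tau]; first by rewrite lt_min d10.
  rewrite lt_min => /andP[/h1 {}h1 /h2 {}h2] s hs.
  rewrite (_ : _ - _ = F tau s - F tau0 s + (G tau s - G tau0 s)); last by ring.
  by apply: (le_trans (ler_normD _ _)); have := h1 s hs; have := h2 s hs; clear; lra.
exists (BF + BG) => [|s hs]; first exact: addr_gt0.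
by apply: (le_trans (ler_normD _ _)); rewrite lerD ?hF ?hG.
Qed.

Lemma ucontM F G tau0 : ucont F tau0 -> ucont G tau0 ->
  ucont (fun tau s => F tau s * G tau s) tau0.
Proof.
move=> [cF [BF BF0 hF]] [cG [BG BG0 hG]]; split=> [e e0|]; last first.
  exists (BF * BG) => [|s hs]; first exact: mulr_gt0.
  by rewrite normrM ler_pM ?hF ?hG.
pose eF := Order.min 1 (e / (2 * BG)); pose eG := e / (2 * (BF + 1)).
have BF10 : 0 < BF + 1 by rewrite addr_gt0.
have eF0 : 0 < eF by rewrite lt_min ltr01 divr_gt0// mulr_gt0.
have eG0 : 0 < eG by rewrite divr_gt0// mulr_gt0.
have [d1 d10 h1] := cF _ eF0; have [d2 d20 h2] := cG _ eG0.
exists (Order.min d1 d2) => [|tau]; first by rewrite lt_min d10.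
rewrite lt_min => /andP[/h1 {}h1 /h2 {}h2] s hs.
rewrite (_ : _ - _ = F tau s * (G tau s - G tau0 s)
  + (F tau s - F tau0 s) * G tau0 s); last by ring.
apply: (le_trans (ler_normD _ _)); rewrite !normrM [leRHS](splitr e) lerD//.
  have -> : e / 2 = (BF + 1) * eG by rewrite /eG; field; rewrite gt_eqF.
  apply: ler_pM => //; last exact: h2.
  have := hF s hs; have := h1 s hs; rewrite le_min => /andP[h3 _].
  have := ler_normD (F tau s - F tau0 s) (F tau0 s); rewrite subrK.
  by move: h3; clear; lra.
have -> : e / 2 = e / (2 * BG) * BG by field; rewrite gt_eqF.
apply: ler_pM => //; last exact: hG.
by have := h1 s hs; rewrite le_min => /andP[].
Qed.

(** Mean value theorem: for [s] in [[-1, 0]] the arguments stay in [[-1, 1]], where [df] is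
    bounded. *)
Lemma ucont_dilate f (df : R -> R) tau0 : (forall s, is_derive s 1 f (df s)) ->
  continuous df -> `|tau0| <= 1 ->
  ucont (fun tau s => f (tau * (s - - 2^-1))) tau0.
Proof.
move=> dF cdf tau01; have cf : continuous f by move=> s; exact: derive_cont (dF s).
have sle s : - 1 <= s <= 0 -> `|s - - 2^-1| <= 2^-1.
  by move=> /andP[h1 h2]; rewrite ler_norml; lra.
have [B B0 hB] := cont_bounded (- 1) 1 cdf; split; last first.
  have [B' B'0 hB'] := cont_bounded (- 1) 1 cf; exists B' => // s hs.
  apply: hB'; rewrite -ler_norml normrM.
  by apply: le_trans (ler_pM _ _ tau01 (sle s hs)) _ => //; lra.
move=> e e0; pose d := Order.min 1 (e / B).
exists d => [|tau htau s hs]; first by rewrite lt_min ltr01 divr_gt0.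
have tau2 : `|tau| <= 2.
  have := ler_normD (tau - tau0) tau0; rewrite subrK.
  by move: htau; rewrite lt_min => /andP[h _]; move: h tau01; clear; lra.
have dtau : `|tau - tau0| <= e / B by move: htau; rewrite lt_min => /andP[_ /ltW].
pose u := tau * (s - - 2^-1); pose u0 := tau0 * (s - - 2^-1).
have huu0 : `|u - u0| <= e / B.
  rewrite /u /u0 -mulrBl normrM -[leRHS]mulr1; apply: ler_pM => //.
  by apply: le_trans (sle s hs) _; lra.
have hu w : `|w| <= 2 -> - 1 <= w * (s - - 2^-1) <= 1.
  move=> hw; rewrite -ler_norml normrM.
  by apply: le_trans (ler_pM _ _ hw (sle s hs)) _ => //; lra.
have hu1 := hu tau tau2; have hu2 : - 1 <= u0 <= 1 by apply: hu; lra.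
rewrite -/u in hu1.
suff lip v w : - 1 <= v -> v <= w -> w <= 1 -> `|f w - f v| <= B * `|w - v|.
  have : `|f u - f u0| <= B * `|u - u0|.
    case: (leP u u0) => huu.
      by rewrite distrC (distrC u); apply: lip; lra.
    by apply: lip; lra.
  by move/le_trans; apply; rewrite mulrC -ler_pdivlMr.
move=> hv vw hw.
have [y] := MVT_segment vw (fun t _ => dF t) (cont_within cf).
rewrite in_itv/= => /andP[h1 h2] ->; rewrite normrM ler_wpM2r// hB//.
by rewrite (le_trans hv h1) (le_trans h2 hw).
Qed.

Lemma ucont_eq F G tau0 : (forall tau s, F tau s = G tau s) ->
  ucont G tau0 -> ucont F tau0.
Proof. by move=> FG; rewrite (_ : F = G)//; apply/funext => tau; apply/funext. Qed.

End DelayHomotopy.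

(** * Kernels for delays between 0 and 1, and the continuation of positivity *)

Section ScaledKernel.
Variable R : realType.
Implicit Types (x f g : R -> R) (F G : R -> R -> R) (s t tau e B : R).

Lemma ucontN F tau0 : ucont F tau0 -> ucont (fun tau s => - F tau s) tau0.
Proof.
move=> hF; apply: (@ucont_eq _ _ (fun tau s => - 1 * F tau s)).
  by move=> tau s; rewrite mulN1r.
by apply: ucontM => //; apply: ucont_param; exact: cst_continuous.
Qed.

Lemma contAM f g t : {for t, continuous f} -> {for t, continuous g} ->
  {for t, continuous (fun s => f s * g s)}.
Proof. by move=> cf cg; apply: cvgM. Qed.

Lemma contAD f g t : {for t, continuous f} -> {for t, continuous g} ->
  {for t, continuous (fun s => f s + g s)}.
Proof. by move=> cf cg; apply: cvgD. Qed.

Lemma contAV f t : f t != 0 -> {for t, continuous f} ->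
  {for t, continuous (fun s => (f s)^-1)}.
Proof. by move=> f0 cf; apply: cvgV. Qed.

Variables (A k : R) (c0 c1 c2 c3 c4 : R -> R).
Hypotheses (A0 : 0 < A) (k0 : 0 < k).
Hypothesis st : stumpff (2 * k - A ^+ 2) c0 c1 c2 c3 c4.
Hypothesis pos : forall s, 0 < s <= 2^-1 -> 0 < A * c1 s + c0 s.

Let h : R := 2^-1.
Let C0 tau s : R := c0 (tau * s).
Let C1 tau s : R := tau^-1 * c1 (tau * s).
Let C2 tau s : R := tau ^- 2 * c2 (tau * s).
Let C3 tau s : R := tau ^- 3 * c3 (tau * s).
Let C4 tau s : R := tau ^- 4 * c4 (tau * s).

(* Shortening the delay from [1] to [tau] and rescaling time turns [(A, k)] into
   [(tau A, tau^2 k)]. *)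
Let Qt tau := kQ (tau * A) (tau ^+ 2 * k) (C0 tau) (C1 tau) (C2 tau) (C3 tau) (C4 tau).
Let qt tau := kq (tau * A) (tau ^+ 2 * k) (C0 tau) (C1 tau) (C2 tau) (C3 tau).
Let dqt tau := kdq (tau * A) (tau ^+ 2 * k) (C0 tau) (C1 tau) (C2 tau) (C3 tau).
Let pt tau : R := (tau ^+ 2 * k)^-1 - Qt tau 0.
Let dent tau : R := kden (tau * A) (C0 tau) (C1 tau).
Let coeft tau : R := kcoef (tau * A) (tau ^+ 2 * k) (C0 tau) (C1 tau) (C2 tau) (C3 tau).

(** The scaling factors cancel, so a single function on []0, 1/2]] controls the denominator for
    every delay at once. *)
Let dentE tau : tau != 0 -> dent tau = A * c1 (tau * h) + c0 (tau * h).
Proof. by move=> t0; rewrite /dent /kden /C1 /C0 -/h; field. Qed.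

Let dent_neq0 tau : 0 < tau <= 1 -> dent tau != 0.
Proof.
move=> /andP[t0 t1]; rewrite dentE ?gt_eqF// pos// mulr_gt0 ?invr_gt0//=.
by rewrite ler_piMl ?invr_ge0.
Qed.

Lemma scaled_lyap_kernel tau : 0 < tau <= 1 ->
  lyap_kernel (tau * A) (tau ^+ 2 * k) (pt tau) (Qt tau) (qt tau) (dqt tau).
Proof.
move=> ht; have den0 := dent_neq0 ht.
have t0 : tau != 0 by case/andP: ht => /gt_eqF ->.
have stt : stumpff (2 * (tau ^+ 2 * k) - (tau * A) ^+ 2)
    (C0 tau) (C1 tau) (C2 tau) (C3 tau) (C4 tau).
  rewrite (_ : _ - _ = tau ^+ 2 * (2 * k - A ^+ 2)); last by ring.
  exact: stumpff_scale st t0.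
split.
- exact: derive_kQ stt.
- exact: derive_kq stt.
- exact: kQ_ode stt.
- exact: kQ_N1 stt.
- exact: kq_N1 stt den0.
- exact: kq_0 stt den0.
- by [].
- exact: separable_kQ stt.
- exact: separable_kQ_reflect stt.
- exact: separable_kq stt.
- exact: cont_kdq stt.
Qed.

Section Continuity.
Variable tau0 : R.
Hypothesis htau0 : 0 < tau0 <= 1.

Let tau0n0 : tau0 != 0. Proof. by case/andP: htau0 => /gt_eqF ->. Qed.
Let tau0_le1 : `|tau0| <= 1.
Proof. by case/andP: htau0 => h1 h2; rewrite gtr0_norm. Qed.

Let cvar : {for tau0, continuous (fun tau : R => tau)}.
Proof. exact: cvg_id. Qed.

Let cexp n : {for tau0, continuous (fun tau : R => tau ^+ n)}.
Proof. exact: exprn_continuous. Qed.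

Let cexpV n : {for tau0, continuous (fun tau : R => tau ^- n)}.
Proof. by apply: contAV; rewrite ?expf_neq0//; exact: cexp. Qed.

Let cinv : {for tau0, continuous (fun tau : R => tau^-1)}.
Proof. exact: contAV. Qed.

Let cath f : continuous f -> {for tau0, continuous (fun tau => f (tau * h))}.
Proof.
move=> cf; apply: (@continuous_comp _ _ _ (fun tau => tau * h) f); last exact: cf.
by apply: contAM => //; exact: cst_continuous.
Qed.

Let cc0 : continuous c0. Proof. exact: separable_cont (stumpff_s0 st). Qed.
Let cc1 : continuous c1. Proof. exact: separable_cont (stumpff_s1 st). Qed.
Let cc2 : continuous c2. Proof. exact: separable_cont (stumpff_s2 st). Qed.
Let cc3 : continuous c3. Proof. exact: separable_cont (stumpff_s3 st). Qed.
Let cc4 : continuous c4. Proof. exact: separable_cont (stumpff_s4 st). Qed.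

Let ucst c : ucont (fun _ _ => c) tau0.
Proof. by apply: ucont_param; exact: cst_continuous. Qed.
Let uA : ucont (fun tau _ => tau * A) tau0.
Proof. by apply: ucontM; [exact: ucont_param|exact: ucst]. Qed.
Let uk : ucont (fun tau _ => tau ^+ 2 * k) tau0.
Proof. by apply: ucontM; [exact: ucont_param|exact: ucst]. Qed.

Let uh0 : ucont (fun tau _ => C0 tau h) tau0.
Proof. by apply: ucont_param; exact: cath. Qed.
Let uh1 : ucont (fun tau _ => C1 tau h) tau0.
Proof. by apply: ucontM; apply: ucont_param => //; exact: cath. Qed.
Let uh2 : ucont (fun tau _ => C2 tau h) tau0.
Proof. by apply: ucontM; apply: ucont_param; [exact: cexpV|exact: cath]. Qed.
Let uh3 : ucont (fun tau _ => C3 tau h) tau0.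
Proof. by apply: ucontM; apply: ucont_param; [exact: cexpV|exact: cath]. Qed.
Let uh4 : ucont (fun tau _ => C4 tau h) tau0.
Proof. by apply: ucontM; apply: ucont_param; [exact: cexpV|exact: cath]. Qed.

Let us0 : ucont (fun tau s => C0 tau (s - - h)) tau0.
Proof.
apply: (ucont_dilate (stumpff_d0 st)) => //.
by apply: cont_cmulf.
Qed.
Let us1 : ucont (fun tau s => C1 tau (s - - h)) tau0.
Proof.
by apply: ucontM; [exact: ucont_param|exact: ucont_dilate (stumpff_d1 st) cc0 _].
Qed.
Let us2 : ucont (fun tau s => C2 tau (s - - h)) tau0.
Proof.
apply: ucontM; first by apply: ucont_param; exact: cexpV.
exact: ucont_dilate (stumpff_d2 st) cc1 _.
Qed.
Let us3 : ucont (fun tau s => C3 tau (s - - h)) tau0.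
Proof.
apply: ucontM; first by apply: ucont_param; exact: cexpV.
exact: ucont_dilate (stumpff_d3 st) cc2 _.
Qed.
Let us4 : ucont (fun tau s => C4 tau (s - - h)) tau0.
Proof.
apply: ucontM; first by apply: ucont_param; exact: cexpV.
exact: ucont_dilate (stumpff_d4 st) cc3 _.
Qed.

Let uden : ucont (fun tau _ => (dent tau)^-1) tau0.
Proof.
apply: ucont_param; apply: contAV; first exact: dent_neq0.
apply: contAD; last exact: cath.
apply: contAM; first by apply: contAM => //; exact: cst_continuous.
by apply: contAM; [exact: cinv|exact: cath].
Qed.

Let ucoef : ucont (fun tau _ => coeft tau) tau0.
Proof.
apply: ucontM uden; apply: ucontN; apply: ucontD; last exact: ucontM.
by apply: ucontD => //; apply: ucontM => //; exact: ucontM.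
Qed.

Let u1cA : ucont (fun tau _ => 1 + coeft tau * (tau * A)) tau0.
Proof. by apply: ucontD => //; exact: ucontM. Qed.

Let u2k : ucont (fun tau _ => 2 * (tau ^+ 2 * k)) tau0.
Proof. exact: ucontM. Qed.

Lemma ucont_Qt : ucont Qt tau0.
Proof.
apply: ucontD; last by apply: ucontD; exact: ucontM.
apply: ucontD; last by apply: ucontN; exact: ucontM.
apply: ucontD; last by apply: ucontN; exact: ucontM.
apply: ucontD; first by apply: ucontD; exact: ucontM.
by apply: ucontD; exact: ucontM.
Qed.

Lemma ucont_qt : ucont qt tau0.
Proof.
apply: ucontD; last by apply: ucontD; exact: ucontM.
apply: ucontD; last by apply: ucontN; exact: ucontM.
by apply: ucontM => //; exact: ucontN.
Qed.

Lemma ucont_Yt : ucont (fun tau s => tau ^+ 2 * k * Qt tau s) tau0.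
Proof. by apply: ucontM => //; exact: ucont_Qt. Qed.

Lemma ucont_pt : ucont (fun tau _ => pt tau) tau0.
Proof.
apply: ucontD.
  apply: ucont_param; apply: contAV; last first.
    by apply: contAM; [exact: cexp|exact: cst_continuous].
  by apply: mulf_neq0; [exact: expf_neq0|rewrite gt_eqF].
apply: ucontN; have [hQ [B B0 hB]] := ucont_Qt.
have h0 : -1 <= (0 : R) <= 0 by rewrite lexx andbT lerN10.
split=> [e e0|]; last by exists B => // s _; exact: hB.
have [d d0 hd] := hQ e e0; exists d => // tau htau s _.
exact: hd.
Qed.

End Continuity.

Let Wt tau := lyapW (pt tau) (qt tau) (fun s => tau ^+ 2 * k * Qt tau s).

(** [lyapM] is the same for all delays and drops out of the difference; the factor 5 is that of
    [lyapV_bound]. *)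
Lemma Wt_near tau0 e : 0 < tau0 <= 1 -> 0 < e -> exists2 d, 0 < d &
  forall tau, 0 < tau <= 1 -> `|tau - tau0| < d -> forall x t, continuous x ->
    `|Wt tau x t - Wt tau0 x t| <= e * state_norm x t.
Proof.
move=> ht0 e0; have e5 : 0 < e / 5 by rewrite divr_gt0.
have [cq _] := ucont_qt ht0; have [cY _] := ucont_Yt ht0.
have [cp _] := ucont_pt ht0.
have [d1 d10 h1] := cq _ e5; have [d2 d20 h2] := cY _ e5.
have [d3 d30 h3] := cp _ e5.
exists (Order.min d1 (Order.min d2 d3)) => [|tau ht]; first by rewrite !lt_min d10 d20.
rewrite !lt_min => /and3P[/h1 {}h1 /h2 {}h2 /h3 {}h3] x t cx.
have lk := scaled_lyap_kernel ht; have lk0 := scaled_lyap_kernel ht0.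
have s1 := separable_cont (lk_sq lk); have s2 := separable_cont (lk_sq lk0).
have s3 := separableZ (tau ^+ 2 * k) (lk_sQ lk).
have s4 := separableZ (tau0 ^+ 2 * k) (lk_sQ lk0).
have s5 := separableZ (tau ^+ 2 * k) (lk_sQr lk).
have s6 := separableZ (tau0 ^+ 2 * k) (lk_sQr lk0).
have c3' := separable_cont s3; have c4' := separable_cont s4.
have -> : Wt tau x t - Wt tau0 x t =
    lyapV (pt tau) (qt tau) (fun s => tau ^+ 2 * k * Qt tau s) x t
    - lyapV (pt tau0) (qt tau0) (fun s => tau0 ^+ 2 * k * Qt tau0 s) x t.
  by rewrite /Wt /lyapW; ring.
rewrite lyapV_sub//.
rewrite (_ : e = 5 * (e / 5)); last by field.
apply: lyapV_bound => //.
- by apply: cont_addf => //; exact: cont_cmulf.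
- by apply: cont_addf => //; exact: cont_cmulf.
- exact: separableD s5 (separableZ _ s6).
- by apply: (h3 0); rewrite lexx andbT lerN10.
- by move=> s hs; rewrite mulN1r; exact: h1.
- by move=> s hs; rewrite mulN1r; exact: h2.
Qed.

Lemma pow_bound f (df : R -> R) n B : f 0 = 0 -> (forall s, is_derive s 1 f (df s)) ->
  (forall s, `|s| <= 1 -> `|df s| <= B * `|s| ^+ n) ->
  forall s, `|s| <= 1 -> `|f s| <= B * `|s| ^+ n.+1.
Proof.
move=> f0 fd dfB s s1.
have cf : continuous f by move=> u; exact: derive_cont (fd u).
suff [c hc ->] : exists2 c, `|c| <= `|s| & f s = df c * s.
  rewrite normrM exprSr mulrA ler_wpM2r//.
  apply: le_trans (dfB c (le_trans hc s1)) _.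
  have B0 : 0 <= B.
    have := dfB 1; rewrite normr1 expr1n mulr1 lexx => /(_ isT); exact: le_trans.
  by rewrite ler_wpM2l// lerXn2r ?nnegrE.
have [s0|s0] := leP 0 s.
  have [c] := MVT_segment s0 (fun u _ => fd u) (cont_within cf).
  rewrite in_itv/= f0 !subr0 => /andP[h1 h2] ->; exists c => //.
  by rewrite !ger0_norm.
have [c] := MVT_segment (ltW s0) (fun u _ => fd u) (cont_within cf).
rewrite in_itv/= f0 !sub0r => /andP[h1 h2] e; exists c.
  by rewrite !ler0_norm ?lerN2// ltW.
by apply: oppr_inj; rewrite e mulrN.
Qed.

(** [c_j] vanishes to order [j] at 0, which compensates the factor [tau ^- j] down to [tau = 0]. *)
Let bound_all : exists2 B, 0 < B & forall tau s, 0 < tau <= 1 -> `|s| <= 1 ->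
  [/\ `|C0 tau s| <= B, `|C1 tau s| <= B, `|C2 tau s| <= B,
      `|C3 tau s| <= B & `|C4 tau s| <= B].
Proof.
have [B B0 hB] := cont_bounded (- 1) 1 (separable_cont (stumpff_s0 st)).
have b0 s : `|s| <= 1 -> `|c0 s| <= B * `|s| ^+ 0.
  by rewrite mulr1 ler_norml; exact: hB.
have z1 : c1 0 = 0 by have := stumpff_p1 st 0; rewrite oppr0; lra.
have z3 : c3 0 = 0 by have := stumpff_p3 st 0; rewrite oppr0; lra.
have b1 := pow_bound z1 (stumpff_d1 st) b0.
have b2 := pow_bound (stumpff_z2 st) (stumpff_d2 st) b1.
have b3 := pow_bound z3 (stumpff_d3 st) b2.
have b4 := pow_bound (stumpff_z4 st) (stumpff_d4 st) b3.
exists B => // tau s /andP[t0 t1] s1.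
have ts : `|tau * s| <= 1 by rewrite normrM mulr_ile1// gtr0_norm.
have gen n (c : R -> R) : (forall s, `|s| <= 1 -> `|c s| <= B * `|s| ^+ n) ->
    `|tau ^- n * c (tau * s)| <= B.
  move=> /(_ _ ts) hc; rewrite normrM gtr0_norm ?invr_gt0 ?exprn_gt0//.
  rewrite ler_pdivrMl ?exprn_gt0//; apply: le_trans hc _.
  rewrite mulrC ler_wpM2r// ?(ltW B0)// normrM exprMn gtr0_norm//.
  by apply: ler_piMr; [exact/exprn_ge0/ltW|exact: exprn_ile1].
split.
- by have := gen 0%N c0 b0; rewrite expr0 invr1 mul1r.
- exact: gen 1%N c1 b1.
- exact: gen 2%N c2 b2.
- exact: gen 3%N c3 b3.
- exact: gen 4%N c4 b4.
Qed.

(** As [tau] tends to 0 the denominator tends to [c0 0 = 1], hence stays above [1/2], and everything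
    else is bounded by [bound_all]. *)
Let kernel_bound : exists2 M, 0 < M & exists2 t1, 0 < t1 <= 1 &
  forall tau, 0 < tau <= t1 -> forall s, - 1 <= s <= 0 ->
    `|Qt tau s| <= M /\ `|qt tau s| <= M.
Proof.
have [B B0 hB] := bound_all.
have cden : {for 0, continuous (fun tau => A * c1 (tau * h) + c0 (tau * h))}.
  have ch : {for 0, continuous (fun tau : R => tau * h)}.
    by apply: contAM; [exact: cvg_id|exact: cst_continuous].
  have cc0 := separable_cont (stumpff_s0 st).
  have cc1 := separable_cont (stumpff_s1 st).
  apply: contAD; last exact: (continuous_comp ch (cc0 _)).
  apply: contAM; first exact: cst_continuous.
  exact: (continuous_comp ch (cc1 _)).
have z1 : c1 0 = 0 by have := stumpff_p1 st 0; rewrite oppr0; lra.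
have z0 : c0 0 = 1 by have := stumpff_e0 st 0; rewrite (stumpff_z2 st) mulr0 addr0.
have half0 : (0 : R) < 2^-1 by rewrite invr_gt0.
move/cvgrPdist_lt : cden => /(_ _ half0) /nbhs_ballP[d /= d0 hd].
pose t1 := Order.min 1 (d / 2).
have t10 : 0 < t1 by rewrite lt_min ltr01 divr_gt0.
pose K1 := 2 * (B * (1 + 2 * k + A)).
have K10 : 0 < K1 by rewrite !mulr_gt0// !addr_gt0// mulr_gt0.
pose L := 1 + K1 * A.
have L0 : 0 < L by rewrite addr_gt0// mulr_gt0.
pose X := L * B + 2 * k * B + (A * B + K1 * B).
have X0 : 0 < X.
  have := mulr_gt0 L0 B0; have := mulr_gt0 k0 B0; have := mulr_gt0 A0 B0.
  by have := mulr_gt0 K10 B0; rewrite /X; lra.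
exists (2 * X) => [|]; first by rewrite mulr_gt0.
exists t1 => [|tau /andP[tau0 tau1]]; first by rewrite t10 ge_min lexx.
have tau_le1 : tau <= 1 by apply: le_trans tau1 _; rewrite ge_min lexx.
have ht : 0 < tau <= 1 by rewrite tau0.
have den : 2^-1 <= dent tau.
  rewrite dentE ?gt_eqF//.
  have /hd : ball (0 : R) d tau.
    rewrite /ball/= sub0r normrN gtr0_norm//; apply: le_lt_trans tau1 _.
    rewrite gt_min; apply/orP; right.
    by rewrite ltr_pdivrMr// ltr_pMr// ltr1n.
  rewrite mul0r z1 z0 mulr0 add0r => /ltW hh.
  by have := ler_norm (1 - (A * c1 (tau * h) + c0 (tau * h))); move: hh; lra.
have hb s : `|s| <= 1 -> [/\ `|C0 tau s| <= B, `|C1 tau s| <= B, `|C2 tau s| <= B,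
      `|C3 tau s| <= B & `|C4 tau s| <= B] by exact: hB.
have nA : `|tau * A| <= A.
  by rewrite gtr0_norm ?mulr_gt0// ler_piMl// ltW.
have nk : `|tau ^+ 2 * k| <= k.
  rewrite gtr0_norm ?mulr_gt0 ?exprn_gt0// ler_piMl// ?(ltW k0)//.
  by rewrite exprn_ile1// ltW.
have n2k : `|2 * (tau ^+ 2 * k)| <= 2 * k by rewrite normrM ger0_norm// ler_pM2l.
have nM (a b a' b' : R) : `|a| <= a' -> `|b| <= b' -> `|a * b| <= a' * b'.
  by move=> h1 h2; rewrite normrM ler_pM.
have nD (a b a' b' : R) : `|a| <= a' -> `|b| <= b' -> `|a + b| <= a' + b'.
  by move=> h1 h2; apply: le_trans (ler_normD _ _) _; rewrite lerD.
have nB (a b a' b' : R) : `|a| <= a' -> `|b| <= b' -> `|a - b| <= a' + b'.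
  by move=> h1 h2; apply: le_trans (ler_normB _ _) _; rewrite lerD.
have nh : `|h| <= 1 by rewrite /h ger0_norm ?invr_ge0// invf_le1// ler1n.
have [h0 h1 h2 h3 h4] := hb h nh.
have ncoef : `|coeft tau| <= K1.
  rewrite /coeft /kcoef -/(dent tau) -/h mulrC; apply: (nM).
    rewrite normfV invf_ple ?posrE ?normr_gt0 ?dent_neq0//.
    by apply: le_trans den _; exact: ler_norm.
  rewrite normrN (_ : B * _ = B + 2 * k * B + A * B); last by ring.
  by apply: (nD _ _ _ _ (nD _ _ _ _ h1 (nM _ _ _ _ n2k h3)) (nM _ _ _ _ nA h2)).
have n1c : `|1 + coeft tau * (tau * A)| <= L.
  by apply: nD; [rewrite normr1|exact: nM].
have nc1c : `|- (1 + coeft tau * (tau * A))| <= L by rewrite normrN.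
have ncst : `|kcst (tau * A) (tau ^+ 2 * k) (C0 tau) (C1 tau) (C2 tau) (C3 tau) (C4 tau)| <= X.
  exact: (nD _ _ _ _ (nD _ _ _ _ (nM _ _ _ _ n1c h2) (nM _ _ _ _ n2k h4))
    (nD _ _ _ _ (nM _ _ _ _ nA h3) (nM _ _ _ _ ncoef h1))).
move=> s hs; have ns : `|s - - h| <= 1 by rewrite ler_norml /h; move: hs; lra.
have [s0 s1 s2 s3 s4] := hb _ ns; split.
  rewrite (_ : 2 * X = X + L * B + 2 * k * B + (A * B + K1 * B)); last by rewrite /X; ring.
  exact: (nD _ _ _ _ (nB _ _ _ _ (nB _ _ _ _ ncst (nM _ _ _ _ n1c s2))
    (nM _ _ _ _ n2k s4)) (nD _ _ _ _ (nM _ _ _ _ nA s3) (nM _ _ _ _ ncoef s1))).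
apply: (@le_trans _ _ X); last by rewrite ler_peMl ?(ltW X0)// ler1n.
exact: (nD _ _ _ _ (nB _ _ _ _ (nM _ _ _ _ nc1c s1) (nM _ _ _ _ n2k s3))
  (nD _ _ _ _ (nM _ _ _ _ nA s2) (nM _ _ _ _ ncoef s0))).
Qed.

Let Wt_ge0_small : exists2 t1, 0 < t1 <= 1 &
  forall tau, 0 < tau <= t1 -> forall x t, continuous x -> 0 <= Wt tau x t.
Proof.
have [M M0 [t1 /andP[t10 t11] hM]] := kernel_bound.
pose p0 := 4 * M ^+ 2 + 1 + M.
have M2 : 0 < M ^+ 2 by rewrite exprn_gt0.
have p00 : 0 < p0 by rewrite /p0; move: M0 M2; lra.
(* Below [t1] the kernels are bounded by [M]; the second bound gives [|Y| <= 1/20], so the [Y] terms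
   cost a fifth of the window; the third gives [p >= 4 M^2], so the cross term with [q] costs a
   quarter. Both fit into [lyapM]. *)
pose t2 := Order.min t1 (Order.min (20 * (k * M))^-1 (k * p0)^-1).
have kM : 0 < 20 * (k * M) by rewrite !mulr_gt0.
have kp : 0 < k * p0 by rewrite mulr_gt0.
exists t2; first by rewrite !lt_min t10 !invr_gt0 kM kp/= ge_min t11.
move=> tau /andP[tau0]; rewrite !le_min => /and3P[h1 h2 h3] x t cx.
have ht : 0 < tau <= 1 by rewrite tau0 (le_trans h1).
have ht1 : 0 < tau <= t1 by rewrite tau0.
have tt : tau ^+ 2 <= tau by rewrite expr2 ler_piMl ?(ltW tau0)// (le_trans h1).
have tau2 : 0 < tau ^+ 2 by rewrite exprn_gt0.
have lk := scaled_lyap_kernel ht.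
have sq := lk_sq lk; have cq := separable_cont sq.
have sY := separableZ (tau ^+ 2 * k) (lk_sQ lk).
have sYr := separableZ (tau ^+ 2 * k) (lk_sQr lk).
have h0 : -1 <= (0 : R) <= 0 by rewrite lexx andbT lerN10.
have b20 : 0 < (20 : R)^-1 by rewrite invr_gt0.
have hY s : - 1 <= s <= 0 -> `|tau ^+ 2 * k * Qt tau s| <= 20^-1.
  move=> hs; have [hQ _] := hM tau ht1 s hs.
  rewrite normrM gtr0_norm ?mulr_gt0//.
  apply: (@le_trans _ _ (tau * (k * M))).
    rewrite mulrA; apply: ler_pM => //; first by rewrite mulr_ge0// ltW.
    by rewrite ler_pM2r.
  by move: h2; rewrite invfM -ler_pdivlMr ?mulr_gt0// mulrC.
have hV := lyapV_bound_Y (pt tau) (qt tau) t b20 cx (separable_cont sY) sYr hY.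
have hq s : - 1 <= s <= 0 -> `|qt tau s| <= M by move=> /(hM tau ht1)[].
have hL := window_bound t cq cx hq.
have S0 := sqwindow_ge0 t cx.
have /andP[hMm _] := lyapM_bound t cx.
have hp : 4 * M ^+ 2 <= pt tau.
  have [hQ _] := hM tau ht1 0 h0.
  have : p0 <= (tau ^+ 2 * k)^-1.
    rewrite -[p0]invrK lef_pV2 ?posrE ?invr_gt0 ?mulr_gt0//.
    rewrite -ler_pdivlMr// -invfM mulrC; exact: le_trans tt h3.
  have := ler_norm (Qt tau 0); rewrite /pt; move: hQ M0; rewrite /p0; lra.
have M4 : 0 < 4 * M ^+ 2 by rewrite mulr_gt0.
have h5 := norm_mul_le (x t) (window (qt tau) x t) M4.
have h6 : (4 * M ^+ 2)^-1 * window (qt tau) x t ^+ 2 <= 4^-1 * sqwindow x t.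
  by rewrite invfM -mulrA ler_pM2l ?invr_gt0// ler_pdivrMl.
have h7 : 4 * M ^+ 2 * x t ^+ 2 <= pt tau * x t ^+ 2 by rewrite ler_wpM2r ?sqr_ge0.
rewrite /Wt /lyapW; move: hV h5 h6 h7 hMm S0.
move: (lyapV _ _ _ _ _) (lyapM _ _) (sqwindow x t) (x t * _) (_ * window _ _ _ ^+ 2) => V Mm S a b.
rewrite ler_norml => /andP[hV1 hV2] h5.
have := lerNnormlW (lexx `|a|); move: hV1 h5; lra.
Qed.

Lemma lyapunov_functional : exists p Q q dq, lyap_kernel A k p Q q dq /\
  exists2 c, 0 < c & forall x t, continuous x ->
    c * state_norm x t <= lyapW p q (fun s => k * Q s) x t.
Proof.
have [t1 /andP[t10 t11] small] := Wt_ge0_small.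
have key tau : 0 < tau <= 1 ->
    (forall x t, continuous x -> 0 <= Wt tau x t) ->
    exists2 c, 0 < c & forall x t, continuous x -> c * state_norm x t <= Wt tau x t.
  move=> ht; apply: lyapW_coercive (scaled_lyap_kernel ht).
  - by rewrite mulr_gt0//; case/andP: ht.
  - by rewrite mulr_gt0// exprn_gt0//; case/andP: ht.
have one1 : 0 < (1 : R) <= 1 by rewrite lexx andbT ltr01.
suff W1 x t : continuous x -> 0 <= Wt 1 x t.
  have lk := scaled_lyap_kernel one1; have [c c0' hc] := key _ one1 W1.
  rewrite expr1n !mul1r in lk; exists (pt 1), (Qt 1), (qt 1), (dqt 1); split=> //.
  exists c => // x t cx; have := hc x t cx.
  by rewrite /Wt expr1n; under [X in lyapW _ _ X]funext do rewrite mul1r.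
move: x t; pose P tau := forall x t, continuous x -> 0 <= Wt tau x t.
have t1in : t1 <= (1 : R) <= 1 by apply/andP; split.
apply: (@real_induction _ P t1 1) t1in => //.
- by apply: small; rewrite t10/=.
(* Nonnegativity at [tau] is upgraded to coercivity with constant [c], which leaves room for a
   perturbation of size [c] of the kernels. *)
- move=> tau /andP[h1 h2] hP.
  have ht : 0 < tau <= 1 by rewrite (lt_le_trans t10 h1) ltW.
  have hPt : P tau by apply: hP; apply/andP; split.
  have [c c0' hc] := key tau ht hPt.
  have [d d0 hd] := Wt_near ht c0'; exists d => // s /andP[s1 s2] s3 x t cx.
  have hs : 0 < s <= 1 by rewrite s3 andbT (lt_trans _ s1)//; case/andP: ht.
  have hsd : `|s - tau| < d by rewrite gtr0_norm ?subr_gt0// ltrBlDl.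
  have := hd s hs hsd x t cx; rewrite ler_norml => /andP[+ _].
  by have := hc x t cx; lra.
- move=> tau /andP[h1 h2] hP x t cx.
  have ht : 0 < tau <= 1 by rewrite (lt_trans t10 h1).
  rewrite leNgt; apply/negP => neg.
  have N0 := state_norm_ge0 t cx.
  (* A perturbation of relative size [e] is too small to bring a negative value up to 0; the [+ 1]
     covers the zero history. *)
  pose e := - Wt tau x t / (state_norm x t + 1).
  have N1 : 0 < state_norm x t + 1 by rewrite ltr_wpDl.
  have e0 : 0 < e by rewrite divr_gt0// oppr_gt0.
  have [d d0 hd] := Wt_near ht e0.
  pose s := Order.max t1 (tau - d / 2).
  have st' : s < tau.
    by rewrite gt_max h1 ltrBlDr ltrDl divr_gt0.
  have ts : t1 <= s by rewrite le_max lexx.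
  have hs : 0 < s <= 1 by rewrite (lt_le_trans t10 ts) (le_trans (ltW st')).
  have hsd : `|s - tau| < d.
    rewrite distrC gtr0_norm ?subr_gt0// ltrBlDr -ltrBlDl.
    have : tau - d / 2 <= s by rewrite le_max lexx orbT.
    by apply: lt_le_trans; rewrite ltrD2l ltrN2 ltr_pdivrMr// ltr_pMr// ltr1n.
  have := hd s hs hsd x t cx; rewrite ler_norml => /andP[_].
  have : 0 <= Wt s x t by apply: hP => //; rewrite ts.
  have : e * (state_norm x t + 1) = - Wt tau x t by rewrite divfK// gt_eqF.
  by move: e0; lra.
Qed.

End ScaledKernel.

(** * Characteristic equation and nonvanishing of the denominator *)

Section Characteristic.
Variable R : realType.
Implicit Types (A k b x s : R).

(* The first purely imaginary root crosses at [i beta] with [beta / 2] in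
   [pi / 2, pi]; there [2 k = A^2 + beta^2]. *)
Lemma first_crossing A k : 0 < A ->
  (forall b, 0 < b -> sin b != 0 -> b = A * (cos b - 1) / sin b ->
    k < - A * b / sin b) ->
  exists2 x, 0 < x < pi &
    A * sin x + 2 * x * cos x = 0 /\ 2 * k - A ^+ 2 < (2 * x) ^+ 2.
Proof.
move=> A0 crit.
have pi0 := @pi_gt0 R.
pose G x := A * sin x + 2 * x * cos x.
have cG : continuous G.
  apply: cont_addf; first exact/cont_cmulf/continuous_sin.
  exact: cont_mulf (cont_cmulf (@cont_idf R)) (@continuous_cos R).
have G1 : G (pi / 2) = A by rewrite /G sin_pihalf cos_pihalf; ring.
have G2 : G pi = - (2 * pi) by rewrite /G sinpi cospi; ring.
have hpi : pi / 2 <= pi :> R by lra.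
have [|x] := @IVT _ G _ _ 0 hpi (cont_within cG).
  by rewrite G1 G2 min_r ?max_l ?oppr_le0; lra.
rewrite in_itv/= => /andP[x1 x2] Gx.
have x1' : pi / 2 < x.
  by rewrite lt_neqAle x1 andbT; apply: contra_eq_neq Gx => <-; rewrite G1 gt_eqF.
have x2' : x < pi.
  rewrite lt_neqAle x2 andbT; apply: contra_eq_neq Gx => ->.
  by rewrite G2 lt_eqF// oppr_lt0 mulr_gt0.
have x0 : 0 < x by apply: lt_trans x1'; rewrite divr_gt0.
exists x; first by rewrite x0.
split=> //.
have s0 : 0 < sin x by rewrite sin_gt0_pi// x0.
have c0 : cos x < 0.
  have : 2 * x * cos x < 0.
    by have := mulr_gt0 A0 s0; move: Gx; rewrite /G; lra.
  by rewrite pmulr_rlt0// mulr_gt0.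
have sE : sin (2 * x) = 2 * (sin x * cos x) by rewrite mulr2n mulrDl !mul1r sinD; ring.
have cE : cos (2 * x) - 1 = - 2 * sin x ^+ 2.
  by rewrite mulr2n mulrDl !mul1r cosD -!expr2 cos2sin2; ring.
have sn : sin x != 0 by rewrite gt_eqF.
have cn : cos x != 0 by rewrite lt_eqF.
have AE : A = - 2 * x * cos x / sin x.
  by apply: (mulIf sn); rewrite divfK//; move: Gx; rewrite /G; lra.
have := crit (2 * x); rewrite sE cE mulr_gt0// !mulf_neq0// => /(_ isT isT).
move=> /(_ _)/wrap[|hk].
  by rewrite {1}AE; field; rewrite sn cn.
suff -> : (2 * x) ^+ 2 = 2 * (- A * (2 * x) / (2 * (sin x * cos x))) - A ^+ 2.
  by lra.
rewrite AE; transitivity (4 * x ^+ 2 * (1 - cos x ^+ 2) / sin x ^+ 2).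
  by rewrite -sin2cos2 mulfK ?expf_neq0//; ring.
by field; rewrite sn cn.
Qed.

(** In the oscillating case, with [w^2 = 2 k - A^2], the first crossing [x] gives [w < 2 x], and
    [s <= 1/2] keeps the angle [w s] below [x]. In the hyperbolic and polynomial cases both summands
    are positive. *)
Lemma stable_parameters A k : 0 < A ->
  (forall b, 0 < b -> sin b != 0 -> b = A * (cos b - 1) / sin b ->
    k < - A * b / sin b) ->
  exists c0 c1 c2 c3 c4, stumpff (2 * k - A ^+ 2) c0 c1 c2 c3 c4 /\
    forall s, 0 < s <= 2^-1 -> 0 < A * c1 s + c0 s.
Proof.
move=> A0 crit; have [K0|K0|K0] := ltrgt0P (2 * k - A ^+ 2).
- set w := Num.sqrt (2 * k - A ^+ 2).
  have w0 : 0 < w by rewrite sqrtr_gt0.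
  have <- : w ^+ 2 = 2 * k - A ^+ 2 by rewrite sqr_sqrtr// ltW.
  do 5 eexists; split; first exact: stumpff_trig w0.
  have [x /andP[x0 xpi] [Gx hx]] := first_crossing A0 crit.
  move=> s /andP[s0 s1] /=.
  have wx : w < 2 * x.
    rewrite -(ltr_pXn2r (n := 2)) ?nnegrE ?mulr_ge0 ?(ltW x0) ?(ltW w0)//.
    by rewrite sqr_sqrtr// ltW.
  set th := w * s.
  have th0 : 0 < th by rewrite mulr_gt0.
  have thx : th < x.
    have : th <= w * 2^-1 by rewrite ler_pM2l.
    by move: wx; lra.
  have sx0 : 0 < sin x by rewrite sin_gt0_pi// x0.
  have sth0 : 0 < sin th by rewrite sin_gt0_pi// th0 (lt_trans thx).
  have sxth0 : 0 < sin (x - th) by rewrite sin_gt0_pi//; lra.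
  have cx0 : cos x < 0.
    have : 2 * x * cos x < 0 by have := mulr_gt0 A0 sx0; move: Gx; lra.
    by rewrite pmulr_rlt0// mulr_gt0.
  have h1 : 0 < A * sin x + w * cos x.
    rewrite (_ : _ + _ = (2 * x - w) * (- cos x)); last by lra.
    by rewrite mulr_gt0 ?subr_gt0 ?oppr_gt0.
  (* Multiplying by [sin x > 0] lets the subtraction formula compare the angle [th] with the
     crossing [x]; both resulting terms are positive. *)
  have h2 : 0 < sin x * (A * sin th + w * cos th).
    have -> : sin x * (A * sin th + w * cos th) =
        w * sin (x - th) + sin th * (A * sin x + w * cos x) by rewrite sinB; ring.
    by apply: addr_gt0; exact: mulr_gt0.
  rewrite pmulr_rgt0// in h2.
  rewrite (_ : _ + _ = w^-1 * (A * sin th + w * cos th)).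
    by rewrite mulr_gt0 ?invr_gt0.
  by rewrite -/th; field; rewrite gt_eqF.
- set w := Num.sqrt (- (2 * k - A ^+ 2)).
  have w0 : 0 < w by rewrite sqrtr_gt0 oppr_gt0.
  have <- : - w ^+ 2 = 2 * k - A ^+ 2 by rewrite sqr_sqrtr ?opprK// oppr_ge0 ltW.
  have [c2 [c3 [c4 st]]] := stumpff_hyp w0.
  do 5 eexists; split; first exact: st.
  move=> s /andP[s0 _] /=; rewrite addr_gt0//.
    rewrite !mulr_gt0 ?invr_gt0 ?mulr_gt0// subr_gt0 ltr_expR mulNr.
    by have := mulr_gt0 w0 s0; lra.
  by rewrite mulr_gt0 ?invr_gt0// addr_gt0 ?expR_gt0.
- rewrite K0; have [c4 st] := stumpff_poly R.
  do 5 eexists; split; first exact: st.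
  by move=> s /andP[s0 _] /=; rewrite addr_gt0 ?mulr_gt0.
Qed.

End Characteristic.

(** * Limits of Euler polygons along an ultrafilter *)

Section EulerLimit.
Variables (R : realType) (n : nat).
Local Notation V := 'rV[R]_n.
Implicit Types (s t w e M : R) (g l : V) (y : R -> V).

(** Compactness along an ultrafilter yields limits at all times simultaneously, in place of
    extracting subsequences. *)
Lemma ultra_bounded_cvg (U : set_system nat) (u : nat -> V) M :
  UltraFilter U -> (forall N, `|u N| <= M) ->
  exists l, forall e, 0 < e -> U [set N | `|u N - l| < e].
Proof.
move=> UU uM; pose A := [set v : V | `|v| <= M].
have cA : compact A.
  apply: bounded_closed_compact.
    exists M; split; first exact: num_real.
    by move=> x Mx v /= /le_trans; apply; exact: ltW.
  exact: (preimage_closed (fun v _ => @norm_continuous _ _ v) (@closed_le R M)).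
have FA : U (u @^-1` A) by apply: (@filterE _ U) => N; exact: uM.
have [l [_ cl]] := cA (u @ U) _ FA.
exists l => e e0; pose B := [set v : V | `|v - l| < e].
have nB : nbhs l B.
  by apply/nbhs_ballP; exists e => // v; rewrite -ball_normE /ball_/= distrC.
have [//|h] := @in_ultra_setVsetC _ U (u @^-1` B) UU.
by have [v []] := cl (~` B) B h nB.
Qed.

Lemma derive_of_increments y t g :
  (forall e, 0 < e -> exists2 d, 0 < d & forall s, `|s| < d ->
    `|y (t + s) - y t - s *: g| <= e * `|s|) -> is_derive t 1 y g.
Proof.
move=> H.
suff cy : (fun s : R => s^-1 *: (y (s *: (1 : R) + t) - y t)) @ 0^' --> g.
  by apply: DeriveDef; [apply/cvg_ex; exists g|apply/cvg_lim].
apply/cvgrPdist_le => e e0; have [d d0 hd] := H e e0.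
near=> s; have s0 : s != 0 by near: s; exact: nbhs_dnbhs_neq.
have sd : `|s| < d by near: s; exact: dnbhs0_lt.
have := hd s sd; rewrite -(ler_pM2l (x := `|s|^-1)) ?invr_gt0 ?normr_gt0//.
rewrite mulrCA mulVf ?normr_eq0// mulr1; apply: le_trans.
rewrite -normfV -normrZ [in leRHS]scalerBr (scalerA s^-1 s) mulVf// scale1r distrC.
by rewrite [s *: 1]mulr1 (addrC s t).
Unshelve. all: by end_near. Qed.

Lemma euler_increment (u v : nat -> V) e (eta : R) g k m : 0 <= e ->
  (forall i, u i.+1 = u i + e *: v i) ->
  (forall i, (k <= i < k + m)%N -> `|v i - g| <= eta) ->
  `|u (k + m)%N - u k - (m%:R * e) *: g| <= m%:R * e * eta.
Proof.
move=> e0 uE; elim: m => [|m IH] hv.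
  by rewrite addn0 subrr mul0r scale0r subr0 normr0 !mul0r.
rewrite addnS uE (_ : _ - _ - _ =
    u (k + m)%N - u k - (m%:R * e) *: g + e *: (v (k + m)%N - g)); last first.
  rewrite -natr1 mulrDl mul1r scalerDl scalerBr opprD !addrA.
  by rewrite -!addrA; congr (_ + _); rewrite addrCA; congr (_ + _);
     rewrite addrCA.
apply: le_trans (ler_normD _ _) _; rewrite -natr1 !mulrDl mul1r lerD//.
  by apply: IH => i /andP[h1 h2]; apply: hv; rewrite h1 addnS ltnS ltnW.
rewrite normrZ ger0_norm// ler_wpM2l// hv// leq_addr/= addnS//.
Qed.

Definition step N : R := N.+1%:R^-1.

(** Number of the last step before time [t]; truncation sends all [t <= 0] to step 0, so the
    discrete solution is constant before time 0. *)
Definition idx N t : nat := Num.truncn (t * N.+1%:R).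

Lemma step_gt0 N : 0 < step N.
Proof. by rewrite invr_gt0. Qed.

Lemma idx_le0 N t : t <= 0 -> idx N t = 0%N.
Proof.
move=> t0; apply/truncn0Pn; rewrite -ltNge.
by apply: le_lt_trans ltr01; rewrite mulr_le0_ge0.
Qed.

Lemma idx_itv N t : 0 <= t ->
  (idx N t)%:R * step N <= t < (idx N t)%:R * step N + step N.
Proof.
move=> t0; have t1 : 0 <= t * N.+1%:R by rewrite mulr_ge0.
have /andP[h1 h2] := truncn_itv t1.
rewrite ler_pdivrMr// h1/= -{2}(mul1r (step N)) -mulrDl ltr_pdivlMr//.
by rewrite natr1.
Qed.

Lemma idx_mono N s t : s <= t -> (idx N s <= idx N t)%N.
Proof. by move=> st; apply: le_truncn; rewrite ler_pM2r. Qed.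

Lemma idx_sub_le N s t : s <= t ->
  (idx N t - idx N s)%:R * step N <= t - s + step N.
Proof.
move=> st; rewrite natrB ?idx_mono// mulrBl.
have [t0|t0] := leP t 0.
  by rewrite !idx_le0 ?(le_trans st)// subrr; have := step_gt0 N; lra.
have /andP[h1 _] := idx_itv N (ltW t0).
have [s0|s0] := leP s 0.
  by rewrite (idx_le0 _ s0) mul0r; have := step_gt0 N; lra.
by have /andP[_ h2] := idx_itv N (ltW s0); lra.
Qed.

Variables (U : set_system nat) (UU : UltraFilter U).
Hypothesis Ularge : forall N0, U [set N | (N0 <= N)%N].
Variables (u v : nat -> nat -> V) (M : R).
Hypothesis M0 : 0 < M.
Hypothesis uE : forall N i, u N i.+1 = u N i + step N *: v N i.
Hypothesis vM : forall N i, `|v N i| <= M.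

Lemma Ustep e : 0 < e -> U [set N | step N < e].
Proof.
move=> e0; apply: filterS (Ularge (Num.truncn e^-1)) => N /= hN.
rewrite /step invf_plt ?posrE//.
by apply: lt_le_trans (truncnS_gt _) _; rewrite ler_nat.
Qed.

Lemma euler_lip N s t : s <= t ->
  `|u N (idx N t) - u N (idx N s)| <= M * (t - s + step N).
Proof.
move=> st; have := @euler_increment (u N) (v N) (step N) M 0 (idx N s)
  (idx N t - idx N s) (ltW (step_gt0 N)) (uE N).
rewrite subnKC ?idx_mono// scaler0 subr0 => h.
apply: le_trans (h _) _ => [i _|]; first by rewrite subr0.
by rewrite mulrC ler_pM2l// idx_sub_le.
Qed.

Variable y : R -> V.
Hypothesis uy : forall t e, 0 < e -> U [set N | `|u N (idx N t) - y t| < e].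

Lemma limit_lip s t : s <= t -> `|y t - y s| <= M * (t - s).
Proof.
move=> st; apply/ler_addgt0Pr => e e0.
have e3 : 0 < e / 3 by rewrite divr_gt0.
have eM : 0 < e / 3 / M by rewrite divr_gt0.
have [N [[h1 h2] h3]] := filter_ex (filterI (filterI (uy t e3) (uy s e3)) (Ustep eM)).
have h4 := euler_lip N st; rewrite /= in h1 h2 h3.
have h5 : M * step N < e / 3 by rewrite mulrC -ltr_pdivlMr.
rewrite (_ : y t - y s = (u N (idx N t) - u N (idx N s))
  - (u N (idx N t) - y t) + (u N (idx N s) - y s)); last first.
  by apply/matrixP => a b; rewrite !mxE; ring.
have := ler_normD (u N (idx N t) - u N (idx N s) - (u N (idx N t) - y t))
  (u N (idx N s) - y s).
have := ler_normB (u N (idx N t) - u N (idx N s)) (u N (idx N t) - y t).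
by move: h1 h2 h4 h5; lra.
Qed.

Lemma limit_derive t g : 0 < t ->
  (forall e, 0 < e -> exists2 d, 0 < d &
    U [set N | forall i, `|i%:R * step N - t| < d -> `|v N i - g| <= e]) ->
  is_derive t 1 y g.
Proof.
move=> t0 H.
suff key e : 0 < e -> exists2 d, 0 < d & forall s w, s <= w ->
    t - d < s -> w < t + d -> `|y w - y s - (w - s) *: g| <= e * (w - s).
  apply: derive_of_increments => e e0; have [d d0 hd] := key e e0.
  exists d => // s; rewrite ltr_norml => /andP[s1 s2].
  have [s0|s0] := leP 0 s.
    have := hd t (t + s); rewrite (_ : t + s - t = s); last by rewrite addrAC subrr add0r.
    by rewrite ger0_norm//; apply; lra.
  have := hd (t + s) t; rewrite (_ : t - (t + s) = - s); last by ring.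
  rewrite ltr0_norm// -[X in _ -> _ -> _ -> X <= _]normrN.
  rewrite (_ : - (_ - _ - _) = y (t + s) - y t - s *: g); first by apply; lra.
  by apply/matrixP => a b; rewrite !mxE; ring.
move=> e0; have [d d0 hd] := H e e0.
pose d' := Order.min (d / 2) t.
have d'0 : 0 < d' by rewrite lt_min divr_gt0.
have d'1 : d' <= d / 2 by rewrite ge_min lexx.
have d'2 : d' <= t by rewrite ge_min lexx orbT.
exists d' => // s w sw s1 w1.
have s0 : 0 < s by move: s1 d'2; lra.
have w0 : 0 < w by exact: lt_le_trans sw.
apply/ler_addgt0Pr => f f0.
have f3 : 0 < f / 3 by rewrite divr_gt0.
have eg : 0 < e + `|g| by rewrite ltr_wpDr.
have fE : 0 < Order.min (d / 2) (f / 3 / (e + `|g|)).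
  by rewrite lt_min !divr_gt0.
have [N [[[h1 h2] h3] h4]] := filter_ex (filterI (filterI (filterI
  (uy w f3) (uy s f3)) (Ustep fE)) hd).
rewrite /= in h1 h2 h3 h4; move: h3; rewrite lt_min => /andP[h3 h3'].
have st0 := step_gt0 N.
have h5 : step N * (e + `|g|) < f / 3 by rewrite -ltr_pdivlMr.
have /andP[is1 is2] := idx_itv N (ltW s0).
have /andP[iw1 iw2] := idx_itv N (ltW w0).
set k := idx N s in h2 is1 is2 *; set m := idx N w in h1 iw1 iw2 *.
have km : (k <= m)%N by exact: idx_mono.
have hinc : `|u N m - u N k - ((m - k)%:R * step N) *: g| <= (m - k)%:R * step N * e.
  rewrite -{1}(subnKC km); apply: euler_increment (uE N) _ => [|i]; first exact: ltW.
  rewrite subnKC// => /andP[ki im]; apply: h4; rewrite ltr_norml.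
  have : k%:R * step N <= i%:R * step N by rewrite ler_pM2r// ler_nat.
  have : i%:R * step N <= m%:R * step N by rewrite ler_pM2r// ler_nat ltnW.
  by move: is1 is2 iw1 iw2 h3 s1 w1 d'1; lra.
set q := (m - k)%:R * step N in hinc.
have q1 : q <= w - s + step N by exact: idx_sub_le.
have q2 : w - s - step N <= q.
  by rewrite /q natrB// mulrBl; move: is1 iw2; lra.
rewrite (_ : y w - y s - (w - s) *: g = (u N m - u N k - q *: g)
  - (u N m - y w) + (u N k - y s) + (q - (w - s)) *: g); last first.
  by apply/matrixP => a b; rewrite !mxE; ring.
have hq : `|(q - (w - s)) *: g| <= step N * `|g|.
  by rewrite normrZ ler_wpM2r// ler_norml; move: q1 q2; lra.
have hqe : q * e <= (w - s + step N) * e by rewrite ler_pM2r.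
have := ler_normD (u N m - u N k - q *: g - (u N m - y w) + (u N k - y s))
  ((q - (w - s)) *: g).
have := ler_normD (u N m - u N k - q *: g - (u N m - y w)) (u N k - y s).
have := ler_normB (u N m - u N k - q *: g) (u N m - y w).
by move: hq hqe hinc h1 h2 h5; lra.
Qed.

End EulerLimit.

(** * Existence of solutions for a bounded continuous field *)

Section Peano.
Variables (R : realType) (n : nat).
Local Notation V := 'rV[R]_n.
Implicit Types (s t e d : R) (g : V).

Lemma is_derive_coord (y : R -> V) t g i : is_derive t 1 y g ->
  is_derive t 1 (fun s => y s 0 i) (g 0 i).
Proof.
move=> [dy yg]; have := dy => /derivable_mxP /(_ 0 i) dyi.
apply: DeriveDef => //; rewrite -yg derive_mx// mxE //.
Qed.

Lemma row_continuous_coord (y : R -> V) i : continuous y ->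
  continuous (fun s => y s 0 i).
Proof.
move=> cy s; have := @coord_continuous R 1 n 0 i (y s).
exact: (@continuous_comp _ _ _ y (fun M : V => M 0 i) s (cy s)).
Qed.

Variables (G : V -> V -> V) (M : R) (phi : R -> V) (B : R).
Hypothesis Gc : forall x z e, 0 < e -> exists2 d, 0 < d & forall x' z',
  `|x' - x| < d -> `|z' - z| < d -> `|G x' z' - G x z| <= e.
Hypotheses (M0 : 0 < M) (GM : forall x z, `|G x z| <= M).
Hypotheses (cphi : continuous phi) (phiB : forall t, `|phi t| <= B).

Let B0 : 0 <= B. Proof. exact: le_trans (phiB 0). Qed.
Let M1 := M + 2 * B.
Let M10 : 0 < M1. Proof. by rewrite ltr_wpDr// mulr_ge0. Qed.

Let zinit : V := \row_i Int (fun s => phi s 0 i) (- 1) 0.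

(* The first component of the state at step [k] lists the past values, the most
   recent one first. *)
Let estep N (s : (nat -> V) * V) : (nat -> V) * V :=
  (fun j => if j is j'.+1 then s.1 j' else s.1 0%N + step R N *: G (s.1 0%N) s.2,
   s.2 + step R N *: (s.1 0%N - s.1 N.+1)).

Let st N k := iter k (estep N) (fun j => phi (- (j%:R * step R N)), zinit).
Let X N k : V := (st N k).1 0%N.
Let Z N k : V := (st N k).2.
(** The value one unit of time ago, since [N.+1] steps have total length 1. *)
Let D N k : V := (st N k).1 N.+1.

Let XE N i : X N i.+1 = X N i + step R N *: G (X N i) (Z N i).
Proof. by []. Qed.

Let ZE N i : Z N i.+1 = Z N i + step R N *: (X N i - D N i).
Proof. by []. Qed.

Let hist N k j : (st N k).1 j =
  if (j <= k)%N then X N (k - j) else phi (- ((j - k)%:R * step R N)).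
Proof.
by elim: k j => [|k IH] [|j] //=.
Qed.

Let X0 N : X N 0 = phi 0.
Proof. by rewrite /X /= mul0r oppr0. Qed.

Let phim t := phi (Order.min t 0).

Let cphim : continuous phim.
Proof.
have cm := cont_minf (@cont_idf R) (@cont_cstf R 0).
move=> t; apply: (@continuous_comp R R V (fun t : R => Order.min t 0) phi t).
  exact: cm.
exact: cphi.
Qed.

Let stepK N : N.+1%:R * step R N = 1.
Proof. by rewrite /step mulfV. Qed.

Let idxK N k : idx N (k%:R * step R N) = k.
Proof. by rewrite /idx -mulrA (mulrC (step R N)) stepK mulr1 natrK. Qed.

(** Delayed times before and after 0 are merged: [idx] is 0 on the former and [phim] equals [phi 0]
    on the latter, so one of the two summands always cancels [phi 0]. *)
Let DE N k : D N k =
  X N (idx N (k%:R * step R N - 1)) + phim (k%:R * step R N - 1) - phi 0.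
Proof.
rewrite /D hist; case: (leqP N.+1 _) => Nk.
  have -> : k%:R * step R N - 1 = (k - N.+1)%:R * step R N.
    by rewrite (natrB _ Nk) [RHS]mulrBl stepK.
  rewrite idxK /phim min_r ?addrK//.
  by rewrite mulr_ge0// ltW// step_gt0.
have -> : k%:R * step R N - 1 = - ((N.+1 - k)%:R * step R N).
  by rewrite (natrB _ (ltnW Nk)) [in RHS]mulrBl stepK opprB.
have le0 : - ((N.+1 - k)%:R * step R N) <= 0.
  by rewrite oppr_le0 mulr_ge0// ltW// step_gt0.
by rewrite (idx_le0 _ le0) X0 /phim min_l// (addrC (phi 0)) addrK.
Qed.

Let XM N i : `|G (X N i) (Z N i)| <= M. Proof. exact: GM. Qed.

(** After time 1 this is an increment over unit time, at most [M]; before, the history enters,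
    whence the extra [2 B]. *)
Let ZM N i : `|X N i - D N i| <= M1.
Proof.
have st0 := ltW (step_gt0 R N).
have inc k m : `|X N (k + m)%N - X N k| <= m%:R * step R N * M.
  have := @euler_increment R n (X N) (fun i => G (X N i) (Z N i)) (step R N) M 0 k m
    st0 (XE N).
  by rewrite scaler0 subr0; apply => j _; rewrite subr0.
rewrite /D hist; case: (leqP N.+1 _) => Ni.
  have := inc (i - N.+1)%N N.+1; rewrite subnK// stepK mul1r => /le_trans; apply.
  by rewrite lerDl mulr_ge0.
have h1 : `|X N i - X N 0| <= M.
  apply: le_trans (inc 0%N i) _; rewrite -[leRHS]mul1r ler_wpM2r ?(ltW M0)//.
  rewrite -[leRHS](stepK N); apply: ler_wpM2r st0 _ _ _.
  by rewrite ler_nat ltnW.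
have := ler_normB (X N i) (phi (- ((N.+1 - i)%:R * step R N))).
have := ler_normD (X N i - X N 0) (X N 0); rewrite subrK X0.
have := phiB (- ((N.+1 - i)%:R * step R N)); have := phiB 0.
by move: h1; rewrite X0 /M1; lra.
Qed.

Lemma idx_bound (u v : nat -> nat -> V) (K C : R) : 0 < K ->
  (forall N i, u N i.+1 = u N i + step R N *: v N i) ->
  (forall N i, `|v N i| <= K) -> (forall N, `|u N 0%N| <= C) ->
  forall t N, `|u N (idx N t)| <= C + K * (`|t| + 1).
Proof.
move=> K0 uE vK uC t N.
have s1 : step R N <= 1 by rewrite /step invf_le1// ler1n.
have [t0|t0] := leP t 0.
  by rewrite idx_le0//; apply: le_trans (uC N) _; rewrite lerDl mulr_ge0 ?(ltW K0)// addr_ge0.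
have := euler_lip K0 uE vK N (ltW t0); rewrite (@idx_le0 _ N 0)//= subr0.
have : K * (t + step R N) <= K * (`|t| + 1).
  by rewrite ler_pM2l// (gtr0_norm t0) lerD2l.
have := ler_normD (u N (idx N t) - u N 0%N) (u N 0%N); rewrite subrK.
by have := uC N; lra.
Qed.

(** The window integral is carried as a second unknown [z] with [z' = x(t) - x(t-1)], so each Euler
    step needs two point values of [x] and no quadrature; [z] is identified with the integral only
    in the limit. *)
Lemma peano_delay : exists x : R -> V,
  [/\ continuous x, forall t, t <= 0 -> x t = phi t &
   forall t, 0 < t ->
     is_derive t 1 x (G (x t) (\row_i Int (fun s => x s 0 i) (t - 1) t))].
Proof.
have [U [UU Usub]] := ultraFilterLemma (@eventually_filter).
have Ularge N0 : U [set N | (N0 <= N)%N] by apply: Usub; exists N0.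
have lims (u v : nat -> nat -> V) (K C : R) : 0 < K ->
    (forall N i, u N i.+1 = u N i + step R N *: v N i) ->
    (forall N i, `|v N i| <= K) -> (forall N, `|u N 0%N| <= C) ->
    exists y : R -> V, forall t e, 0 < e -> U [set N | `|u N (idx N t) - y t| < e].
  move=> K0 uE vK uC.
  have lim1 t : exists l, forall e, 0 < e -> U [set N | `|u N (idx N t) - l| < e].
    apply: (@ultra_bounded_cvg _ _ U (fun N => u N (idx N t)) (C + K * (`|t| + 1))).
    exact: idx_bound K0 uE vK uC t.
  by have [y hy] := choice lim1; exists y.
have [xh xhP] := lims X _ M B M0 XE XM (fun N => eq_ind_r (fun w => `|w| <= B) (phiB 0) (X0 N)).
have [zh zhP] := lims Z _ M1 `|zinit| M10 ZE ZM (fun=> lexx _).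
have small (a b : V) : (forall e, 0 < e -> U [set N : nat | `|a - b| < e]) -> a = b.
  move=> h; apply/eqP; rewrite -subr_eq0 -normr_le0; apply/ler_addgt0Pr => e e0.
  by have [N /= /ltW] := filter_ex (h e e0); rewrite add0r.
have xh0 t : t <= 0 -> xh t = phi 0.
  move=> t0; apply/esym/small => e e0; have := xhP t e e0.
  by apply: filterS => N /=; rewrite idx_le0// X0.
have zh0 t : t <= 0 -> zh t = zinit.
  move=> t0; apply/esym/small => e e0; have := zhP t e e0.
  by apply: filterS => N /=; rewrite idx_le0.
have xlip := limit_lip UU Ularge M0 XE XM xhP.
have zlip := limit_lip UU Ularge M10 ZE ZM zhP.
have lip_cont (y : R -> V) (K : R) : 0 < K ->
    (forall s t, s <= t -> `|y t - y s| <= K * (t - s)) -> continuous y.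
  move=> K0 yl t; apply/cvgrPdist_lt => e e0.
  apply/nbhs_ballP; exists (e / K) => [|s]; rewrite /= ?divr_gt0//.
  rewrite /ball/= => ts; have [st'|st'] := leP s t.
    apply: le_lt_trans (yl _ _ st') _; rewrite mulrC -ltr_pdivlMr//.
    by apply: le_lt_trans ts; exact: ler_norm.
  rewrite distrC; apply: le_lt_trans (yl _ _ (ltW st')) _; rewrite mulrC -ltr_pdivlMr//.
  by apply: le_lt_trans ts; rewrite distrC; exact: ler_norm.
have cxh := lip_cont _ _ M0 xlip; have czh := lip_cont _ _ M10 zlip.
have near_lim (u v : nat -> nat -> V) (K : R) (y : R -> V) : 0 < K ->
    (forall N i, u N i.+1 = u N i + step R N *: v N i) ->
    (forall N i, `|v N i| <= K) ->
    (forall t e, 0 < e -> U [set N | `|u N (idx N t) - y t| < e]) ->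
    forall t e, 0 < e -> exists2 d, 0 < d &
      U [set N | forall s, `|s - t| < d -> `|u N (idx N s) - y t| < e].
  move=> K0 uE vK uy t e e0.
  have e3 : 0 < e / 3 by rewrite divr_gt0.
  have eK : 0 < e / 3 / K by rewrite divr_gt0.
  exists (e / 3 / K) => //.
  apply: filterS (filterI (uy t _ e3) (Ustep UU Ularge eK)) => N /= [h1 h2] s hs.
  have h3 : K * step R N < e / 3 by rewrite mulrC -ltr_pdivlMr.
  have h4 : K * `|s - t| < e / 3 by rewrite mulrC -ltr_pdivlMr.
  have h5 : `|u N (idx N s) - u N (idx N t)| <= K * (`|s - t| + step R N).
    have [st'|st'] := leP s t.
      rewrite distrC; apply: le_trans (euler_lip K0 uE vK N st') _.
      by rewrite ler_pM2l// lerD2r distrC ler_norm.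
    apply: le_trans (euler_lip K0 uE vK N (ltW st')) _.
    by rewrite ler_pM2l// lerD2r ler_norm.
  have := ler_normD (u N (idx N s) - u N (idx N t)) (u N (idx N t) - y t).
  by rewrite addrA subrK; move: h5; rewrite mulrDr; lra.
(* Glues history and limit as in [DE]; continuity at 0 comes for free. *)
pose x t := xh t + phim t - phi 0.
have cx : continuous x.
  by move=> t; apply: cvgB; [apply: cvgD; [exact: cxh|exact: cphim]|exact: cvg_cst].
have xpos t : 0 <= t -> x t = xh t by move=> t0; rewrite /x /phim min_r// addrK.
have xneg t : t <= 0 -> x t = phi t.
  by move=> t0; rewrite /x /phim min_l// xh0// (addrC (phi 0)) addrK.
have dxh t : 0 < t -> is_derive t 1 xh (G (xh t) (zh t)).
  move=> t0; apply: (limit_derive UU Ularge XE xhP t0) => e e0.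
  have [d d0 hd] := Gc (xh t) (zh t) e0.
  have [d1 d10 h1] := near_lim _ _ _ _ M0 XE XM xhP t d d0.
  have [d2 d20 h2] := near_lim _ _ _ _ M10 ZE ZM zhP t d d0.
  exists (Order.min d1 d2); first by rewrite lt_min d10.
  apply: filterS (filterI h1 h2) => N /= [k1 k2] i.
  rewrite lt_min => /andP[/k1 {}k1 /k2 {}k2].
  by apply: hd; [move: k1|move: k2]; rewrite idxK.
have dzh t : 0 < t -> is_derive t 1 zh (x t - x (t - 1)).
  move=> t0; apply: (limit_derive UU Ularge ZE zhP t0) => e e0.
  have e3 : 0 < e / 3 by rewrite divr_gt0.
  have [d1 d10 h1] := near_lim _ _ _ _ M0 XE XM xhP t _ e3.
  have [d2 d20 h2] := near_lim _ _ _ _ M0 XE XM xhP (t - 1) _ e3.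
  have /cvgrPdist_lt /(_ _ e3) /nbhs_ballP[d3 /= d30 h3] := @cphim (t - 1).
  exists (Order.min d1 (Order.min d2 d3)); first by rewrite !lt_min d10 d20.
  apply: filterS (filterI h1 h2) => N /= [k1 k2] i.
  rewrite !lt_min => /and3P[/k1 {}k1 hi2 hi3].
  have sh : i%:R * step R N - 1 - (t - 1) = i%:R * step R N - t by ring.
  have {}k2 := k2 (i%:R * step R N - 1); rewrite sh in k2.
  have {}k3 : `|phim (t - 1) - phim (i%:R * step R N - 1)| < e / 3.
    by apply: h3; rewrite /ball/= distrC sh.
  rewrite idxK in k1; have {}k2 := k2 hi2.
  rewrite DE (xpos t (ltW t0)) /x.
  set a := X N i in k1 *; set b := X N _ in k2 *; set c := phim (_ * _ - 1) in k3 *.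
  rewrite (_ : _ - _ = (a - xh t) - (b - xh (t - 1)) + (phim (t - 1) - c)); last first.
    by apply/matrixP => p q; rewrite !mxE; ring.
  have := ler_normD (a - xh t - (b - xh (t - 1))) (phim (t - 1) - c).
  by have := ler_normB (a - xh t) (b - xh (t - 1)); lra.
(* Both sides have derivative [x(t) - x(t-1)] and agree at 0; monotonicity of [E] and of [- E] gives
   equality. *)
have zE t : 0 < t -> zh t = \row_i Int (fun s => x s 0 i) (t - 1) t.
  move=> t0; apply/rowP => i; rewrite mxE.
  have cxi := @row_continuous_coord x i cx.
  pose E s := zh s 0 i - Int (fun s => x s 0 i) (s - 1) s.
  have dE s : 0 < s < t -> is_derive s 1 E 0.
    move=> /andP[s0 _].
    have hE := derive_subf (is_derive_coord i (dzh s s0)) (derive_Int_window s cxi).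
    by apply: (is_derive_eq hE); rewrite !mxE; ring.
  have cE : continuous E.
    apply: cont_subf; first exact: row_continuous_coord.
    by move=> s; exact: derive_cont (derive_Int_window s cxi).
  have E0 : E 0 = 0.
    rewrite /E zh0// mxE sub0r; apply/eqP; rewrite subr_eq0; apply/eqP.
    apply: eq_Int; [lra|exact: row_continuous_coord|by []|].
    by move=> s /andP[_ s0]; rewrite xneg// ltW.
  have h1 : E t <= E 0 := derive_le (ltW t0) (cont_within cE) dE (fun _ _ => lexx 0).
  have dE' s : 0 < s < t -> is_derive s 1 (fun s => - 1 * E s) (- 1 * 0).
    by move=> hs; exact: derive_cmulf (dE s hs).
  have h2 : - 1 * E t <= - 1 * E 0.
    apply: (derive_le (ltW t0) _ dE'); first exact/cont_within/cont_cmulf.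
    by move=> s _; rewrite mulr0.
  by move: h1 h2; rewrite E0 /E; lra.
exists x; split=> // t t0; rewrite -zE// (xpos _ (ltW t0)).
apply: near_eq_is_derive (dxh t t0).
by near=> s; rewrite xpos// ltW//; near: s; exact: lt_nbhsr.
Unshelve. all: by end_near. Qed.

End Peano.

(** * Differential inequality for the functional, scalar and vector case *)

Section NonlinearDecay.
Variable R : realType.

Lemma scalar_lyapunov (A k : R) (c0 c1 c2 c3 c4 : R -> R) : 0 < A -> 0 < k ->
  stumpff (2 * k - A ^+ 2) c0 c1 c2 c3 c4 ->
  (forall s, 0 < s <= 2^-1 -> 0 < A * c1 s + c0 s) ->
  exists (W : (R -> R) -> R -> R) (c K : R),
  [/\ 0 < c, 0 < K & forall x : R -> R, continuous x ->
  [/\ continuous (W x),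
      forall t, c * state_norm x t <= W x t <= K * state_norm x t &
      forall t v : R, is_derive t 1 x v -> exists2 w, is_derive t 1 (W x) w &
        w <= - c * W x t + K * (v + A * x t + k * Int x (t - 1) t) ^+ 2]].
Proof.
move=> A0 k0 st pos; have k0' : k != 0 by rewrite gt_eqF.
have [p [Q [q [dq [lk [c c_gt0 hc]]]]]] := lyapunov_functional A0 k0 st pos.
have cq := separable_cont (lk_sq lk); have sY := separableZ k (lk_sQ lk).
have sYr := separableZ k (lk_sQr lk); have cY := separable_cont sY.
have [B1 B10 qB] := cont_bounded (- 1) 0 cq.
have [B2 B20 YB] := cont_bounded (- 1) 0 cY.
pose B := B1 + B2 + `|p|.
have B0 : 0 < B by rewrite ltr_wpDr// addr_gt0.
have qB' s : - 1 <= s <= 0 -> `|q s| <= B.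
  by move=> /qB; have := normr_ge0 p; rewrite /B; move: B20; clear; lra.
have YB' s : - 1 <= s <= 0 -> `|k * Q s| <= B.
  by move=> /YB; have := normr_ge0 p; rewrite /B; move: B10; clear; lra.
have pB : `|p| <= B by rewrite /B; move: B10 B20; clear; lra.
pose K0 := 5 * B + 2; have K00 : 0 < K0 by rewrite /K0; move: B0; clear; lra.
pose m := Order.min (2 * A / k) 1.
have m0 : 0 < m by rewrite lt_min ltr01 divr_gt0// mulr_gt0.
pose G := 4 * B ^+ 2; have G0 : 0 < G by rewrite mulr_gt0// exprn_gt0.
(* Young's inequality spends half of the dissipation [m N] on the defect; the other half, measured
   against the upper bound [K0 N] of the functional, gives the rate [m / (2 K0)]. *)
pose lam := m / (2 * G); have lam0 : 0 < lam by rewrite divr_gt0// mulr_gt0.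
pose c' := Order.min c (m / (2 * K0)).
have c'0 : 0 < c' by rewrite lt_min c_gt0 divr_gt0// mulr_gt0.
pose K := K0 + lam^-1; have K_gt0 : 0 < K by rewrite addr_gt0// invr_gt0.
exists (lyapW p q (fun s => k * Q s)), c', K; split=> // x cx.
have N0 t : 0 <= state_norm x t by exact: state_norm_ge0.
have low t : c' * state_norm x t <= lyapW p q (fun s => k * Q s) x t.
  by apply: le_trans (hc x t cx); rewrite ler_wpM2r// ge_min lexx.
have up t : lyapW p q (fun s => k * Q s) x t <= K0 * state_norm x t.
  have hV := lyapV_bound t B0 cx cq cY sYr pB qB' YB'.
  have /andP[_ hM] := lyapM_bound t cx.
  have h1 : sqwindow x t <= state_norm x t by rewrite lerDr sqr_ge0.
  have := ler_norm (lyapV p q (fun s => k * Q s) x t).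
  by rewrite /lyapW /K0; move: hV hM h1; clear; lra.
split=> [|t|t v xv].
- exact: cont_lyapW lk cx.
- rewrite low/=; apply: le_trans (up t) _; rewrite ler_wpM2r//.
  by rewrite lerDl invr_ge0 ltW.
- eexists; first exact: derive_lyapW k0' lk cx xv.
  set rho := v + _ + _; set N := state_norm x t; set S := sqwindow x t.
  have S0 : 0 <= S by exact: sqwindow_ge0.
  have y2 := sqr_ge0 (x t); have y12 := sqr_ge0 (x (t - 1)).
  have h1 : m * N <= 2 * A / k * x t ^+ 2 + S.
    rewrite /N /state_norm mulrDr lerD//.
      by rewrite ler_wpM2r// ge_min lexx.
    by rewrite ler_piMl// ge_min lexx orbT.
  have hw : (p * x t + window q x t) ^+ 2 <= G * N.
    have hL := window_bound t cq cx qB'.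
    have h2 : p ^+ 2 * x t ^+ 2 <= B ^+ 2 * x t ^+ 2.
      rewrite ler_wpM2r// -(real_normK (num_real p)) lerXn2r ?nnegrE//.
      exact: ltW.
    have h3 : 0 <= (p * x t - window q x t) ^+ 2 by exact: sqr_ge0.
    have B2' : 0 <= B ^+ 2 by exact: sqr_ge0.
    have h4 := mulr_ge0 B2' y2; have h5 := mulr_ge0 B2' S0.
    by rewrite /G /N /state_norm -/S; move: hL h2 h3 h4 h5; rewrite -/S; clear; lra.
  have h2 := mul_le_half (p * x t + window q x t) rho lam0.
  have h3 : lam * (p * x t + window q x t) ^+ 2 <= m / 2 * N.
    have -> : m / 2 * N = lam * (G * N) by rewrite /lam; field; rewrite gt_eqF.
    by rewrite ler_pM2l.
  have h4 : c' * lyapW p q (fun s => k * Q s) x t <= m / 2 * N.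
    apply: le_trans (ler_wpM2l (ltW c'0) (up t)) _; rewrite mulrA ler_wpM2r//.
    apply: (@le_trans _ _ (m / (2 * K0) * K0)).
      by rewrite ler_pM2r// ge_min lexx orbT.
    by rewrite invfM mulrA divfK// gt_eqF.
  have h5 : 0 <= K0 * rho ^+ 2 by rewrite mulr_ge0 ?sqr_ge0// ltW.
  rewrite /K mulrDl (mulrC rho).
  by move: h1 h2 h3 h4 h5 y12; rewrite -/S; clear; lra.
Qed.

Variable n : nat.
Local Notation V := 'rV[R]_n.
Implicit Types (x : R -> V) (v u : V) (t : R).

Lemma row_norm_le v (c : R) : 0 <= c -> (forall i, `|v 0 i| <= c) -> `|v| <= c.
Proof.
move=> c0 h; rewrite /Num.Def.normr/= mx_normrE (bigmax_le _ c0)// => -[a i] _.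
by rewrite ord1.
Qed.

Lemma row_coord_le v i : `|v 0 i| <= `|v|.
Proof.
rewrite [leRHS]/Num.Def.normr/= mx_normrE.
exact: (le_bigmax _ (fun k : 'I_1 * 'I_n => `|v k.1 k.2|) (0, i)).
Qed.

Lemma mulmx_row_bound (M : 'M[R]_n) : exists2 B : R, 0 < B &
  forall v, `|v *m M| <= B * `|v|.
Proof.
pose B := 1 + \sum_i \sum_j `|M j i|.
have s0 i : 0 <= \sum_j `|M j i| by apply: sumr_ge0.
have B0 : 0 < B by rewrite ltr_wpDr// sumr_ge0.
exists B => // v; apply: row_norm_le => [|i]; first by rewrite mulr_ge0// ltW.
rewrite mxE; apply: le_trans (ler_norm_sum _ _ _) _.
apply: (@le_trans _ _ (\sum_j `|M j i| * `|v|)).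
  by apply: ler_sum => j _; rewrite normrM mulrC ler_wpM2l// row_coord_le.
rewrite -mulr_suml ler_wpM2r//.
have h : \sum_j `|M j i| <= \sum_i \sum_j `|M j i|.
  by rewrite [leRHS](bigD1 i)//= lerDl sumr_ge0.
by apply: le_trans h _; rewrite lerDr.
Qed.

Definition delay_mean x t : V := \row_i Int (fun s => x s 0 i) (t - 1) t.

Lemma row_linear_comb x (M : 'M[R]_n) i t :
  (x t *m M) 0 i = \sum_j M j i * x t 0 j.
Proof. by rewrite mxE; apply: eq_bigr => j _; rewrite mulrC. Qed.

Lemma continuous_coord_mulmx x (M : 'M[R]_n) i : continuous x ->
  continuous (fun s => (x s *m M) 0 i).
Proof.
move=> cx; rewrite (_ : (fun s => _) = fun s => \sum_j M j i * x s 0 j).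
  by apply: cont_sumf => j; apply: cont_cmulf; exact: row_continuous_coord.
by apply/funext => s; rewrite row_linear_comb.
Qed.

Lemma Int_coord_mulmx x (M : 'M[R]_n) i t : continuous x ->
  Int (fun s => (x s *m M) 0 i) (t - 1) t = (delay_mean x t *m M) 0 i.
Proof.
move=> cx; rewrite (_ : (fun s => _) = fun s => \sum_j M j i * x s 0 j); last first.
  by apply/funext => s; rewrite row_linear_comb.
have cj j := @row_continuous_coord R n x j cx.
rewrite Int_sum => [|j]; last exact: cont_cmulf.
rewrite row_linear_comb; apply: eq_bigr => j _.
by rewrite IntZ// mxE.
Qed.

Lemma derive_coord_mulmx x (M : 'M[R]_n) i t v : is_derive t 1 x v ->
  is_derive t 1 (fun s => (x s *m M) 0 i) ((v *m M) 0 i).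
Proof.
move=> xv; rewrite (_ : (fun s => _) = fun s => \sum_j M j i * x s 0 j); last first.
  by apply/funext => s; rewrite row_linear_comb.
have dj j := derive_cmulf (M j i) (@is_derive_coord R n x t v j xv).
apply: (is_derive_eq (derive_sumf _ dj)).
by rewrite mxE; apply: eq_bigr => j _; rewrite mulrC.
Qed.

Lemma sqr_le_sqr (a b : R) : `|a| <= b -> a ^+ 2 <= b ^+ 2.
Proof.
move=> ab; rewrite -(real_normK (num_real a)) !expr2.
exact: ler_pM.
Qed.

Lemma sqr_norm_mulmx_le (M : 'M[R]_n) (B : R) u : 0 < B ->
  (forall v, `|v *m M| <= B * `|v|) ->
  `|u *m M| ^+ 2 <= B ^+ 2 * \sum_i u 0 i ^+ 2.
Proof.
move=> B0 hB; set S := \sum_i _.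
have S0 : 0 <= S by apply: sumr_ge0 => i _; exact: sqr_ge0.
have uS : `|u| <= Num.sqrt S.
  apply: row_norm_le => [|i]; first exact: sqrtr_ge0.
  rewrite -sqrtr_sqr ler_sqrt// /S (bigD1 i)//= lerDl.
  by apply: sumr_ge0 => j _; exact: sqr_ge0.
rewrite -[S in leRHS]sqr_sqrtr// -exprMn; apply: sqr_le_sqr; rewrite normr_id.
by apply: le_trans (hB u) _; rewrite ler_pM2l.
Qed.

(** Sum of the scalar functionals of the coordinates of [x P]. On row vectors [C P = P D] turns the
    linear part into independent scalar equations, and the defect of coordinate [i] is the [i]-th
    coordinate of the vector defect times [P]. *)
Lemma vector_lyapunov (a k : R) (C P : 'M[R]_n) (d : 'rV[R]_n) : 0 < k ->
  P \in unitmx -> C *m P = P *m diag_mx d -> (forall i, 0 < a + d 0 i) ->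
  (forall i, exists c0 c1 c2 c3 c4,
    stumpff (2 * k - (a + d 0 i) ^+ 2) c0 c1 c2 c3 c4 /\
    forall s, 0 < s <= 2^-1 -> 0 < (a + d 0 i) * c1 s + c0 s) ->
  exists (W : (R -> V) -> R -> R) (c K : R),
  [/\ 0 < c, 0 < K & forall x : R -> V, continuous x ->
  [/\ continuous (W x),
      forall t, c * (`|x t| ^+ 2 + `|delay_mean x t| ^+ 2) <= W x t,
      forall t (r : R), (forall s, t - 1 <= s <= t -> `|x s| <= r) ->
        W x t <= K * r ^+ 2 &
      forall t v, is_derive t 1 x v -> exists2 w, is_derive t 1 (W x) w &
        w <= - c * W x t
          + K * `|v + a *: x t + k *: delay_mean x t + x t *m C| ^+ 2]].
Proof.
move=> k0 Pu CP A0 hst.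
have hsc i : exists f : ((R -> R) -> R -> R) * R * R,
    [/\ 0 < f.1.2, 0 < f.2 & forall y : R -> R, continuous y ->
    [/\ continuous (f.1.1 y),
      forall t, f.1.2 * state_norm y t <= f.1.1 y t <= f.2 * state_norm y t &
      forall t v : R, is_derive t 1 y v -> exists2 w, is_derive t 1 (f.1.1 y) w &
        w <= - f.1.2 * f.1.1 y t
          + f.2 * (v + (a + d 0 i) * y t + k * Int y (t - 1) t) ^+ 2]].
  have [c0 [c1 [c2 [c3 [c4 [st pos]]]]]] := hst i.
  have [W [c [K h]]] := scalar_lyapunov (A0 i) k0 st pos.
  by exists (W, c, K).
have [F hF] := choice hsc.
pose Wi i := (F i).1.1; pose ci i := (F i).1.2; pose Ki i := (F i).2.
have ci0 i : 0 < ci i by have [] := hF i.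
have Ki0 i : 0 < Ki i by have [] := hF i.
(* Stand-ins for the least [ci] and the greatest [Ki] that need no nonempty index set. *)
pose cm := (1 + \sum_i (ci i)^-1)^-1; pose Km := 1 + \sum_i Ki i.
have sc0 : 0 <= \sum_i (ci i)^-1 by apply: sumr_ge0 => i _; rewrite invr_ge0 ltW.
have cm0 : 0 < cm by rewrite invr_gt0 ltr_wpDr.
have Km0 : 0 < Km by rewrite ltr_wpDr// sumr_ge0// => i _; exact: ltW.
have cmi i : cm <= ci i.
  rewrite -[ci i]invrK lef_pV2 ?posrE ?invr_gt0 ?ltr_wpDr//.
  rewrite (bigD1 i)//= addrCA lerDl addr_ge0// sumr_ge0// => j _.
  by rewrite invr_ge0 ltW.
have Kmi i : Ki i <= Km.
  rewrite /Km (bigD1 i)//= addrCA lerDl addr_ge0// sumr_ge0// => j _.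
  exact: ltW.
have [Bp Bp0 hBp] := mulmx_row_bound P.
have [Bq Bq0 hBq] := mulmx_row_bound (invmx P).
have Bq2 : 0 < Bq ^+ 2 by rewrite exprn_gt0.
have PK (w : V) : w = w *m P *m invmx P by rewrite mulmxK.
have nrm (w : V) : `|w| ^+ 2 <= Bq ^+ 2 * \sum_i (w *m P) 0 i ^+ 2.
  by rewrite {1}(PK w); exact: sqr_norm_mulmx_le.
pose c := Order.min cm (cm / (2 * Bq ^+ 2)).
have c_gt0 : 0 < c by rewrite lt_min cm0 divr_gt0// mulr_gt0.
pose N1 : R := 1 + n%:R; have N10 : 0 < N1 by rewrite ltr_wpDr.
pose K := N1 * (2 * Km * Bp ^+ 2).
have K0 : 0 < K by rewrite !mulr_gt0 ?exprn_gt0.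
pose W x t := \sum_i Wi i (fun s => (x s *m P) 0 i) t.
have sumc (f : 'I_n -> R) (r : R) : 0 <= r -> (forall i, f i <= r) -> \sum_i f i <= N1 * r.
  move=> r0 fr; apply: (@le_trans _ _ (\sum_(i < n) r)); first exact: ler_sum.
  by rewrite sumr_const card_ord -mulr_natl ler_wpM2r// lerDr.
exists W, c, K; split=> // x cx.
have cy i := @continuous_coord_mulmx x P i cx.
have N0 i t : 0 <= state_norm (fun s => (x s *m P) 0 i) t by exact: state_norm_ge0.
have hi i : [/\ continuous (Wi i (fun s => (x s *m P) 0 i)),
   forall t, ci i * state_norm (fun s => (x s *m P) 0 i) t
      <= Wi i (fun s => (x s *m P) 0 i) t
      <= Ki i * state_norm (fun s => (x s *m P) 0 i) t &
   forall t (v : R), is_derive t 1 (fun s => (x s *m P) 0 i) v ->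
     exists2 w, is_derive t 1 (Wi i (fun s => (x s *m P) 0 i)) w &
        w <= - ci i * Wi i (fun s => (x s *m P) 0 i) t
          + Ki i * (v + (a + d 0 i) * (x t *m P) 0 i
              + k * Int (fun s => (x s *m P) 0 i) (t - 1) t) ^+ 2].
  by have [_ _] := hF i; exact.
have Wi0 i t : 0 <= Wi i (fun s => (x s *m P) 0 i) t.
  have [_ /(_ t)/andP[h _] _] := hi i.
  by apply: le_trans h; rewrite mulr_ge0// ltW.
split.
- by apply: cont_sumf => i; have [] := hi i.
- move=> t.
  have key (w : V) : (forall i, (w *m P) 0 i ^+ 2
      <= state_norm (fun s => (x s *m P) 0 i) t) ->
      cm * `|w| ^+ 2 <= Bq ^+ 2 * W x t.
    move=> hw; apply: le_trans (ler_wpM2l (ltW cm0) (nrm w)) _.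
    rewrite mulrCA ler_pM2l// mulr_sumr; apply: ler_sum => i _.
    have [_ /(_ t)/andP[h _] _] := hi i; apply: le_trans h.
    apply: ler_pM => //; [exact: ltW|exact: sqr_ge0].
  have h1 : cm * `|x t| ^+ 2 <= Bq ^+ 2 * W x t.
    by apply: key => i; rewrite lerDl sqwindow_ge0.
  have h2 : cm * `|delay_mean x t| ^+ 2 <= Bq ^+ 2 * W x t.
    apply: key => i; rewrite -Int_coord_mulmx//.
    apply: le_trans (sqr_Int_window_le t (cy i)) _.
    by rewrite lerDr sqr_ge0.
  apply: (@le_trans _ _ (cm / (2 * Bq ^+ 2) * (`|x t| ^+ 2 + `|delay_mean x t| ^+ 2))).
    by rewrite ler_wpM2r ?addr_ge0 ?sqr_ge0// ge_min lexx orbT.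
  rewrite mulrAC ler_pdivrMr ?mulr_gt0//; move: h1 h2; clear; lra.
- move=> t r hr.
  have r0 : 0 <= r.
    by have := hr t; rewrite lexx andbT gerBl ler01 => /(_ isT); exact: le_trans.
  have hK : K * r ^+ 2 = N1 * (2 * Km * Bp ^+ 2 * r ^+ 2) by rewrite /K -mulrA.
  rewrite hK; apply: sumc => [|i].
    by rewrite !mulr_ge0 ?sqr_ge0// ltW.
  have [_ /(_ t)/andP[_ h] _] := hi i; apply: le_trans h _.
  have hy s : t - 1 <= s <= t -> (x s *m P) 0 i ^+ 2 <= Bp ^+ 2 * r ^+ 2.
    move=> hs; rewrite -exprMn; apply: sqr_le_sqr.
    apply: le_trans (row_coord_le _ _) _; apply: le_trans (hBp _) _.
    by rewrite ler_pM2l// hr.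
  have hS : sqwindow (fun s => (x s *m P) 0 i) t <= Bp ^+ 2 * r ^+ 2.
    rewrite -[leRHS]mulr1 -[in leRHS](_ : t - (t - 1) = 1); last by ring.
    rewrite -Int_cst; apply: le_Int => [||| s /andP[s1 s2]]; first by rewrite gerBl.
    - exact: cont_sqrf.
    - exact: cst_continuous.
    - by apply: hy; rewrite !ltW.
  have hN : state_norm (fun s => (x s *m P) 0 i) t <= 2 * (Bp ^+ 2 * r ^+ 2).
    have := hy t; rewrite lexx andbT gerBl ler01 => /(_ isT).
    by move: hS; rewrite /state_norm; clear; lra.
  apply: (@le_trans _ _ (Km * (2 * (Bp ^+ 2 * r ^+ 2)))); last first.
    by rewrite le_eqVlt; apply/orP; left; apply/eqP; ring.
  by apply: ler_pM => //; exact: ltW.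
- move=> t v xv; set rho := v + _ + _ + _.
  have hd i : {w | is_derive t 1 (Wi i (fun s => (x s *m P) 0 i)) w &
      w <= - ci i * Wi i (fun s => (x s *m P) 0 i) t + Ki i * (rho *m P) 0 i ^+ 2}.
    apply: cid2; have [_ _ h] := hi i; have [w h1 h2] := h t _ (@derive_coord_mulmx x P i t v xv).
    exists w => //; move: h2; congr (_ <= _ + _ * _ ^+ 2).
    rewrite Int_coord_mulmx// /rho !mulmxDl -!scalemxAl -mulmxA CP mulmxA mul_mx_diag !mxE.
    by ring.
  exists (\sum_i sval (hd i)).
    by apply: derive_sumf => i; case: (hd i).
  have hw i : sval (hd i) <= - c * Wi i (fun s => (x s *m P) 0 i) t
      + Km * (Bp ^+ 2 * `|rho| ^+ 2).
    case: (hd i) => w /= _ h; apply: le_trans h _; apply: lerD.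
      rewrite !mulNr lerN2 ler_wpM2r//; apply: le_trans (cmi i).
      by rewrite ge_min lexx.
    apply: ler_pM => //; [exact: ltW|exact: sqr_ge0|].
    rewrite -exprMn; apply: sqr_le_sqr.
    by apply: le_trans (row_coord_le _ _) _; exact: hBp.
  apply: le_trans (ler_sum _ (fun i _ => hw i)) _.
  rewrite big_split/= -mulr_sumr lerD2l.
  apply: (@le_trans _ _ (N1 * (Km * (Bp ^+ 2 * `|rho| ^+ 2)))).
    by apply: sumc => //; rewrite !mulr_ge0 ?sqr_ge0// ltW.
  have : 0 <= N1 * (Km * (Bp ^+ 2 * `|rho| ^+ 2)).
    by rewrite !mulr_ge0 ?sqr_ge0// ltW.
  by rewrite /K; clear; lra.
Qed.

End NonlinearDecay.

(** * Exponential decay of small solutions, and extension by clamping *)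

Section Assembly.
Variables (R : realType) (n : nat).
Local Notation V := 'rV[R]_n.
Implicit Types (x : R -> V) (v u z : V) (t s : R).

(** While [W < c d^2], the lower bound of [W] puts both arguments of the field within [d], where the
    nonlinear remainder costs at most half the decay rate. The weighted functional [g] then does not
    increase, which keeps [W] below the threshold: a bootstrap closed by [real_induction]. *)
Lemma decay (a k : R) (C : 'M[R]_n) (G : V -> V -> V)
    (W : (R -> V) -> R -> R) (c K : R) : 0 < c -> 0 < K ->
  (forall x : R -> V, continuous x ->
  [/\ continuous (W x),
      forall t, c * (`|x t| ^+ 2 + `|delay_mean x t| ^+ 2) <= W x t,
      forall t (r : R), (forall s, t - 1 <= s <= t -> `|x s| <= r) ->
        W x t <= K * r ^+ 2 &
      forall t v, is_derive t 1 x v -> exists2 w, is_derive t 1 (W x) w &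
        w <= - c * W x t
          + K * `|v + a *: x t + k *: delay_mean x t + x t *m C| ^+ 2]) ->
  (forall e : R, 0 < e -> exists2 d, 0 < d & forall v z, `|v| < d -> `|z| < d ->
    `|G v z + a *: v + k *: z + v *m C| <= e * (`|v| + `|z|)) ->
  exists2 w0, 0 < w0 & forall (T : R) x, 0 <= T -> continuous x ->
    (forall t, 0 < t < T -> is_derive t 1 x (G (x t) (delay_mean x t))) ->
    W x 0 < w0 -> W x T * expR (c / 2 * T) <= W x 0.
Proof.
move=> c0 K0 hW hG.
(* Chosen so that [K e^2 (X + Z)^2 <= 2 K e^2 (X^2 + Z^2) = (c / 2) c (X^2 + Z^2)], at most [c / 2]
   times the functional. *)
pose e := Num.sqrt (c ^+ 2 / (4 * K)).
have e20 : 0 < c ^+ 2 / (4 * K) by rewrite divr_gt0 ?exprn_gt0// mulr_gt0.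
have e0 : 0 < e by rewrite sqrtr_gt0.
have eE : e ^+ 2 = c ^+ 2 / (4 * K) by rewrite sqr_sqrtr// ltW.
have [d d0 hd] := hG e e0.
exists (c * d ^+ 2) => [|T x T0 cx dx Wx0]; first by rewrite mulr_gt0// exprn_gt0.
have [cW low _ dW] := hW x cx.
pose g t := W x t * expR (c / 2 * t).
have ce : continuous (fun t : R => expR (c / 2 * t)).
  exact/cont_lin_comp/continuous_expR.
have cg : continuous g by exact: cont_mulf.
have W0 t : 0 <= W x t.
  by apply: le_trans (low t); rewrite mulr_ge0 ?(ltW c0)// addr_ge0 ?sqr_ge0.
have dg t : 0 < t < T -> W x t < c * d ^+ 2 -> exists2 w, is_derive t 1 g w & w <= 0.
  move=> ht Wt; have [w hw1 hw2] := dW t _ (dx t ht).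
  have dexp : is_derive t 1 (fun t : R => expR (c / 2 * t)) (c / 2 * expR (c / 2 * t)).
    exact: derive_lin_comp (is_derive_expR _).
  exists (w * expR (c / 2 * t) + W x t * (c / 2 * expR (c / 2 * t))).
    exact: derive_mulf hw1 dexp.
  rewrite (_ : _ + _ = (w + c / 2 * W x t) * expR (c / 2 * t)); last by ring.
  rewrite mulr_le0_ge0 ?expR_ge0//.
  have lt := low t; set X := `|x t| in lt; set Z := `|delay_mean x t| in lt.
  have X0 : 0 <= X := normr_ge0 _; have Z0 : 0 <= Z := normr_ge0 _.
  have lt_d (y : R) : 0 <= y -> c * y ^+ 2 <= W x t -> y < d.
    move=> y0 hy; rewrite ltNge; apply/negP => dy.
    have : c * d ^+ 2 <= c * y ^+ 2.
      by rewrite ler_pM2l//; apply: sqr_le_sqr; rewrite gtr0_norm.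
    by move: hy Wt; clear; lra.
  have hX : X < d.
    by apply: lt_d => //; move: lt (mulr_ge0 (ltW c0) (sqr_ge0 Z)); clear; lra.
  have hZ : Z < d.
    by apply: lt_d => //; move: lt (mulr_ge0 (ltW c0) (sqr_ge0 X)); clear; lra.
  have := hd _ _ hX hZ; rewrite -/X -/Z; set rho := `|_| => hrho.
  have h1 : rho ^+ 2 <= (e * (X + Z)) ^+ 2 by apply: sqr_le_sqr; rewrite normr_id.
  have h2 : (X + Z) ^+ 2 <= 2 * (X ^+ 2 + Z ^+ 2).
    by have := sqr_ge0 (X - Z); clear; lra.
  have h3 : K * rho ^+ 2 <= c / 2 * W x t.
    apply: (@le_trans _ _ (K * (e ^+ 2 * (2 * (X ^+ 2 + Z ^+ 2))))).
      rewrite ler_pM2l//; apply: le_trans h1 _.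
      by rewrite exprMn ler_wpM2l// sqr_ge0.
    rewrite (_ : _ * _ = c / 2 * (c * (X ^+ 2 + Z ^+ 2))).
      by rewrite ler_pM2l// divr_gt0.
    by rewrite eE; field; rewrite gt_eqF.
  by move: hw2 h3; rewrite -/rho; clear; lra.
have step (b : R) : 0 <= b <= T -> (forall s, 0 <= s < b -> W x s < c * d ^+ 2) ->
    g b <= g 0.
  move=> /andP[b0 bT] hb.
  have hd' t : 0 < t < b -> 0 < t < T /\ W x t < c * d ^+ 2.
    move=> /andP[t0 tb]; rewrite t0 (lt_le_trans tb)//; split=> //.
    by apply: hb; rewrite ltW.
  (* Turns the pointwise existence of a nonpositive derivative into the function that [derive_le]
     expects; the default 0 is never reached on the interval. *)
  pose dd t := xget 0 [set w | is_derive t 1 g w /\ w <= 0].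
  have ddP t : 0 < t < b -> is_derive t 1 g (dd t) /\ dd t <= 0.
    move=> /hd' [h1 h2]; rewrite /dd; case: xgetP => [w -> //|].
    by have [w hw1 hw2] := dg t h1 h2 => /(_ w); case.
  apply: (@derive_le R g dd 0 b b0 (cont_within cg)) => t /ddP[] //.
have g0 : g 0 = W x 0 by rewrite /g mulr0 expR0 mulr1.
have W_le t : 0 <= t -> W x t <= g t.
  by move=> t0; rewrite /g ler_peMr// -expR0 ler_expR mulr_ge0// divr_ge0// ltW.
suff : g T <= g 0 by rewrite g0.
have hT : 0 <= T <= T by rewrite T0 lexx.
apply: (@real_induction _ (fun t => g t <= g 0) 0 T) hT => //.
- move=> t /andP[t0 tT] hP.
  have Wt : W x t < c * d ^+ 2.
    apply: le_lt_trans Wx0; rewrite -g0; apply: le_trans (W_le t t0) _.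
    by apply: hP; rewrite t0 lexx.
  have gap : 0 < c * d ^+ 2 - W x t by rewrite subr_gt0.
  have /cvgrPdist_lt /(_ _ gap) /nbhs_ballP[f /= f0 hf] := @cW t.
  exists f => // s /andP[ts sf] sT; apply: step => [|u /andP[u0 us]].
    by rewrite sT andbT (le_trans t0)// ltW.
  have [ut|ut] := leP u t.
    apply: le_lt_trans Wx0; rewrite -g0; apply: le_trans (W_le u u0) _.
    by apply: hP; rewrite u0 ut.
  have : `|W x t - W x u| < c * d ^+ 2 - W x t.
    apply: hf; rewrite /ball/= distrC gtr0_norm ?subr_gt0// ltrBlDl.
    exact: lt_trans sf.
  by rewrite distrC => /(le_lt_trans (ler_norm _)); rewrite ltrBrDr subrK.
- move=> t /andP[t0 tT] hP; apply: step => [|s hs]; first by rewrite ltW.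
  apply: le_lt_trans Wx0; rewrite -g0; apply: le_trans (W_le s _) (hP s hs).
  by case/andP: hs.
Qed.

Definition clamp (lo hi t : R) : R := Order.max lo (Order.min hi t).

Lemma clamp_in lo hi t : lo <= hi -> lo <= clamp lo hi t <= hi.
Proof.
by move=> lh; rewrite /clamp le_max lexx/= ge_max lh ge_min lexx.
Qed.

Lemma clamp_id lo hi t : lo <= t <= hi -> clamp lo hi t = t.
Proof. by move=> /andP[h1 h2]; rewrite /clamp min_r// max_r. Qed.

Lemma clamp_lip lo hi t s : `|clamp lo hi t - clamp lo hi s| <= `|t - s|.
Proof.
rewrite /clamp; have h1 := ler_norm (t - s); have h2 := ler_norm (s - t).
rewrite distrC in h2; rewrite ler_norml.
case: (leP hi t) => h3; case: (leP hi s) => h4; case: (leP lo hi) => h5;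
  case: (leP lo t) => h6; case: (leP lo s) => h7; move: h1 h2 h3 h4 h5 h6 h7; clear; lra.
Qed.

(** Constant continuation at both ends; functional and integrals are only handled for globally
    continuous functions. *)
Lemma within_clamp_continuous (x : R -> V) (lo hi : R) : lo <= hi ->
  {within `[lo, hi], continuous x} -> continuous (fun t => x (clamp lo hi t)).
Proof.
move=> lh cx t; apply/cvgrPdist_lt => e e0.
have tin : clamp lo hi t \in `[lo, hi] by rewrite in_itv/= clamp_in.
have tin' : `[lo, hi]%classic (clamp lo hi t) by [].
have : within `[lo, hi]%classic (nbhs (clamp lo hi t))
    [set u | `|x (clamp lo hi t) - x u| < e].
  rewrite (nbhs_subspace_in tin').
  by have /cvgrPdist_lt /(_ e e0) := @cx (clamp lo hi t).
move=> /nbhs_ballP[d /= d0 hd].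
apply/nbhs_ballP; exists d => // s hs; apply: hd.
  by rewrite /ball/=; apply: le_lt_trans hs; exact: clamp_lip.
by rewrite /= in_itv/= clamp_in.
Qed.

Lemma Rintegral_delay (u : R -> R) t : continuous u ->
  (\int[lebesgue_measure]_(s in `[0, 1]) u (t - s))%R = Int u (t - 1) t.
Proof.
move=> cu; rewrite Rintegral_Int//; last exact: cont_reflf.
by rewrite Int_reflect// subr0.
Qed.

End Assembly.

(** * Linearization at the origin and diagonalization of [C] *)

Section Remainder.
Variables (R : realType) (n : nat).
Local Notation V := 'rV[R]_n.
Implicit Types (v u z : V).

Lemma differentiable_remainder (h : V -> V) : h 0 = 0 -> differentiable h 0 ->
  forall e : R, 0 < e -> exists2 d, 0 < d &
    forall v, `|v| < d -> `|h v - v *m jacobian h 0| <= e * `|v|.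
Proof.
move=> h0 dh e e0; have := diff_locally dh => /eqaddoP /(_ e e0) /nbhs_ballP[d /= d0 hd].
exists d => // v vd; have : ball (0 : V) d v by rewrite -ball_normE /ball_/= sub0r normrN.
move=> /hd /=; rewrite /cst /=.
rewrite -[(_ - _) v]/(h (v + 0) - (h 0 + 'd h 0 v)) addr0 h0 add0r.
by rewrite /jacobian mul_rV_lin1.
Qed.

Lemma derive_remainder (f : R -> R) (b : R) : f 0 = 0 -> is_derive (0 : R) 1 f b ->
  forall e : R, 0 < e -> exists2 d, 0 < d &
    forall s, `|s| < d -> `|f s - b * s| <= e * `|s|.
Proof.
move=> f0 [df <-] e e0.
have dff : differentiable f 0 by apply/derivable1_diffP.
have := diff_locally dff => /eqaddoP /(_ e e0) /nbhs_ballP[d /= d0 hd].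
exists d => // s sd; have : ball (0 : R) d s by rewrite /ball/= sub0r normrN.
move=> /hd /=; rewrite /cst /=.
rewrite -[(_ - _) s]/(f (s + 0) - (f 0 + 'd f 0 s)) addr0 f0 add0r.
by rewrite -derive1E diff1E// [s *: _]mulrC.
Qed.

(** The isotypic components fill the space, hence so do the eigenspaces they coincide with. The
    eigenvectors form the rows of the diagonalizing matrix, so its inverse is the [P] acting on row
    vectors from the right. *)
Lemma isotypic_diagonalization (C : 'M[R]_n) (gT : finGroupType)
    (G : {group gT}) (rG : mx_representation R G n) (r : nat) (mu : 'I_r.+1 -> R)
    (W : 'I_r.+1 -> 'M[R]_n) :
  injective mu -> isotypic_decomposition rG W ->
  (forall j, (eigenspace C (mu j) :=: W j)%MS) ->
  exists (P : 'M[R]_n) (d : 'rV[R]_n),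
    [/\ P \in unitmx, C *m P = P *m diag_mx d & forall i, eigenvalue C (d 0 i)].
Proof.
move=> mu_inj [_ _ W1] We.
have sumE : (\sum_(j <- codom mu) eigenspace C j :=: 1%:M)%MS.
  apply: eqmx_trans W1; rewrite big_map big_enum/=.
  by apply: eqmx_sums => j _; exact: We.
have /diagonalizablePeigen [P Pu] : exists2 rs, uniq rs &
    (\sum_(r <- rs) eigenspace C r :=: 1%:M)%MS.
  by exists (codom mu) => //; rewrite map_inj_uniq ?enum_uniq.
move=> /diagonalizable_forPex[d /(simmxP Pu) PC].
exists (invmx P), d; split=> [||i]; first by rewrite unitmx_inv.
  rewrite -[C in LHS]mul1mx -(mulVmx Pu) -!mulmxA (mulmxA P) PC.
  by rewrite -mulmxA mulmxV// mulmx1.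
apply/eigenvalueP; exists (row i P); last first.
  apply/negP => /eqP r0; have : row i (P *m invmx P) = 0 by rewrite row_mul r0 mul0mx.
  rewrite mulmxV// => /rowP /(_ i); rewrite !mxE eqxx => /eqP.
  by rewrite oner_eq0.
by rewrite -row_mul PC row_mul row_diag_mx -scalemxAl -rowE.
Qed.

End Remainder.

(** * The consensus field and its truncation to the unit ball *)

Section Truncation.
Variables (R : realType) (n : nat).
Local Notation V := 'rV[R]_n.
Implicit Types (v u z : V) (x y : R -> V) (t s : R) (h : V -> V).

Definition consensus_field (a al : R) (f : R -> R) h v z : V :=
  - (a *: v) - al *: componentwise f z - h v.

(** Agreement on the window suffices, so a solution on a bounded interval can be exchanged for its
    clamped extension. *)
Lemma consensus_rhsE (a al : R) (f : R -> R) h x y t : continuous y ->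
  (forall s, t - 1 <= s <= t -> x s = y s) ->
  consensus_rhs a al f h x t = consensus_field a al f h (y t) (delay_mean y t).
Proof.
move=> cy xy; have xyt : x t = y t by apply: xy; rewrite lexx andbT gerBl.
rewrite /consensus_rhs /consensus_field xyt; congr (_ - _ *: componentwise f _ - _).
apply/rowP => i; rewrite !mxE -(Rintegral_delay t (@row_continuous_coord R n y i cy)).
apply: eq_Rintegral => s; rewrite inE/= in_itv/= => /andP[s0 s1].
by rewrite xy//; move: s0 s1; clear; lra.
Qed.

(** For the maximum norm, clamping each coordinate is a 1-Lipschitz retraction onto the closed unit
    ball. *)
Definition truncate v : V := map_mx (clamp (- 1) 1) v.

Lemma truncate_norm v : `|truncate v| <= 1.
Proof.
apply: row_norm_le => // i; rewrite mxE ler_norml; apply: clamp_in.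
by lra.
Qed.

Lemma truncate_id v : `|v| <= 1 -> truncate v = v.
Proof.
move=> v1; apply/rowP => i; rewrite mxE clamp_id// -ler_norml.
exact: le_trans (row_coord_le _ _) v1.
Qed.

Lemma truncate_lip v u : `|truncate v - truncate u| <= `|v - u|.
Proof.
apply: row_norm_le => // i; rewrite !mxE; apply: le_trans (clamp_lip _ _ _ _) _.
by have := row_coord_le (v - u) i; rewrite !mxE.
Qed.

Lemma truncate_comp_continuous h : continuous h -> forall v (e : R), 0 < e ->
  exists2 d, 0 < d & forall u, `|u - v| < d ->
    `|h (truncate u) - h (truncate v)| < e.
Proof.
move=> ch v e e0; have /cvgrPdist_lt /(_ e e0) /nbhs_ballP[d /= d0 hd] := @ch (truncate v).
exists d => // u hu; rewrite distrC; apply: hd; rewrite -ball_normE /ball_/= distrC.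
exact: le_lt_trans (truncate_lip _ _) hu.
Qed.

Lemma truncate_comp_bounded h : continuous h ->
  exists2 M, 0 < M & forall v, `|h (truncate v)| <= M.
Proof.
move=> ch; pose A := [set v : V | `|v| <= 1].
have cA : compact A.
  apply: bounded_closed_compact.
    exists 1; split; first exact: num_real.
    by move=> x Mx v /= /le_trans; apply; exact: ltW.
  exact: (preimage_closed (fun v _ => @norm_continuous _ _ v) (@closed_le R 1)).
have A0 : A !=set0 by exists 0; rewrite /A/= normr0.
have cn : {within A, continuous (fun v => `|h v|)}.
  by apply: continuous_subspaceT => v; exact: cvg_norm (@ch v).
have [v0 _ hv0] := EVT_max_rV A0 cA cn.
exists (`|h v0| + 1) => [|v]; first by rewrite ltr_wpDl.
apply: le_trans (hv0 (truncate v) _) _; last by rewrite lerDl.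
by rewrite inE; exact: truncate_norm.
Qed.

Lemma consensus_field_remainder (a al b : R) (f : R -> R) h : 0 < al ->
  h 0 = 0 -> differentiable h 0 -> f 0 = 0 -> is_derive (0 : R) 1 f b ->
  forall e : R, 0 < e -> exists2 d, 0 < d & forall v z, `|v| < d -> `|z| < d ->
    `|consensus_field a al f h v z + a *: v + (al * b) *: z + v *m jacobian h 0|
      <= e * (`|v| + `|z|).
Proof.
move=> al0 h0 dh f0 df e e0.
have ea : 0 < e / al by rewrite divr_gt0.
have [d1 d10 hd1] := differentiable_remainder h0 dh e0.
have [d2 d20 hd2] := derive_remainder f0 df ea.
exists (Order.min d1 d2) => [|v z]; first by rewrite lt_min d10.
rewrite !lt_min => /andP[v1 _] /andP[_ z2].
rewrite (_ : _ + _ = - (h v - v *m jacobian h 0)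
    - al *: (componentwise f z - b *: z)); last first.
  rewrite /consensus_field scalerBr scalerA.
  by apply/matrixP => i j; rewrite !mxE; ring.
apply: le_trans (ler_normB _ _) _; rewrite normrN mulrDr lerD ?hd1//.
have -> : e * `|z| = al * (e / al * `|z|) by field; rewrite gt_eqF.
rewrite normrZ gtr0_norm// ler_pM2l//; apply: row_norm_le => [|i].
  by rewrite mulr_ge0// ltW.
rewrite !mxE; have zi := row_coord_le z i.
apply: le_trans (hd2 _ (le_lt_trans zi z2)) _.
by rewrite ler_pM2l.
Qed.

Lemma truncated_field_continuous (a al : R) (f : R -> R) h :
  continuous (@componentwise R n f) -> continuous h ->
  forall v z (e : R), 0 < e -> exists2 d, 0 < d & forall v' z',
    `|v' - v| < d -> `|z' - z| < d ->
    `|consensus_field a al f h (truncate v') (truncate z')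
      - consensus_field a al f h (truncate v) (truncate z)| <= e.
Proof.
move=> cf ch v z e e0.
have e3 : 0 < e / 3 by rewrite divr_gt0.
have ea : 0 < e / 3 / (1 + `|a|) by rewrite divr_gt0// ltr_wpDr.
have el : 0 < e / 3 / (1 + `|al|) by rewrite divr_gt0// ltr_wpDr.
have [d1 d10 hd1] := truncate_comp_continuous ch v e3.
have [d2 d20 hd2] := truncate_comp_continuous cf z el.
exists (Order.min (e / 3 / (1 + `|a|)) (Order.min d1 d2)) => [|v' z'].
  by rewrite !lt_min ea d10.
rewrite !lt_min => /and3P[v1 v2 _] /and3P[_ _ z2].
pose F := @componentwise R n f.
rewrite (_ : _ - _ = - (a *: (truncate v' - truncate v))
    - al *: (F (truncate z') - F (truncate z))
    - (h (truncate v') - h (truncate v))); last first.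
  rewrite /consensus_field -/F !scalerBr.
  by apply/matrixP => i j; rewrite !mxE; ring.
have b1 : `|a *: (truncate v' - truncate v)| <= e / 3.
  rewrite normrZ; have -> : e / 3 = (1 + `|a|) * (e / 3 / (1 + `|a|)).
    by rewrite [RHS]mulrC divfK// gt_eqF// ltr_wpDr.
  apply: ler_pM => //; first by rewrite lerDr.
  exact: le_trans (truncate_lip _ _) (ltW v1).
have b2 : `|al *: (F (truncate z') - F (truncate z))| <= e / 3.
  rewrite normrZ; have -> : e / 3 = (1 + `|al|) * (e / 3 / (1 + `|al|)).
    by rewrite [RHS]mulrC divfK// gt_eqF// ltr_wpDr.
  by apply: ler_pM => //; [rewrite lerDr|exact/ltW/hd2].
have b3 := ltW (hd1 _ v2).
apply: le_trans (ler_normB _ _) _.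
have := ler_normB (- (a *: (truncate v' - truncate v)))
  (al *: (F (truncate z') - F (truncate z))).
by rewrite normrN; move: b1 b2 b3; clear; lra.
Qed.

Lemma truncated_field_bounded (a al : R) (f : R -> R) h :
  continuous (@componentwise R n f) -> continuous h ->
  exists2 M, 0 < M & forall v z,
    `|consensus_field a al f h (truncate v) (truncate z)| <= M.
Proof.
move=> cf ch.
have [M1 M10 hM1] := truncate_comp_bounded cf.
have [M2 M20 hM2] := truncate_comp_bounded ch.
exists (`|a| + `|al| * M1 + M2) => [|v z].
  by rewrite ltr_wpDl// addr_ge0// mulr_ge0// ltW.
apply: le_trans (ler_normB _ _) _; apply: lerD (hM2 v).
apply: le_trans (ler_normB _ _) _; rewrite normrN; apply: lerD.
  by rewrite normrZ ler_piMr// truncate_norm.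
by rewrite normrZ ler_wpM2l.
Qed.

(** The derivative of the map in the direction [(1, ..., 1)] has the derivative of [f] in every
    coordinate. *)
Lemma componentwise_derive (f : R -> R) (i : 'I_n) :
  differentiable (@componentwise R n f) 0 -> is_derive (0 : R) 1 f (derive1 f 0).
Proof.
move=> df; have dv := @diff_derivable _ _ _ (@componentwise R n f) 0 (const_mx 1) df.
have /derivable_mxP /(_ 0 i) := dv.
rewrite /derivable => h; rewrite derive1E; apply: derivableP; rewrite /derivable.
move: h; rewrite (_ : (fun s : R => _) = fun s : R => s^-1 *: ((f \o shift 0) (s *: (1 : R)) - f 0)) //.
by apply/funext => s /=; rewrite !mxE.
Qed.

End Truncation.

(** * Stability and attractivity from the decay of the functional *)

Section DelayStability.
Variables (R : realType) (n : nat).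
Local Notation V := 'rV[R]_n.
Variables (rhs : (R -> V) -> R -> V) (G : V -> V -> V).
Variables (W : (R -> V) -> R -> R) (c K : R).
Hypotheses (c_gt0 : 0 < c) (K_gt0 : 0 < K).
Hypothesis rhsE : forall (x y : R -> V) t, continuous y ->
  (forall s, t - 1 <= s <= t -> x s = y s) -> rhs x t = G (y t) (delay_mean y t).
Hypothesis W_lower : forall (x : R -> V), continuous x -> forall t,
  c * (`|x t| ^+ 2 + `|delay_mean x t| ^+ 2) <= W x t.
Hypothesis W_upper : forall (x : R -> V), continuous x -> forall t (r : R),
  (forall s, t - 1 <= s <= t -> `|x s| <= r) -> W x t <= K * r ^+ 2.

Let decays (F : V -> V -> V) (w0 : R) := forall (T : R) (x : R -> V),
  0 <= T -> continuous x ->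
  (forall t, 0 < t < T -> is_derive t 1 x (F (x t) (delay_mean x t))) ->
  W x 0 < w0 -> W x T * expR (c / 2 * T) <= W x 0.

(** Freezing the solution outside [[-1, t]] makes it globally continuous without changing it up to
    time [t], so the decay estimate holds for every solution, whatever its lifetime [T]. *)
Lemma solution_decay (w0 delta : R) (phi : R -> V) (T : \bar R) (x : R -> V) :
  decays G w0 -> K * delta ^+ 2 < w0 -> near_history 0 delta phi ->
  dde_solution rhs phi T x -> forall t : R, 0 <= t -> (t%:E < T)%E ->
    c * `|x t| ^+ 2 * expR (c / 2 * t) <= K * delta ^+ 2.
Proof.
move=> dec Kd [_ nphi] [_ xphi cx dx] t t0 tT.
have m1t : -1 <= t by move: t0; lra.
have cy : continuous (fun s => x (clamp (-1) t s)).
  apply: within_clamp_continuous => //; apply: continuous_subspaceW cx => s /=.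
  rewrite in_itv/= => /andP[s1 s2]; split=> //.
  by apply: le_lt_trans tT; rewrite lee_fin.
set y := fun s => x (clamp (-1) t s) in cy.
have yE s : -1 <= s <= t -> x s = y s by move=> hs; rewrite /y clamp_id.
have dy s : 0 < s < t -> is_derive s 1 y (G (y s) (delay_mean y s)).
  move=> /andP[s0 st].
  have sT : (s%:E < T)%E by apply: lt_trans tT; rewrite lte_fin.
  have := dx s s0 sT; rewrite (rhsE cy); last first.
    by move=> u /andP[u1 u2]; apply: yE; move: s0 st u1 u2; lra.
  apply: near_eq_is_derive.
  have sin : s \in `]0, t[ by rewrite in_itv/= s0.
  apply: filterS (near_in_itvoo sin) => u; rewrite in_itv/= => /andP[u0 ut].
  by apply: yE; move: u0 ut; lra.
have Wy0 : W y 0 <= K * delta ^+ 2.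
  apply: (W_upper cy) => s /andP[]; rewrite sub0r => s1 s0.
  have sI : s \in `[(-1 : R), 0] by rewrite in_itv/= s1.
  rewrite -yE; last by rewrite s1 (le_trans s0).
  by rewrite (xphi s sI) -[phi s]subr0 ltW// nphi.
have Wyt := dec t y t0 cy dy (le_lt_trans Wy0 Kd).
apply: le_trans (le_trans Wyt Wy0); rewrite ler_pM2r ?expR_gt0//.
rewrite (yE t) ?m1t ?lexx//; apply: le_trans (W_lower cy t).
by rewrite ler_pM2l// lerDl sqr_ge0.
Qed.

(** The truncated field has a global solution; decay keeps its functional below [c], so its value
    and window integral stay in the unit ball, where both fields agree. *)
Lemma truncated_solution (w1 delta M : R) (phi : R -> V) :
  let F v z := G (truncate v) (truncate z) in
  decays F w1 -> 0 < M ->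
  (forall v z (e : R), 0 < e -> exists2 d, 0 < d & forall v' z',
    `|v' - v| < d -> `|z' - z| < d -> `|F v' z' - F v z| <= e) ->
  (forall v z, `|F v z| <= M) ->
  K * delta ^+ 2 < w1 -> K * delta ^+ 2 < c -> near_history 0 delta phi ->
  exists x, dde_solution rhs phi +oo%E x.
Proof.
move=> F dec M0 cF bF Kw1 Kc [cphi nphi].
have m10 : (-1 : R) <= 0 by lra.
have cpsi := within_clamp_continuous m10 cphi.
have bpsi t : `|phi (clamp (-1) 0 t)| <= delta.
  by rewrite -[phi _]subr0 ltW// nphi// in_itv/= clamp_in.
have [x [cx x0 dx]] := peano_delay cF M0 bF cpsi bpsi.
exists x; split; first by [].
- by move=> s; rewrite in_itv/= => hs; rewrite x0 ?clamp_id//; case/andP: hs.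
- exact: continuous_subspaceT.
move=> t t0 _; rewrite (rhsE cx)//.
have Wx0 : W x 0 <= K * delta ^+ 2.
  by apply: (W_upper cx) => s /andP[_ s0]; rewrite x0.
have Wt : W x t <= W x 0.
  apply: le_trans (dec t x (ltW t0) cx _ (le_lt_trans Wx0 Kw1)); last first.
    by move=> s /andP[s0 _]; exact: dx.
  apply: ler_peMr.
    apply: le_trans (W_lower cx t); apply: mulr_ge0; first exact: ltW.
    by rewrite addr_ge0 ?sqr_ge0.
  by rewrite -expR0 ler_expR mulr_ge0 ?(ltW t0)// divr_ge0// ltW.
have small : `|x t| ^+ 2 + `|delay_mean x t| ^+ 2 < 1.
  rewrite -(ltr_pM2l c_gt0) mulr1; apply: le_lt_trans (W_lower cx t) _.
  exact: le_lt_trans Wt (le_lt_trans Wx0 Kc).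
have le1 (u : R) : 0 <= u -> u ^+ 2 < 1 -> u <= 1.
  by move=> u0; rewrite -{1}(expr1n R 2) ltr_pXn2r// ?nnegrE// => /ltW.
have hx : `|x t| <= 1.
  by apply: le1 => //; move: small (sqr_ge0 `|delay_mean x t|); lra.
have hz : `|delay_mean x t| <= 1.
  by apply: le1 => //; move: small (sqr_ge0 `|x t|); lra.
by have := dx t t0; rewrite -/(delay_mean x t) /F !truncate_id.
Qed.

Lemma lyapunov_stability (w0 w1 M : R) :
  let F v z := G (truncate v) (truncate z) in
  0 < w0 -> 0 < w1 -> decays G w0 -> decays F w1 -> 0 < M ->
  (forall v z (e : R), 0 < e -> exists2 d, 0 < d & forall v' z',
    `|v' - v| < d -> `|z' - z| < d -> `|F v' z' - F v z| <= e) ->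
  (forall v z, `|F v z| <= M) ->
  locally_asymptotically_stable rhs 0.
Proof.
move=> F w00 w10 dec decF M0 cF bF.
have radius (m : R) : 0 < m -> exists2 delta, 0 < delta & K * delta ^+ 2 < m.
  move=> m0; exists (Num.sqrt (m / (2 * K))).
    by rewrite sqrtr_gt0 divr_gt0// mulr_gt0.
  rewrite sqr_sqrtr; last by rewrite ltW// divr_gt0// mulr_gt0.
  have -> : K * (m / (2 * K)) = m / 2 by field; rewrite gt_eqF.
  by move: m0; lra.
split=> [eps eps0|].
  have [|d d0] := radius (Order.min (Order.min w0 w1) (Order.min c (c * eps ^+ 2))).
    by rewrite !lt_min w00 w10 c_gt0 mulr_gt0 ?exprn_gt0.
  rewrite !lt_min => /andP[/andP[dw0 dw1] /andP[dc deps]].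
  exists d => // phi nphi; split.
    exact: (truncated_solution decF M0 cF bF dw1 dc nphi).
  move=> T x sx t t0 tT; rewrite subr0.
  have h := solution_decay dec dw0 nphi sx t0 tT.
  have : `|x t| ^+ 2 < eps ^+ 2.
    rewrite -(ltr_pM2l c_gt0); apply: le_lt_trans deps; apply: le_trans h.
    apply: ler_peMr; first by rewrite mulr_ge0 ?sqr_ge0// ltW.
    by rewrite -expR0 ler_expR mulr_ge0// divr_ge0// ltW.
  by rewrite ltr_pXn2r ?nnegrE ?normr_ge0 ?(ltW eps0).
have [d d0 dw0] := radius _ w00.
exists d => // phi nphi x sx; apply/cvgrPdist_lt => e e0.
pose A := K * d ^+ 2.
have A0 : 0 < A by rewrite mulr_gt0// exprn_gt0.
have ce0 : 0 < c * e ^+ 2 by rewrite mulr_gt0// exprn_gt0.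
have c20 : 0 < c / 2 by rewrite divr_gt0.
(* Beyond this time [1 + c t / 2], hence [expR (c / 2 * t)], exceeds [A / (c e^2)]. *)
have T0 : 0 <= A / (c * e ^+ 2) / (c / 2) by rewrite !divr_ge0// ltW.
exists (A / (c * e ^+ 2) / (c / 2)); split; first exact: num_real.
move=> t tT /=; have t0 : 0 <= t by rewrite (le_trans T0)// ltW.
have h := solution_decay dec dw0 nphi sx t0 (ltry t).
rewrite sub0r normrN; suff : `|x t| ^+ 2 < e ^+ 2.
  by rewrite ltr_pXn2r ?nnegrE ?normr_ge0 ?(ltW e0).
rewrite -(ltr_pM2l c_gt0) -(ltr_pM2r (expR_gt0 (c / 2 * t))).
apply: le_lt_trans h _; rewrite [ltRHS]mulrC -ltr_pdivrMr//.
apply: lt_le_trans (expR_ge1Dx _).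
move: tT; rewrite ltr_pdivrMr// [ltRHS]mulrC => tT.
by apply: lt_trans tT _; rewrite ltrDr.
Qed.

End DelayStability.

Theorem theorem4p1p1 (R : realType) (n : nat) (n_gt0 : (0 < n)%N)
  (Gamma0 : {group 'S_n}) (a : R) (a_gt0 : 0 < a)
  (f : R -> R) (h : 'rV[R]_n -> 'rV[R]_n)
  (f_odd : forall x : 'rV[R]_n, componentwise f (- x) = - componentwise f x)
  (h_odd : forall x : 'rV[R]_n, h (- x) = - h x)
  (f_cont : continuous (@componentwise R n f))
  (h_cont : continuous h)
  (f_diff : differentiable (@componentwise R n f) 0)
  (h_diff : differentiable h 0)
  (b : R) (b_def : b = derive1 f 0) (b_gt0 : 0 < b)
  (C : 'M[R]_n) (C_def : C = jacobian h 0) (C_sym : C^T = C)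
  (h_equiv : forall s : 'S_n, s \in Gamma0 ->
     forall x : 'rV[R]_n, h (col_perm s x) = col_perm s (h x))
  (r : nat) (mu : 'I_r.+1 -> R) (mu_inj : injective mu)
  (mu_spec : forall lam : R, eigenvalue C lam <-> exists j, lam = mu j)
  (V : 'I_r.+1 -> 'M[R]_n)
  (V_iso : isotypic_decomposition (perm_sign_repr R Gamma0) V)
  (V_eig : forall j, (eigenspace C (mu j) :=: V j)%MS)
  (alphahat : R)
  (alphahat_crit : critical_alphas a b mu alphahat)
  (alphahat_min : lbound (critical_alphas a b mu) alphahat)
  (aj_gt0 : forall j, 0 < a + mu j) :
  forall alpha : R, 0 < alpha -> alpha < alphahat ->
    locally_asymptotically_stable (consensus_rhs a alpha f h) 0.
Proof.
move=> al al_gt0 al_lt.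
have f0 : f 0 = 0.
  have /rowP /(_ (Ordinal n_gt0)) := f_odd 0; rewrite oppr0 !mxE => h0.
  by move: h0; lra.
have h0 : h 0 = 0.
  apply/rowP => i; have /rowP /(_ i) := h_odd 0.
  by rewrite oppr0 !mxE => h0; move: h0; lra.
have df : is_derive (0 : R) 1 f b.
  by rewrite b_def; exact: componentwise_derive (Ordinal n_gt0) f_diff.
have k_gt0 : 0 < al * b by rewrite mulr_gt0.
have [P [d [Pu CP dC]]] := isotypic_diagonalization mu_inj V_iso V_eig.
have dmu i : exists j, d 0 i = mu j by apply/mu_spec.
have ad i : 0 < a + d 0 i by have [j ->] := dmu i.
have weights i : exists c0 c1 c2 c3 c4,
    stumpff (2 * (al * b) - (a + d 0 i) ^+ 2) c0 c1 c2 c3 c4 /\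
    forall s, 0 < s <= 2^-1 -> 0 < (a + d 0 i) * c1 s + c0 s.
  apply: stable_parameters => // beta beta_gt0 sb betaE.
  have [j dj] := dmu i; rewrite dj in betaE *.
  have A_gt0 := aj_gt0 j; set A := a + mu j in betaE A_gt0 *.
  (* Since [cos beta - 1 <= 0] and [beta > 0], the equation for [beta] forces this sign; it makes
     the candidate value positive, hence a member of the critical set and at least [alphahat]. *)
  have sb_lt0 : sin beta < 0.
    rewrite lt_neqAle sb leNgt; apply/negP => sb_gt0.
    move: beta_gt0; rewrite betaE; apply/negP; rewrite -leNgt.
    by rewrite mulr_le0_ge0 ?invr_ge0 ?(ltW sb_gt0)// mulr_ge0_le0 ?(ltW A_gt0)// subr_le0 cos_le1.
  have critE : - A * beta / (b * sin beta) = (- A * beta / sin beta) / b.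
    by field; rewrite sb gt_eqF.
  have crit : critical_alphas a b mu (- A * beta / (b * sin beta)).
    split; last by exists j, beta.
    rewrite critE divr_gt0// nmulr_rgt0 ?invr_lt0//.
    by rewrite mulNr oppr_lt0 mulr_gt0.
  rewrite -ltr_pdivlMr// -critE; apply: lt_le_trans al_lt _.
  exact: alphahat_min.
have [W [c [K [c_gt0 K_gt0 hW]]]] := vector_lyapunov k_gt0 Pu CP ad weights.
rewrite C_def in hW.
have rem := consensus_field_remainder a al_gt0 h0 h_diff f0 df.
have [w0 w0_gt0 dec] := decay c_gt0 K_gt0 hW rem.
(* Truncation is the identity near 0, so the truncated field has the same linearization and the same
   functional applies. *)
have [|w1 w1_gt0 decF] := @decay R n a (al * b) (jacobian h 0)
    (fun v z => consensus_field a al f h (truncate v) (truncate z)) W c K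
    c_gt0 K_gt0 hW.
  move=> e e0; have [r0 r0_gt0 hr] := rem e e0.
  exists (Order.min r0 1) => [|v z]; first by rewrite lt_min r0_gt0 ltr01.
  rewrite !lt_min => /andP[v1 /ltW v2] /andP[z1 /ltW z2].
  by rewrite !truncate_id// hr.
have [M M_gt0 bM] := truncated_field_bounded a al f_cont h_cont.
apply: (lyapunov_stability c_gt0 K_gt0 _ _ _ w0_gt0 w1_gt0 dec decF M_gt0 _ bM).
- by move=> x y t cy xy; exact: consensus_rhsE.
- by move=> x /hW[].
- by move=> x /hW[].
- exact: truncated_field_continuous.
Qed.
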